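(* Let $S$ and $U$ be compact metric spaces, let $p(dy|x,u)$ be a transition kernel from $S\times U$ to $S$, and let $r:S\times U\times S\to[-\infty,\infty)$, such that: (A0) the function $(x,u,y)\mapsto e^{r(x,u,y)}$ is continuous on $S\times U\times S$ (with $e^{-\infty}=0$); (A1) the family of maps $(x,u)\mapsto\int f(y)\,p(dy|x,u)$, indexed by $f\in C(S)$ with $\|f\|\le 1$, is equicontinuous on $S\times U$. Then the optimal growth rate of reward $$\lambda:=\sup_{x\in S}\ \sup\ \liminf_{N\to\infty}\frac1N\log E\left[e^{\sum_{m=0}^{N-1}r(X_m,Z_m,X_{m+1})}\,\Big|\,X_0=x\right],$$ where the second supremum is over all admissible controls, satisfies $$\lambda=\sup_{\eta\in\mathcal G}\left(\iiint\eta(dx,du,dy)\,r(x,u,y)-\iint\tilde\eta(dx,du)\,D\big(\eta_2(dy|x,u)\,\|\,p(dy|x,u)\big)\right).$$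
   Context: $C(S)$ is the space of continuous real functions on $S$ with supremum norm $\|\cdot\|$; $\mathcal P(\mathcal X)$ is the set of Borel probability measures on a compact metric space $\mathcal X$. A kernel $p(dy|x,u)$ assigns to each $(x,u)\in S\times U$ a probability measure in $\mathcal P(S)$, with $p(A|x,u)$ Borel measurable in $(x,u)$ for each Borel $A\subset S$; kernels between other spaces are defined likewise. Controlled Markov process: $(X_n)_{n\ge0}$ is $S$-valued and $(Z_n)_{n\ge0}$ is $U$-valued. An admissible control is given by a sequence of (measurable) kernels $\phi_n$, $n\ge 0$, where $\phi_n(du|x_0,u_0,\dots,x_{n-1},u_{n-1},x_n)\in\mathcal P(U)$ is the conditional law of $Z_n$ given $(X_0,Z_0,\dots,X_{n-1},Z_{n-1},X_n)$; the conditional law of $X_{n+1}$ given $(X_0,Z_0,\dots,X_n,Z_n)$ is $p(dy|X_n,Z_n)$. Together with the initial state $X_0=x$ these determine the law of $((X_n,Z_n))_{n\ge0}$, and $E[\cdot|X_0=x]$ is the corresponding expectation. Convention: $\log 0=-\infty$. For $\eta\in\mathcal P(S\times U\times S)$ write the disintegration $\eta(dx,du,dy)=\eta_0(dx)\eta_1(du|x)\eta_2(dy|x,u)=\tilde\eta(dx,du)\eta_2(dy|x,u)$, so $\eta_0$ is the marginal on the first coordinate and $\tilde\eta$ the marginal on the first two coordinates. $\mathcal G$ is the set of those $\eta\in\mathcal P(S\times U\times S)$ such that $\eta_0$ is invariant under the transition kernel $\int_U\eta_2(dy|x,u)\eta_1(du|x)$, i.e. $\int\tilde\eta(dx,du)\,\eta_2(dy|x,u)=\eta_0(dy)$.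 Relative entropy: for finite nonnegative Borel measures $\mu,\nu$ on a compact metric space, $D(\mu\|\nu):=\int\mu(dx)\log l(x)$ if $\mu(dx)=l(x)\nu(dx)$ for some density $l$, and $D(\mu\|\nu):=\infty$ otherwise. Since $r$ is bounded above and relative entropy between probability measures is nonnegative, the expression in parentheses is well defined in $[-\infty,\infty)$. *)

(* Defs.v *)
From HB Require Import structures.
From mathcomp Require Import all_boot all_order all_algebra.
From mathcomp Require Import all_classical all_reals all_analysis.
From mathcomp Require Import measurable_realfun.

Set Implicit Arguments.
Unset Strict Implicit.
Unset Printing Implicit Defensive.

Import Order.TTheory GRing.Theory Num.Theory.
Import numFieldNormedType.Exports.

Local Open Scope classical_set_scope.
Local Open Scope ring_scope.
Local Open Scope ereal_scope.

(* A metric space whose sigma-algebra is the Borel one. Being a measurableType,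
   it is pointed, hence nonempty. On a product of two such types that are
   compact (hence second countable), the product sigma-algebra provided by the
   library is the Borel sigma-algebra of the product topology. *)
HB.mixin Record isBorel (d : measure_display) (R : numDomainType) T
    & Metric R T & Measurable d T := {
  borel_measurableE : @measurable d T = <<s @open T >> }.

#[short(type="borelMetricType")]
HB.structure Definition BorelMetric d R :=
  { T of Metric R T & Measurable d T & isBorel d R T }.

Section controlled_process.
Context {dS dU : measure_display} {S : measurableType dS}
  {U : measurableType dU} {R : realType}.

(* ((x_0, u_0), ..., (x_{n-1}, u_{n-1})) together with the current state x_n *)
Definition history n := (n.-tuple (S * U) * S)%type.

Definition control_policy := forall n, R.-pker (history n) ~> U.

Definition hist_rcons n (h : history n) (u : U) (y : S) : history n.+1 :=
  ([tuple of rcons h.1 (h.2, u)], y).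

(* x_m, for m <= n; for m = n the default of nth returns the current state *)
Definition hist_state n (h : history n) (m : nat) : S :=
  nth h.2 (unzip1 h.1) m.

Definition hist_control n (h : history n) (m : 'I_n) : U := (tnth h.1 m).2.

Lemma measurable_hist_rcons n : measurable_fun [set: history n * U * S]
  (fun z => hist_rcons z.1.1 z.1.2 z.2).
Proof.
apply/measurable_fun_pairP; split => /=; last exact: measurable_snd.
apply/measurable_fun_tnthP => i /=.
have [ilt|ige] := ltnP i n.
  rewrite (_ : _ \o _ = (fun t : n.-tuple (S * U) => tnth t (Ordinal ilt)) \o
     (fun z : history n * U * S => z.1.1.1)); last first.
    apply/funext => z /=.
    rewrite (tnth_nth (z.1.1.2, z.1.2)) [RHS](tnth_nth (z.1.1.2, z.1.2)) /=.
    by rewrite nth_rcons size_tuple ilt.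
  apply: measurableT_comp; first exact: measurable_tnth.
  apply: (measurableT_comp measurable_fst).
  exact: (measurableT_comp measurable_fst measurable_fst).
rewrite (_ : _ \o _ = fun z : history n * U * S => (z.1.1.2, z.1.2)).
  apply/measurable_fun_pairP; split => /=.
    apply: (measurableT_comp measurable_snd).
    exact: (measurableT_comp measurable_fst measurable_fst).
  exact: (measurableT_comp measurable_snd measurable_fst).
apply/funext => z /=.
rewrite (tnth_nth (z.1.1.2, z.1.2)) /= nth_rcons size_tuple ltnNge ige /=.
by rewrite if_same.
Qed.

Variable p : R.-pker (S * U) ~> S.

Section step.
Context {n : nat} (phi : R.-pker (history n) ~> U).

Let q (hu : history n * U) : {measure set S -> \bar R} := p (hu.1.2, hu.2).

Let measurable_q A : measurable A -> measurable_fun [set: history n * U] (q ^~ A).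
Proof.
move=> mA; rewrite (_ : (fun _ => _) =
  (p ^~ A) \o (fun hu : history n * U => (hu.1.2, hu.2)))//.
apply: measurableT_comp; first exact: measurable_kernel.
apply/measurable_fun_pairP; split => /=.
  exact: (measurableT_comp measurable_snd measurable_fst).
exact: measurable_snd.
Qed.

HB.instance Definition _ := isKernel.Build _ _ _ _ _ q measurable_q.

Let q_prob hu : q hu [set: S] = 1. Proof. exact: prob_kernel. Qed.

HB.instance Definition _ := Kernel_isProbability.Build _ _ _ _ _ q q_prob.

Let q_rcons (A : set (history n.+1)) (hu : history n * U) : \bar R :=
  q hu (hist_rcons hu.1 hu.2 @^-1` A).

Let preimage_rcons (A : set (history n.+1)) hu :
  hist_rcons hu.1 hu.2 @^-1` A =
  xsection ((fun z => hist_rcons z.1.1 z.1.2 z.2) @^-1` A) hu.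
Proof. by rewrite xsectionE. Qed.

Let measurable_preimage (A : set (history n.+1)) : measurable A ->
  measurable ((fun z : history n * U * S => hist_rcons z.1.1 z.1.2 z.2) @^-1` A).
Proof.
by move=> mA; rewrite -[X in measurable X]setTI; exact: measurable_hist_rcons.
Qed.

Let measurable_preimage_rcons (A : set (history n.+1)) hu : measurable A ->
  measurable (hist_rcons hu.1 hu.2 @^-1` A).
Proof.
move=> mA; rewrite preimage_rcons.
by apply: measurable_xsection; exact: measurable_preimage.
Qed.

Let measurable_q_rcons A : measurable A -> measurable_fun setT (q_rcons A).
Proof.
move=> mA; rewrite /q_rcons; under eq_fun do rewrite preimage_rcons.
apply: measurable_fun_xsection_finite_kernel.
by rewrite inE; exact: measurable_preimage.
Qed.

Let measurable_int_q_rcons A : measurable A ->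
  measurable_fun setT (fun h => \int[phi h]_u q_rcons A (h, u)).
Proof.
move=> mA; apply: measurable_fun_integral_finite_kernel => //.
exact: measurable_q_rcons.
Qed.

Variable mu : probability (history n) R.

(* the law of (X_0, Z_0, ..., X_n, Z_n, X_{n+1}) when mu is the law of
   (X_0, Z_0, ..., X_n) *)
Definition step_law (A : set (history n.+1)) : \bar R :=
  \int[mu]_h \int[phi h]_u p (h.2, u) (hist_rcons h u @^-1` A).

Let step_law0 : step_law set0 = 0.
Proof.
rewrite /step_law integral0_eq// => h _; rewrite integral0_eq// => u _.
by rewrite preimage_set0 measure0.
Qed.

Let step_law_ge0 A : 0 <= step_law A.
Proof. by apply: integral_ge0 => h _; apply: integral_ge0. Qed.

Let step_law_sigma_additive : semi_sigma_additive step_law.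
Proof.
move=> F mF tF mUF.
rewrite [X in _ --> X](_ : _ = \sum_(k <oo) step_law (F k)).
  by apply: is_cvg_nneseries => k _ _; exact: step_law_ge0.
rewrite /step_law -integral_nneseries//; last 2 first.
- by move=> k; exact: measurable_int_q_rcons.
- by move=> k h _; apply: integral_ge0.
apply: eq_integral => h _.
rewrite -integral_nneseries//; last first.
  move=> k.
  rewrite (_ : (fun _ => _) = q_rcons (F k) \o pair h)//.
  by apply: measurableT_comp; [exact: measurable_q_rcons|exact: measurable_pair1].
apply: eq_integral => u _; rewrite preimage_bigcup.
apply/esym/cvg_lim => //; apply: measure_semi_sigma_additive.
- by move=> k; exact: (measurable_preimage_rcons (h, u)).
- apply/trivIsetP => i j _ _ ij; rewrite -preimage_setI.
  by move/trivIsetP : tF => ->//; rewrite preimage_set0.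
- rewrite -preimage_bigcup.
  exact: (measurable_preimage_rcons (h, u)).
Qed.

HB.instance Definition _ := isMeasure.Build _ _ _
  step_law step_law0 step_law_ge0 step_law_sigma_additive.

Let step_law_setT : step_law setT = 1.
Proof.
rewrite /step_law (eq_integral (cst 1)).
  by rewrite integral_cst// mul1e; exact: probability_setT.
move=> h _; rewrite (eq_integral (cst 1)).
  by rewrite integral_cst// mul1e; exact: prob_kernel.
by move=> u _; rewrite preimage_setT; exact: prob_kernel.
Qed.

HB.instance Definition _ := Measure_isProbability.Build _ _ _
  step_law step_law_setT.

End step.

(* the law of (X_0, Z_0, ..., X_{n-1}, Z_{n-1}, X_n) given X_0 = x *)
Fixpoint hist_law (phi : control_policy) (x : S) (n : nat) :
    probability (history n) R :=
  match n with
  | 0 => \d_(([tuple], x) : history 0)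
  | n'.+1 => step_law (phi n') (hist_law phi x n')
  end.

Variable r : S * U * S -> \bar R.

Definition total_reward n (h : history n) : \bar R :=
  \sum_(m < n) r (hist_state h m, hist_control h m, hist_state h m.+1).

(* The term of index 0 of the sequence is irrelevant to the limit inferior. *)
Definition growth_rate (phi : control_policy) (x : S) : \bar R :=
  limn_einf (fun N : nat =>
    (N%:R^-1)%:E * lne (\int[hist_law phi x N]_h expeR (total_reward h))).

Definition optimal_growth_rate : \bar R :=
  ereal_sup [set ereal_sup [set growth_rate phi x | phi in [set: control_policy]]
            | x in [set: S]].

End controlled_process.

Section relative_entropy.
Context {d : measure_display} {T : measurableType d} {R : realType}.
Implicit Types (mu nu : {measure set T -> \bar R}) (l : T -> R).

Definition is_density mu nu l : Prop :=
  [/\ measurable_fun [set: T] l, (forall x, (0 <= l x)%R) &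
      forall A, measurable A -> mu A = \int[nu]_(x in A) (l x)%:E].

(* Any two densities agree nu-almost everywhere, hence mu-almost everywhere,
   so the value does not depend on the one that is chosen. *)
Definition relative_entropy mu nu : \bar R :=
  match pselect (exists l, is_density mu nu l) with
  | left ex_l => \int[mu]_x lne (projT1 (cid ex_l) x)%:E
  | right _ => +oo
  end.

End relative_entropy.

Section variational.
Context {dS dU : measure_display} {S : measurableType dS}
  {U : measurableType dU} {R : realType}.

Definition marginal1 (eta : probability (S * U * S)%type R) : set S -> \bar R :=
  pushforward eta (fun z => z.1.1).

Definition marginal12 (eta : probability (S * U * S)%type R) :
    set (S * U) -> \bar R :=
  pushforward eta (fun z => z.1).

(* eta(dx,du,dy) = eta0(dx) eta1(du|x) eta2(dy|x,u), tested on rectangles *)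
Definition disintegration (eta : probability (S * U * S)%type R)
    (eta1 : R.-pker S ~> U) (eta2 : R.-pker (S * U) ~> S) : Prop :=
  (forall A B, measurable A -> measurable B ->
    marginal12 eta (A `*` B) = \int[marginal1 eta]_(x in A) eta1 x B) /\
  (forall A B, measurable A -> measurable B ->
    eta (A `*` B) = \int[marginal12 eta]_(xu in A) eta2 xu B).

Definition invariant (mu : set S -> \bar R) (k : S -> set S -> \bar R) : Prop :=
  forall A, measurable A -> \int[mu]_x k x A = mu A.

(* kcomp eta1 eta2 is the kernel x |-> \int eta2(dy|x,u) eta1(du|x) *)
Definition ergodic_occupation (eta : probability (S * U * S)%type R) : Prop :=
  exists (eta1 : R.-pker S ~> U) (eta2 : R.-pker (S * U) ~> S),
    disintegration eta eta1 eta2 /\ invariant (marginal1 eta) (kcomp eta1 eta2).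

Definition entropy_reward (p : R.-pker (S * U) ~> S) (r : S * U * S -> \bar R)
    (eta : probability (S * U * S)%type R) (eta2 : R.-pker (S * U) ~> S) : \bar R :=
  \int[eta]_z r z -
  \int[marginal12 eta]_xu relative_entropy (eta2 xu) (p xu).

(* The supremum over eta: the disintegration kernel eta2 exists and is unique up
   to a null set of the marginal of eta on S * U, so each eta contributes
   exactly one value. *)
Definition variational_value (p : R.-pker (S * U) ~> S)
    (r : S * U * S -> \bar R) : \bar R :=
  ereal_sup [set v | exists2 eta, ergodic_occupation eta &
    exists eta1 eta2, disintegration eta eta1 eta2 /\
      v = entropy_reward p r eta eta2].

End variational.

(* Main.v *)
Require Import Defs.
From HB Require Import structures.
From mathcomp Require Import all_boot all_order all_algebra.
From mathcomp Require Import all_classical all_reals all_analysis.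
From mathcomp Require Import measurable_realfun.
From mathcomp Require Import ring lra.
Import Order.TTheory GRing.Theory Num.Theory.
Import numFieldNormedType.Exports.
Local Open Scope classical_set_scope.
Local Open Scope ring_scope.
Local Open Scope ereal_scope.

Set Implicit Arguments.
Unset Strict Implicit.
Unset Printing Implicit Defensive.

(* Put E = exp r, G h (x, u) = \int E(x, u, y) h(y) p(dy|x, u) and
   T f (x) = sup_u G f (x, u), and let rho be the infimum of the s > 0 for which
   some continuous f >= 1 satisfies T f <= s f. Both sides of the theorem equal
   log rho.
   Upper bounds: if T f <= s f, then E[exp(sum of rewards) f(X_N)] <= s^N f(x),
   so the growth rate is at most log s; and Gibbs' inequality, applied to the
   weight E(x, u, y) f(y) / (s f(x)), whose p-integral is at most 1, bounds the
   variational value by log s, the terms in log f cancelling by invariance.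
   Lower bounds, for rho > 0: (A1) extends from continuous to bounded measurable
   functions, i.e. p is continuous in total variation, so that T is compact.
   The normalised partial sums of the Neumann series of T / s converge, as s
   decreases to rho, to some continuous f >= 0, not identically 0, with
   T f = rho f, and a measurable selector u(x) attains the supremum. The policy
   u has growth rate at least log rho wherever f > 0. Resolvent means of
   L h (x) = G (h 1_{f > 0}) (x, u(x)) yield a probability nu with nu L = rho nu,
   whose countable additivity follows from continuity in total variation. Then
   f nu, normalised, is invariant under the kernel with density
   E(x, u, y) f(y) / G f (x, u) with respect to p(dy|x, u), and the occupation
   measure of this kernel under u has value exactly log rho. *)

(** * Kernels and laws *)

(** No irreducibility is assumed, so the eigenfunction [f] may vanish and [ln f] may be unbounded.
    Hence the upper bounds use supersolutions [f >= 1] at levels above rho, and only the lower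
    bounds use the eigenfunction; there [ln f] is integrable for [f nu] because [f |ln f|] is
    bounded. The cut-off to {f > 0} in [L] keeps [nu] on {f > 0}, so that [f nu] can be normalised.
    The selector is merely measurable, so [L h] need not be continuous even for continuous [h], and
    a weak limit of measures would not preserve nu L = rho nu. The resolvent means are therefore
    functionals on all bounded measurable functions, their limit is taken along one filter that
    decides every bounded sequence, and countable additivity is recovered from the eigenvalue
    equation itself. The reward may be -oo, that is, E may vanish: in the Gibbs bound a small
    constant is added to E before taking logarithms, paid for by the gap between two levels above
    rho. When rho = 0 both sides are -oo and the upper bounds suffice. *)

Section kernel_precomp.
Context d d' d3 (X' : measurableType d) (X : measurableType d')
  (Y : measurableType d3) (R : realType).
Variables (k : R.-pker X ~> Y) (phi : X' -> X).
Hypothesis mphi : measurable_fun [set: X'] phi.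

(** The measurability proof is an argument of the function, so that the kernel structure can be
    inferred from the term alone; [kmap], [ppush] and [kdensity] follow the same pattern. *)
Definition kprecomp (_ : measurable_fun [set: X'] phi) (x : X') :
  {measure set Y -> \bar R} := k (phi x).

Let measurable_kprecomp A : measurable A ->
  measurable_fun [set: X'] (kprecomp mphi ^~ A).
Proof.
move=> mA; rewrite (_ : (fun _ => _) = (k ^~ A) \o phi)//.
exact: (measurableT_comp (measurable_kernel k A mA) mphi).
Qed.

HB.instance Definition _ :=
  isKernel.Build _ _ _ _ _ (kprecomp mphi) measurable_kprecomp.

Let kprecomp_prob x : kprecomp mphi x [set: Y] = 1.
Proof. exact: prob_kernel. Qed.

HB.instance Definition _ :=
  Kernel_isProbability.Build _ _ _ _ _ (kprecomp mphi) kprecomp_prob.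

End kernel_precomp.

Section kernel_map.
Context d d' d3 (X : measurableType d) (Y : measurableType d')
  (Z : measurableType d3) (R : realType).
Variables (k : R.-pker X ~> Y) (g : X * Y -> Z).
Hypothesis mg : measurable_fun [set: X * Y] g.

Let mg1 x : measurable_fun [set: Y] (fun y => g (x, y)).
Proof. by apply: measurableT_comp => //; exact: pair1_measurable. Qed.

Definition kmap (_ : measurable_fun [set: X * Y] g) (x : X) :
  set Z -> \bar R := pushforward (k x) (fun y => g (x, y)).

Let kmap0 x : kmap mg x set0 = 0.
Proof. by rewrite /kmap /pushforward preimage_set0 measure0. Qed.

Let kmap_ge0 x A : 0 <= kmap mg x A. Proof. exact: measure_ge0. Qed.

Let kmap_additive x : semi_sigma_additive (kmap mg x).
Proof.
exact: (@measure_semi_sigma_additive _ _ _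
  (measure_function_pushforward__canonical__measure_function_Measure
     (k x) (mg1 x))).
Qed.

HB.instance Definition _ x := isMeasure.Build _ _ _
  (kmap mg x) (kmap0 x) (kmap_ge0 x) (@kmap_additive x).

Definition mkmap : X -> {measure set Z -> \bar R} := kmap mg.

Let measurable_mkmap A : measurable A ->
  measurable_fun [set: X] (mkmap ^~ A).
Proof.
move=> mA.
rewrite (_ : (fun _ => _) = fun x => k x (xsection (g @^-1` A) x)).
  apply: (measurable_fun_xsection_finite_kernel k).
  by rewrite inE -[X in measurable X]setTI; exact: mg.
by apply/funext => x; rewrite xsectionE.
Qed.

HB.instance Definition _ :=
  isKernel.Build _ _ _ _ _ mkmap measurable_mkmap.

Let mkmap_prob x : mkmap x [set: Z] = 1.
Proof. exact: prob_kernel. Qed.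

HB.instance Definition _ :=
  Kernel_isProbability.Build _ _ _ _ _ mkmap mkmap_prob.

Lemma ge0_integral_kmap x f : measurable_fun [set: Z] f ->
  (forall z, 0 <= f z) -> \int[mkmap x]_z f z = \int[k x]_y f (g (x, y)).
Proof.
by move=> mf f0; rewrite /mkmap /kmap (ge0_integral_pushforward (mg1 x)).
Qed.

End kernel_map.

Section mixture.
Context d d' (X : measurableType d) (Y : measurableType d') (R : realType).
Variables (mu : probability X R) (k : R.-pker X ~> Y).

Definition mixture (A : set Y) : \bar R := \int[mu]_x k x A.

(** Seen as a kernel from a one-point space, [mu] can be composed with [k]; countable additivity and
    the integral formula for mixtures are those of kernel composition. *)
Let l : R.-pker unit ~> X :=
  kprobability (@measurable_cst _ _ unit _ [set: unit] (mu : pprobability X R)).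

Let k' : R.-pker (unit * X) ~> Y :=
  kprecomp k (@measurable_snd _ _ unit X).

Let mixture0 : mixture set0 = 0.
Proof. by rewrite /mixture integral0_eq. Qed.

Let mixture_ge0 A : 0 <= mixture A.
Proof. exact: integral_ge0. Qed.

Let mixture_additive : semi_sigma_additive mixture.
Proof. exact: (@measure_semi_sigma_additive _ _ _ (mkcomp l k' tt)). Qed.

HB.instance Definition _ := isMeasure.Build _ _ _
  mixture mixture0 mixture_ge0 mixture_additive.

Let mixture_setT : mixture [set: Y] = 1.
Proof.
rewrite /mixture (eq_integral (cst 1)) => [|x _]; last exact: prob_kernel.
by rewrite integral_cst// mul1e; exact: probability_setT.
Qed.

HB.instance Definition _ := Measure_isProbability.Build _ _ _
  mixture mixture_setT.

Lemma ge0_integral_mixture (f : Y -> \bar R) : measurable_fun [set: Y] f ->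
  (forall y, 0 <= f y) -> \int[mixture]_y f y = \int[mu]_x \int[k x]_y f y.
Proof. by move=> mf f0; rewrite (integral_kcomp l k' tt f0 mf). Qed.

End mixture.

Section pushforward_probability.
Context d d' (X : measurableType d) (Y : measurableType d') (R : realType).
Variables (m : probability X R) (f : X -> Y).
Hypothesis mf : measurable_fun [set: X] f.

Definition ppush (_ : measurable_fun [set: X] f) : set Y -> \bar R :=
  pushforward m f.

Let ppush0 : ppush mf set0 = 0.
Proof. by rewrite /ppush /pushforward preimage_set0 measure0. Qed.

Let ppush_ge0 A : 0 <= ppush mf A. Proof. exact: measure_ge0. Qed.

Let ppush_additive : semi_sigma_additive (ppush mf).
Proof.
exact: (@measure_semi_sigma_additive _ _ _
  (measure_function_pushforward__canonical__measure_function_Measure m mf)).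
Qed.

HB.instance Definition _ := isMeasure.Build _ _ _
  (ppush mf) ppush0 ppush_ge0 ppush_additive.

Let ppush_setT : ppush mf [set: Y] = 1.
Proof. exact: probability_setT. Qed.

HB.instance Definition _ := Measure_isProbability.Build _ _ _
  (ppush mf) ppush_setT.

Lemma ge0_integral_ppush (g : Y -> \bar R) : measurable_fun [set: Y] g ->
  (forall y, 0 <= g y) -> \int[ppush mf]_y g y = \int[m]_x g (f x).
Proof. by move=> mg g0; rewrite /ppush (ge0_integral_pushforward mf). Qed.

End pushforward_probability.

Section disintegrate.
Context d d' (X : measurableType d) (Y : measurableType d') (R : realType).
Variables (m : probability (X * Y)%type R) (mu : probability X R)
  (k : R.-pker X ~> Y).
Hypothesis mk : forall A B, measurable A -> measurable B ->
  m (A `*` B) = \int[mu]_(x in A) k x B.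

(** Here [kk x] is the law of the pair with first coordinate [x] and second coordinate drawn from
    [k x]. By [mk], [m] and [mixture mu kk] agree on rectangles, a generating class stable under
    intersection, hence everywhere. *)
Lemma ge0_integral_disintegrate (f : X * Y -> \bar R) :
  measurable_fun [set: X * Y] f -> (forall z, 0 <= f z) ->
  \int[m]_z f z = \int[mu]_x \int[k x]_y f (x, y).
Proof.
move=> mf f0.
pose kk : R.-pker X ~> (X * Y)%type := mkmap k (@measurable_id _ (X * Y)%type setT).
transitivity (\int[mixture mu kk]_z f z); last first.
  rewrite ge0_integral_mixture//; apply: eq_integral => x _.
  by rewrite ge0_integral_kmap.
apply: eq_measure_integral => C mC _.
pose G : set (set (X * Y)) :=
  [set A `*` B | A in measurable & B in measurable].
apply: (@measure_unique _ _ _ G (fun=> setT)) => //.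
- by rewrite measurable_prod_measurableType.
- move=> _ _ [A1 mA1 [B1 mB1 <-]] [A2 mA2 [B2 mB2 <-]].
  exists (A1 `&` A2); first exact: measurableI.
  by exists (B1 `&` B2); [exact: measurableI|rewrite setXI].
- by move=> _; exists setT => //; exists setT => //; rewrite setXTT.
- by rewrite bigcup_const.
- move=> _ [A mA [B mB <-]].
  transitivity (\int[mu]_(x in A) k x B); first exact: mk.
  rewrite [LHS]integral_mkcond.
  apply: eq_integral => x _; rewrite patchE; case: ifPn => xA.
    rewrite inE in xA; rewrite /mkmap/= /kmap /pushforward.
    by congr (k x _); apply/seteqP; split=> y /=; [split|case].
  apply/esym; rewrite /= /mkmap/= /kmap /pushforward (_ : _ @^-1` _ = set0) ?measure0//.
  by apply/seteqP; split=> y //= [] /mem_set Ax _; rewrite Ax in xA.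
- by move=> _; apply: (le_lt_trans (probability_le1 m measurableT)); rewrite ltry.
Qed.

End disintegrate.

(** * Bounded measurable functions and finitely additive means *)

Section bounded_measurable.
Context d (X : measurableType d) (R : realType).
Local Open Scope ring_scope.
Implicit Types (h k : X -> R) (A : set X).

Definition bounded_measurable h :=
  measurable_fun [set: X] h /\ exists M, forall x, `|h x| <= M.

Lemma bm_cst c : bounded_measurable (fun=> c).
Proof. by split; [exact: measurable_cst|exists `|c|]. Qed.

Lemma bm_indic A : measurable A -> bounded_measurable (\1_A).
Proof.
move=> mA; split; first exact: measurable_indic.
by exists 1 => x; rewrite indicE; case: (_ \in _); rewrite ?normr1 ?normr0.
Qed.

Lemma bm_add h k : bounded_measurable h -> bounded_measurable k ->
  bounded_measurable (fun x => h x + k x).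
Proof.
move=> [mh [M hM]] [mk [N kN]]; split; first exact: measurable_funD.
by exists (M + N) => x; rewrite (le_trans (ler_normD _ _))// lerD.
Qed.

Lemma bm_mul h k : bounded_measurable h -> bounded_measurable k ->
  bounded_measurable (fun x => h x * k x).
Proof.
move=> [mh [M hM]] [mk [N kN]]; split; first exact: measurable_funM.
by exists (M * N) => x; rewrite normrM ler_pM.
Qed.

Lemma bm_scale c h : bounded_measurable h -> bounded_measurable (fun x => c * h x).
Proof. by move=> bh; apply: bm_mul => //; exact: bm_cst. Qed.

Lemma bm_opp h : bounded_measurable h -> bounded_measurable (fun x => - h x).
Proof.
move=> [mh [M hM]]; split; first exact: measurableT_comp.
by exists M => x; rewrite normrN.
Qed.

Lemma bm_sub h k : bounded_measurable h -> bounded_measurable k ->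
  bounded_measurable (fun x => h x - k x).
Proof. by move=> bh bk; apply: bm_add => //; exact: bm_opp. Qed.

Lemma bm_norm h : bounded_measurable h -> bounded_measurable (fun x => `|h x|).
Proof.
move=> [mh [M hM]]; split; first exact: measurableT_comp.
by exists M => x; rewrite normr_id.
Qed.

Variable mu : probability X R.

Lemma bm_integrable h : bounded_measurable h ->
  mu.-integrable [set: X] (EFin \o h).
Proof.
move=> [mh [M hM]]; apply: measurable_bounded_integrable => //.
  by rewrite [X in (X < _)%E](_ : _ = 1%E) ?ltry//; exact: probability_setT.
exists M; split; first exact: num_real.
by move=> N MN x _; exact: le_trans (hM x) (ltW MN).
Qed.

Lemma bm_integral_EFin h : bounded_measurable h ->
  (\int[mu]_x (h x)%:E)%E = (\int[mu]_x h x)%:E.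
Proof.
by move=> bh; rewrite fineK//; apply: integrable_fin_num => //; exact: bm_integrable.
Qed.

Lemma bm_RintegralD h k : bounded_measurable h -> bounded_measurable k ->
  \int[mu]_x (h x + k x) = \int[mu]_x h x + \int[mu]_x k x.
Proof. by move=> bh bk; rewrite RintegralD//; exact: bm_integrable. Qed.

Lemma bm_RintegralB h k : bounded_measurable h -> bounded_measurable k ->
  \int[mu]_x (h x - k x) = \int[mu]_x h x - \int[mu]_x k x.
Proof. by move=> bh bk; rewrite RintegralB//; exact: bm_integrable. Qed.

Lemma bm_RintegralZ c h : bounded_measurable h ->
  \int[mu]_x (c * h x) = c * \int[mu]_x h x.
Proof. by move=> bh; rewrite RintegralZl//; exact: bm_integrable. Qed.

Lemma Rintegral_cst1 c : \int[mu]_x c = c.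
Proof.
rewrite Rintegral_cst// [X in fine X](_ : _ = 1%E) ?mulr1//.
exact: probability_setT.
Qed.

Lemma bm_le_Rintegral h k : bounded_measurable h -> bounded_measurable k ->
  (forall x, h x <= k x) -> \int[mu]_x h x <= \int[mu]_x k x.
Proof. by move=> bh bk hk; apply: le_Rintegral => //; exact: bm_integrable. Qed.

Lemma bm_norm_Rintegral h : bounded_measurable h ->
  `|\int[mu]_x h x| <= \int[mu]_x `|h x|.
Proof. by move=> bh; apply: le_normr_Rintegral => //; exact: bm_integrable. Qed.

Lemma bm_Rintegral_bound h M : bounded_measurable h ->
  (forall x, `|h x| <= M) -> `|\int[mu]_x h x| <= M.
Proof.
move=> bh hM; apply: le_trans (bm_norm_Rintegral bh) _.
rewrite -[leRHS]Rintegral_cst1; apply: bm_le_Rintegral => //.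
  exact: bm_norm.
exact: bm_cst.
Qed.

Lemma bm_Rintegral_cvg (h_ : nat -> X -> R) h (M : R) :
  (forall n, measurable_fun [set: X] (h_ n)) ->
  (forall n x, `|h_ n x| <= M) ->
  (forall x, h_ n x @[n --> \oo] --> h x) ->
  \int[mu]_x h_ n x @[n --> \oo] --> \int[mu]_x h x.
Proof.
move=> mh hM hh.
have mh0 : measurable_fun [set: X] h.
  by apply: (measurable_fun_cvg mh) => x _; exact: hh.
have h0M x : `|h x| <= M.
  have nh : `|h_ n x| @[n --> \oo] --> `|h x| by exact: cvg_norm.
  rewrite -(cvg_lim _ nh)//; apply: limr_le; first exact: cvgP nh.
  by near=> n; exact: hM.
have b0 : bounded_measurable h by split => //; exists M.
have bn n : bounded_measurable (h_ n) by split => //; exists M.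
have [|||||_ _] := @dominated_convergence _ _ _ mu setT measurableT
  (fun n => EFin \o h_ n) (EFin \o h) (EFin \o cst M).
- by move=> n; apply/measurable_EFinP.
- exact/measurable_EFinP.
- by apply: aeW => x _; apply/cvg_EFin; [exact: nearW|exact: hh].
- exact/bm_integrable/bm_cst.
- by apply: aeW => x n _; rewrite /= lee_fin.
rewrite bm_integral_EFin//.
under eq_fun do rewrite bm_integral_EFin//.
by move/fine_cvg.
Unshelve. all: by end_near. Qed.

End bounded_measurable.

Section mean.
Context d (X : measurableType d) (R : realType).
Local Open Scope ring_scope.
Implicit Types (h k : X -> R) (A : set X) (psi : (X -> R) -> R).

(** A finitely additive probability, seen as a positive normalised linear functional. The conditions
    only concern bounded measurable functions; values elsewhere are arbitrary. *)
Definition mean psi := [/\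
  forall c h k, bounded_measurable h -> bounded_measurable k ->
    psi (fun x => c * h x + k x) = c * psi h + psi k,
  forall h, bounded_measurable h -> (forall x, 0 <= h x) -> 0 <= psi h &
  psi (cst 1) = 1].

Lemma Rintegral_mean (mu : probability X R) : mean (fun h => \int[mu]_x h x).
Proof.
split => [c h k bh bk|h bh h0|].
- by rewrite bm_RintegralD ?bm_RintegralZ//; exact: bm_scale.
- by apply: Rintegral_ge0 => x _; exact: h0.
- exact: Rintegral_cst1.
Qed.

Variable psi : (X -> R) -> R.
Hypothesis mpsi : mean psi.

Lemma meanD h k : bounded_measurable h -> bounded_measurable k ->
  psi (fun x => h x + k x) = psi h + psi k.
Proof.
move=> bh bk; rewrite -[psi h]mul1r; have [<- // _ _] := mpsi.
by congr psi; apply/funext => x; rewrite mul1r.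
Qed.

Lemma mean0 : psi (cst 0) = 0.
Proof.
have b0 := bm_cst X (0 : R); have := meanD b0 b0.
have -> : (fun=> 0 + 0) = cst 0 :> (X -> R) by apply/funext => x; rewrite addr0.
by move/eqP; rewrite -subr_eq0 opprD addrA subrr sub0r oppr_eq0 => /eqP.
Qed.

Lemma meanZ c h : bounded_measurable h -> psi (fun x => c * h x) = c * psi h.
Proof.
move=> bh; have [lin _ _] := mpsi.
rewrite -[RHS]addr0 -mean0 -lin//; last exact: bm_cst.
by congr psi; apply/funext => x; rewrite /= addr0.
Qed.

Lemma meanB h k : bounded_measurable h -> bounded_measurable k ->
  psi (fun x => h x - k x) = psi h - psi k.
Proof.
move=> bh bk; rewrite meanD//; last exact: bm_opp.
by rewrite -mulN1r -meanZ//; under [in LHS]eq_fun do rewrite -mulN1r.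
Qed.

Lemma mean_cst c : psi (cst c) = c.
Proof.
have [_ _ psi1] := mpsi; rewrite -[RHS]mulr1 -psi1 -meanZ; last exact: bm_cst.
by congr psi; apply/funext => x /=; rewrite mulr1.
Qed.

Lemma mean_ge0 h : bounded_measurable h -> (forall x, 0 <= h x) -> 0 <= psi h.
Proof. by case: mpsi => _ + _; exact. Qed.

Lemma mean_le h k : bounded_measurable h -> bounded_measurable k ->
  (forall x, h x <= k x) -> psi h <= psi k.
Proof.
move=> bh bk hk; rewrite -subr_ge0 -meanB//.
by apply: mean_ge0 => [|x]; [exact: bm_sub|rewrite subr_ge0].
Qed.

Lemma mean_norm_le h M : bounded_measurable h -> (forall x, `|h x| <= M) ->
  `|psi h| <= M.
Proof.
move=> bh hM; rewrite ler_norml; apply/andP; split.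
  rewrite -(mean_cst (- M)); apply: mean_le => //; first exact: bm_cst.
  by move=> x; have := hM x; rewrite ler_norml => /andP[].
rewrite -[leRHS](mean_cst M); apply: mean_le => //; first exact: bm_cst.
by move=> x; have := hM x; rewrite ler_norml => /andP[].
Qed.

End mean.

Section mean_close.
Context d (X : measurableType d) (R : realType).
Local Open Scope ring_scope.
Variables (psi1 psi2 : (X -> R) -> R) (e : R).
Hypotheses (mpsi1 : mean psi1) (mpsi2 : mean psi2).
Hypothesis close : forall A, measurable A -> `|psi1 (\1_A) - psi2 (\1_A)| <= e.

(* Peeling off the leading binary digit of a [0, 1]-valued function halves the
   remaining error. *)
Let close_unit (n : nat) (h : X -> R) : measurable_fun [set: X] h ->
  (forall x, 0 <= h x <= 1) -> `|psi1 h - psi2 h| <= e + 2^-1 ^+ n.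
Proof.
have e0 : 0 <= e by apply: le_trans (close measurable0).
elim: n h => [|n ih] h mh h01.
  have hb x : `|h x| <= 1 by have /andP[h0 h1] := h01 x; rewrite ger0_norm.
  have bh : bounded_measurable h by split => //; exists 1.
  have I psi : mean psi -> 0 <= psi h <= 1.
    move=> mpsi; rewrite (mean_ge0 mpsi)// => [|x]; last by case/andP: (h01 x).
    by rewrite (le_trans (ler_norm _))// (mean_norm_le mpsi).
  have /andP[a1 a2] := I _ mpsi1; have /andP[b1 b2] := I _ mpsi2.
  by rewrite expr0 ler_norml; apply/andP; split; lra.
pose A := [set x | 2^-1 <= h x].
have mA : measurable A.
  rewrite (_ : A = h @^-1` `[2^-1, +oo[); last first.
    by apply/seteqP; split => x /=; rewrite in_itv/= andbT.
  by rewrite -[X in measurable X]setTI; apply: mh => //; exact: measurable_itv.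
pose g x := 2 * h x - \1_A x.
have g01 x : 0 <= g x <= 1.
  rewrite /g indicE; have /andP[h0 h1] := h01 x.
  have [xA|xA] := boolP (x \in A).
    by move: xA; rewrite inE /A/= => xA; apply/andP; split; rewrite /=; lra.
  have : h x < 2^-1 by rewrite ltNge; apply/negP => hx; move/negP: xA; apply; rewrite inE.
  by move=> xA'; apply/andP; split; rewrite /=; lra.
have mg : measurable_fun [set: X] g.
  apply: measurable_funB; last exact: measurable_indic.
  by apply: measurable_funM => //; exact: measurable_cst.
have gb x : `|g x| <= 1 by have /andP[h0 h1] := g01 x; rewrite ger0_norm.
have bg : bounded_measurable g by split => //; exists 1.
have bA := bm_indic R mA.
have E psi : mean psi -> psi h = 2^-1 * psi (\1_A) + 2^-1 * psi g.
  move=> mpsi; rewrite -!(meanZ mpsi)// -(meanD mpsi); [|exact: bm_scale..].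
  by congr psi; apply/funext => x; rewrite /g; field.
rewrite (E _ mpsi1) (E _ mpsi2); have := ih _ mg g01; have := close mA.
rewrite exprS; set u := _ ^+ n.
set a := psi1 (\1_A); set b := psi2 (\1_A).
rewrite !ler_norml => /andP[h1 h2] /andP[h3 h4].
by apply/andP; split; lra.
Qed.

(** Letting the number of binary digits grow, the gap is at most [e] on [0, 1]-valued functions; the
    affine map between [-1, 1] and [0, 1] costs the factor 2. *)
Lemma mean_close (h : X -> R) : measurable_fun [set: X] h ->
  (forall x, `|h x| <= 1) -> `|psi1 h - psi2 h| <= 2 * e.
Proof.
move=> mh h1.
have bh : bounded_measurable h by split => //; exists 1.
pose g x := 2^-1 * (h x + 1).
have bg : bounded_measurable g.
  by apply/bm_scale/bm_add => //; exact: bm_cst.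
have E psi : mean psi -> psi h = 2 * psi g - 1.
  move=> mpsi; rewrite -(meanZ mpsi)// -[X in _ - X](mean_cst mpsi) -(meanB mpsi)//.
  - by congr psi; apply/funext => x; rewrite /g/=; field.
  - exact: bm_scale.
  - exact: bm_cst.
rewrite (E _ mpsi1) (E _ mpsi2) (_ : _ - _ = 2 * (psi1 g - psi2 g)); last by ring.
rewrite normrM ger0_norm// ler_pM2l//.
apply/ler_addgt0Pr => c c0.
near \oo => n.
apply: le_trans (close_unit n bg.1 _) _.
  move=> x; have := h1 x; rewrite ler_norml /g => /andP[a b].
  by apply/andP; split; lra.
rewrite lerD2l; near: n.
have : (2^-1 : R) ^+ n @[n --> \oo] --> (0 : R).
  by apply: cvg_expr; rewrite ger0_norm ?invr_ge0// invf_lt1// ltr1n.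
by move/cvgr_le; exact.
Unshelve. all: by end_near. Qed.

End mean_close.

Section mean_measure.
Context d (X : measurableType d) (R : realType).
Local Open Scope ring_scope.
Variable psi : (X -> R) -> R.
Hypothesis mpsi : mean psi.
Hypothesis psi_cvg0 : forall A : nat -> set X, (forall n, measurable (A n)) ->
  nonincreasing_seq A -> \bigcap_n A n = set0 ->
  psi (\1_(A n)) @[n --> \oo] --> (0 : R).

(* The norm only matters for the junk value on non-measurable sets. *)
Definition mean_measure (A : set X) : \bar R := (`|psi (\1_A)|)%:E.

Let mean_measureE A : measurable A -> mean_measure A = (psi (\1_A))%:E.
Proof.
move=> mA; rewrite /mean_measure ger0_norm// (mean_ge0 mpsi)//.
exact: bm_indic.
Qed.

Let mean_measure0 : mean_measure set0 = 0%E.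
Proof. by rewrite mean_measureE// indic0 (mean0 mpsi). Qed.

Let mean_measure_ge0 A : (0 <= mean_measure A)%E.
Proof. by rewrite lee_fin. Qed.

Let mean_measure_additive : semi_sigma_additive mean_measure.
Proof.
move=> F mF tF mUF.
(* The tail of the union decreases to the empty set, and by finite additivity the partial sums are
   [psi] of the union minus [psi] of the tail. *)
pose B n := \bigcup_k F k `\` \big[setU/set0]_(i < n) F i.
have mS n : measurable (\big[setU/set0]_(i < n) F i) by exact: bigsetU_measurable.
have mB n : measurable (B n) by exact: measurableD.
have E n : (\sum_(0 <= i < n) mean_measure (F i))%E =
    (psi (\1_(\bigcup_k F k)) - psi (\1_(B n)))%:E.
  rewrite -(meanB mpsi); [|exact: bm_indic..].
  have -> : (fun x => \1_(\bigcup_k F k) x - \1_(B n) x) =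
      \1_(\big[setU/set0]_(i < n) F i) :> (X -> R).
    apply/funext => x; rewrite !indicE /B in_setD.
    have [xn|xn] := boolP (x \in \big[setU/set0]_(i < n) F i).
      by rewrite andbF subr0 mem_set//; move: xn; rewrite inE -bigcup_mkord => -[k _ Fk]; exists k.
    by rewrite andbT subrr.
  rewrite -mean_measureE//.
  elim: n => [|n ih]; first by rewrite big_nil big_ord0 mean_measure0.
  rewrite big_nat_recr//= ih big_ord_recr/= (mean_measureE (mS n)) (mean_measureE (mF n)).
  rewrite mean_measureE; last by apply: measurableU; [exact: mS|exact: mF].
  rewrite -EFinD -(meanD mpsi); [|exact: bm_indic..].
  congr (psi _)%:E; apply/funext => x; rewrite !indicE in_setU.
  have [xF|xF] := boolP (x \in F n); last by rewrite orbF addr0.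
  rewrite orbT (_ : x \in _ = false) ?add0r//.
  apply/negbTE/negP; rewrite inE -bigcup_mkord => -[k /= kn Fk].
  have := tF k n I I; rewrite inE in xF.
  by move=> /(_ (ex_intro _ x (conj Fk xF))) kn'; rewrite kn' ltnn in kn.
rewrite (_ : (fun n => _) = EFin \o
    (fun n => psi (\1_(\bigcup_k F k)) - psi (\1_(B n)))); last first.
  by apply/funext => n; rewrite E.
rewrite mean_measureE//; apply: cvg_EFin; first exact: nearW.
rewrite -[X in _ --> X]subr0; apply: cvgB; first exact: cvg_cst.
apply: psi_cvg0 => //.
- move=> m n mn; apply/subsetPset => x [UFx nx]; split => // mx; apply: nx.
  move: mx; rewrite -!bigcup_mkord => -[k /= km Fk]; exists k => //=.
  exact: leq_trans mn.
- apply/seteqP; split => // x Bx.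
  have [[k _ Fk] _] := Bx 0%N I.
  have [_] := Bx k.+1 I; apply; rewrite -bigcup_mkord.
  by exists k => /=.
Qed.

HB.instance Definition _ := isMeasure.Build _ _ _
  mean_measure mean_measure0 mean_measure_ge0 mean_measure_additive.

Let mean_measure_setT : mean_measure [set: X] = 1%E.
Proof. by rewrite mean_measureE// indicT (mean_cst mpsi). Qed.

HB.instance Definition _ := Measure_isProbability.Build _ _ _
  mean_measure mean_measure_setT.

(** Continuity at the empty set makes the mean a measure on sets. Mean and integral agree on
    indicators, so [mean_close] with [e = 0] identifies them once [h] is scaled into [-1, 1]. *)
Lemma mean_integral : exists mu : probability X R, forall h,
  bounded_measurable h -> psi h = \int[mu]_x h x.
Proof.
exists mean_measure => h [mh [M hM]].
have bh : bounded_measurable h by split => //; exists M.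
have M1 : 0 < `|M| + 1 by rewrite ltr_wpDl.
have hE : h = fun x => (`|M| + 1) * ((`|M| + 1)^-1 * h x).
  by apply/funext => x; rewrite mulrA divff ?mul1r// gt_eqF.
have bg : bounded_measurable (fun x => (`|M| + 1)^-1 * h x) by exact: bm_scale.
rewrite hE (meanZ mpsi)// (meanZ (Rintegral_mean mean_measure))//; congr (_ * _).
apply/eqP; rewrite -subr_eq0 -normr_le0 -(mulr0 2).
apply: (mean_close mpsi (Rintegral_mean mean_measure)); last 2 first.
- exact: bg.1.
- move=> x; rewrite normrM gtr0_norm ?invr_gt0// ler_pdivrMl// mulr1.
  by rewrite (le_trans (hM x))// (le_trans (ler_norm _))// lerDl.
move=> A mA; rewrite /Rintegral integral_indic// setIT.
rewrite (_ : fine _ = fine (mean_measure A))// mean_measureE//=.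
by rewrite subrr normr0.
Qed.

End mean_measure.

(** * From continuous to bounded measurable test functions *)

Section total_variation.
Context (d : measure_display) (R : realType) (S : borelMetricType d R).
Local Open Scope ring_scope.

Lemma borel_open (A : set S) : open A -> measurable A.
Proof. by move=> oA; rewrite borel_measurableE; exact: sub_sigma_algebra. Qed.

Lemma borel_continuous (f : S -> R) : continuous f -> measurable_fun [set: S] f.
Proof.
move=> cf; apply: (measurability _ (RGenOpens.measurableE R)).
move=> _ [_ [a [b ->]] <-]; rewrite setTI; apply: borel_open.
by apply: open_comp => [x _|]; [exact: cf|exact: interval_open].
Qed.

(** Urysohn functions vanishing off [O] and equal to 1 on [F n], the points lying in no ball of
    radius 1/(n+1) around a point of the complement; each point of [O] is eventually in [F n]. *)
Lemma open_indic_approx (O : set S) : open O -> exists k : nat -> S -> R,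
  [/\ forall n, continuous (k n), forall n x, 0 <= k n x <= 1 &
      forall x, k n x @[n --> \oo] --> (\1_O x : R)].
Proof.
move=> oO.
pose F n := [set x : S | forall a, (~` O) a -> ~ ball a n.+1%:R^-1 x].
pose k n : S -> R := Urysohn (~` O) (F n).
have sep n : uniform_separator (~` O) (F n).
  apply: uniform_separatorW.
  exists [set xy : S * S | ball xy.1 n.+1%:R^-1 xy.2].
    have npos : 0 < n.+1%:R^-1 :> R by rewrite invr_gt0.
    exact: (entourage_ball S (PosNum npos)).
  by apply/seteqP; split => // -[x y] /= [[Ox Fy]]; exact: Fy.
exists k; split.
- by move=> n; exact: Urysohn_continuous.
- by move=> n x; have := @Urysohn_range _ R (~` O) (F n) (k n x);
    rewrite /= in_itv/=; apply; exists x.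
move=> x; rewrite indicE; have [xO|xO] := boolP (x \in O); last first.
  rewrite (_ : (fun n => k n x) = fun=> 0); first exact: cvg_cst.
  apply/funext => n; apply: (Urysohn_sub0 (sep n)).
  by exists x => //= Ox; move/negP : xO; apply; rewrite inE.
apply: cvg_near_cst.
have /nbhs_ballP[e /= e0 eO] : nbhs x O.
  by apply: open_nbhs_nbhs; split => //; rewrite inE in xO.
near=> n; apply: (Urysohn_sub1 (sep n)); exists x => // a Oa ax.
apply: Oa; apply: eO; apply: ball_sym; apply: le_ball ax.
by apply: ltW; near: n; exact: (near_infty_natSinv_lt (PosNum e0)).
Unshelve. all: by end_near. Qed.

Variables (p1 p2 : probability S R).

(** Approximability in the mean by continuous functions. The same [k] serves both measures, because
    [close] compares the two integrals of one continuous function. *)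
Let approx (h : S -> R) := bounded_measurable h /\ forall e : R, 0 < e ->
  exists2 k : S -> R, continuous k & [/\ forall x, 0 <= k x <= 1,
   \int[p1]_x `|h x - k x| <= e & \int[p2]_x `|h x - k x| <= e].

Let bm_unit (k : S -> R) : continuous k -> (forall x, 0 <= k x <= 1) ->
  bounded_measurable k.
Proof.
move=> ck k01; split; first exact: borel_continuous.
by exists 1 => x; have /andP[k0 k1] := k01 x; rewrite ger0_norm.
Qed.

Let approx_lim (h : nat -> S -> R) (g : S -> R) : (forall n, approx (h n)) ->
  (forall n x, 0 <= h n x <= 1) -> (forall x, h n x @[n --> \oo] --> g x) ->
  approx g.
Proof.
move=> ah h01 hg.
have h1 n x : `|h n x| <= 1 by have /andP[h0 h1] := h01 n x; rewrite ger0_norm.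
have mg : measurable_fun [set: S] g.
  by apply: (measurable_fun_cvg (fun n => (ah n).1.1)) => x _; exact: hg.
have g1 x : `|g x| <= 1.
  have nh : `|h n x| @[n --> \oo] --> `|g x| by exact: cvg_norm.
  rewrite -(cvg_lim _ nh)//; apply: limr_le; first exact: cvgP nh.
  by near=> n; exact: h1.
have bg : bounded_measurable g by split => //; exists 1.
split => // e e0.
have cv (p : probability S R) : \int[p]_x `|g x - h n x| @[n --> \oo] --> (0 : R).
  rewrite -(Rintegral_cst1 p 0); apply: (@bm_Rintegral_cvg _ _ _ _ _ _ 2).
  - move=> n; apply: measurableT_comp => //; apply: measurable_funB => //.
    exact: (ah n).1.1.
  - move=> n x; rewrite normr_id (le_trans (ler_normB _ _))//.
    by rewrite (_ : 2 = 1 + 1)// lerD.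
  - move=> x; rewrite -(normr0 R) -(subrr (g x)).
    by apply: cvg_norm; apply: cvgB => //; exact: cvg_cst.
have e2 : 0 < e / 2 by rewrite divr_gt0.
near \oo => n.
have [k ck [k01 k1 k2]] := (ah n).2 _ e2.
have bk := bm_unit ck k01.
exists k => //.
suff H (p : probability S R) : \int[p]_x `|g x - h n x| <= e / 2 ->
    \int[p]_x `|h n x - k x| <= e / 2 -> \int[p]_x `|g x - k x| <= e.
  split => //; apply: H => //; near: n.
    by apply: (cvgr_le _ (cv p1)).
  by apply: (cvgr_le _ (cv p2)).
move=> a b; have bh := (ah n).1.
rewrite [leRHS]splitr; apply: le_trans (lerD a b).
rewrite -bm_RintegralD; [|exact/bm_norm/bm_sub..].
apply: bm_le_Rintegral; first exact/bm_norm/bm_sub.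
  by apply: bm_add; exact/bm_norm/bm_sub.
by move=> x; rewrite (le_trans _ (ler_normD _ _))// addrA subrK.
Unshelve. all: by end_near. Qed.

Let approxC (h : S -> R) : approx h -> approx (fun x => 1 - h x).
Proof.
move=> [bh ah]; split; first by apply: bm_sub => //; exact: bm_cst.
move=> e e0; have [k ck [k01 k1 k2]] := ah e e0.
exists (fun x => 1 - k x).
  by move=> x; apply: cvgB; [exact: cvg_cst|exact: ck].
have E x : `|1 - h x - (1 - k x)| = `|h x - k x|.
  by rewrite -normrN; congr (`|_|); ring.
split; [|by under eq_Rintegral do rewrite E..].
by move=> x; have /andP[k0 kk] := k01 x; rewrite subr_ge0 kk lerBlDr lerDl.
Qed.

Let approxM (h g : S -> R) : (forall x, 0 <= h x <= 1) -> approx h -> approx g ->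
  approx (fun x => h x * g x).
Proof.
move=> h01 [bh ah] [bg ag]; split; first exact: bm_mul.
move=> e e0; have e2 : 0 < e / 2 by rewrite divr_gt0.
have [k ck [k01 k1 k2]] := ah _ e2; have [l cl [l01 l1 l2]] := ag _ e2.
have bk := bm_unit ck k01; have bl := bm_unit cl l01.
exists (fun x => k x * l x).
  by move=> x; apply: cvgM; [exact: ck|exact: cl].
suff H (p : probability S R) : \int[p]_x `|h x - k x| <= e / 2 ->
    \int[p]_x `|g x - l x| <= e / 2 -> \int[p]_x `|h x * g x - k x * l x| <= e.
  split; [|exact: H..].
  move=> x; have /andP[k0 kk] := k01 x; have /andP[l0 ll] := l01 x.
  by rewrite mulr_ge0//= -(mulr1 1) ler_pM.
move=> a b; rewrite [leRHS]splitr; apply: le_trans (lerD a b).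
rewrite -bm_RintegralD; [|exact/bm_norm/bm_sub..].
apply: bm_le_Rintegral.
- by apply/bm_norm/bm_sub; exact: bm_mul.
- by apply: bm_add; exact/bm_norm/bm_sub.
move=> x.
have -> : h x * g x - k x * l x = (h x - k x) * l x + h x * (g x - l x) by ring.
have /andP[l0 ll] := l01 x; have /andP[h0 hh] := h01 x.
rewrite (le_trans (ler_normD _ _))// !normrM (ger0_norm l0) (ger0_norm h0).
by rewrite lerD// ?ler_piMr ?ler_piMl.
Qed.

Let indic01 (A : set S) x : 0 <= (\1_A x : R) <= 1.
Proof. by rewrite indicE; case: (_ \in _); rewrite lexx ler01. Qed.

(** The sets with an approximable indicator form a sigma-algebra: complements by [approxC],
    intersections by [approxM], countable unions by [approx_lim]. It contains the open sets by
    Urysohn approximation. *)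
Let approx_indic (A : set S) : measurable A -> approx \1_A.
Proof.
rewrite borel_measurableE; pose G (A : set S) := approx \1_A.
move: A; apply: (@smallest_sub _ _ _ G).
  have GC B : G B -> G (~` B).
    rewrite /G => /approxC; congr approx; apply/funext => x.
    rewrite !indicE in_setC; case: (_ \in _); rewrite ?subrr ?subr0//.
  have GI A B : G A -> G B -> G (A `&` B).
    move=> GA GB; rewrite /G indicI; exact: approxM.
  have G0 : G set0.
    split; first exact: bm_indic.
    move=> e e0; exists (fun=> 0); first by move=> x; exact: cvg_cst.
    split; first by move=> x; rewrite lexx ler01.
      by under eq_Rintegral do rewrite indic0 subr0 normr0; rewrite Rintegral_cst1 ltW.
    by under eq_Rintegral do rewrite indic0 subr0 normr0; rewrite Rintegral_cst1 ltW.
  split => //; first by move=> A GA; rewrite setTD; exact: GC.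
  move=> A GA; pose B n := \big[setU/set0]_(i < n) A i.
  have GB n : G (B n).
    rewrite /B; elim: n => [|n ih]; first by rewrite big_ord0.
    by rewrite big_ord_recr/= -(setCK (_ `|` _)) setCU; apply/GC/GI; exact: GC.
  apply: (@approx_lim (fun n => \1_(B n))) => // x.
  rewrite [X in _ --> X]indicE; have [xA|xA] := boolP (x \in _).
    move: xA; rewrite inE => -[i _ Aix].
    apply: cvg_near_cst; near=> n.
    rewrite indicE mem_set// /B -bigcup_mkord; exists i => //=.
    by near: n; exact: nbhs_infty_gt.
  apply: cvg_near_cst; apply: nearW => n; rewrite indicE memNset//.
  rewrite /B -bigcup_mkord => -[i _ Aix]; move/negP : xA; apply; rewrite inE.
  by exists i.
move=> A oA; have [k [ck k01 kA]] := open_indic_approx oA.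
apply: approx_lim kA => // n; split; first exact: bm_unit.
move=> e e0; exists (k n) => //; split => //.
  by under eq_Rintegral do rewrite subrr normr0; rewrite Rintegral_cst1 ltW.
by under eq_Rintegral do rewrite subrr normr0; rewrite Rintegral_cst1 ltW.
Unshelve. all: by end_near. Qed.

Variable e : R.
Hypothesis close : forall k : S -> R, continuous k -> (forall x, `|k x| <= 1) ->
  `|\int[p1]_x k x - \int[p2]_x k x| <= e.

Let close_indic (A : set S) : measurable A ->
  `|\int[p1]_x \1_A x - \int[p2]_x \1_A x| <= e.
Proof.
move=> mA; apply/ler_addgt0Pr => c c0.
have [bA aA] := approx_indic mA.
have c2 : 0 < c / 2 by rewrite divr_gt0.
have [k ck [k01 k1 k2]] := aA _ c2.
have bk := bm_unit ck k01.
have kle x : `|k x| <= 1 by have /andP[h0 h1] := k01 x; rewrite ger0_norm.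
have H (p : probability S R) : \int[p]_x `|\1_A x - k x| <= c / 2 ->
    `|\int[p]_x \1_A x - \int[p]_x k x| <= c / 2.
  move=> h; apply: le_trans h; rewrite -bm_RintegralB//.
  by apply: bm_norm_Rintegral; exact: bm_sub.
have := close ck kle; have := H _ k1; have := H _ k2.
set a := \int[p1]_x \1_A x; set b := \int[p2]_x \1_A x.
rewrite !ler_norml => /andP[h1 h2] /andP[h3 h4] /andP[h5 h6].
by apply/andP; split; lra.
Qed.

(** Approximation carries the bound [e] to Borel indicators without loss; the factor 2 comes from
    [mean_close]. This turns (A1) into continuity in total variation. *)
Lemma close_bounded (h : S -> R) : measurable_fun [set: S] h ->
  (forall x, `|h x| <= 1) -> `|\int[p1]_x h x - \int[p2]_x h x| <= 2 * e.
Proof.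
exact: (mean_close (Rintegral_mean p1) (Rintegral_mean p2) close_indic).
Qed.

End total_variation.

(** An ultrafilter finer than the filter of cofinite sets. A single filter gives a limit to all
    bounded sequences at once, which replaces the extraction of subsequences. *)
Lemma exists_limit_filter (R : realType) : exists F : set_system nat,
  [/\ ProperFilter F, (forall P, (\forall n \near \oo, P n) -> F P) &
      forall (a : nat -> R) (M : R), (forall n, `|a n| <= M)%R ->
        exists l : R, a n @[n --> F] --> l].
Proof.
have [F [UF sF]] := ultraFilterLemma (eventually_filter).
have PF : ProperFilter F by exact: ultra_proper.
exists F; split => // a M aM.
have [|l [_ cl]] := @segment_compact R (- M)%R M (a @ F) _.
  by apply: (@filterE _ F) => n /=; rewrite in_itv/= -ler_norml.
exists l => V nV.
have [//|Fc] := in_ultra_setVsetC (a @^-1` V) UF.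
have [t [nVt Vt]] : (~` V `&` V) !=set0 by apply: cl.
by exfalso; exact: nVt.
Qed.

(** * Borel sets of products and compactness arguments *)

Section second_countable_product.
Local Open Scope ring_scope.

Lemma second_countable_prod (X Y : topologicalType) :
  @second_countable X -> @second_countable Y -> @second_countable (X * Y)%type.
Proof.
move=> [B1 cB1 [oB1 bB1]] [B2 cB2 [oB2 bB2]].
exists ((fun b => b.1 `*` b.2) @` (B1 `*` B2)).
  by apply: sub_countable (card_image_le _ _) _; exact: countableX.
split.
  move=> _ [[b1 b2] /= [h1 h2] <-].
  rewrite openE => -[x y] [/= b1x b2y]; exists (b1, b2) => //=.
  by split; apply: open_nbhs_nbhs; split => //; [exact: oB1|exact: oB2].
move=> [x y] V /= [[V1 V2] /= [nV1 nV2] VV].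
have [b1 [hb1 b1x] b1V] := bB1 x _ nV1.
have [b2 [hb2 b2y] b2V] := bB2 y _ nV2.
exists (b1 `*` b2) => /=; first by split => //; exists (b1, b2).
by move=> [a b] /= [ha hb]; apply: VV; split => /=; [exact: b1V|exact: b2V].
Qed.

Lemma countable_bigcup_measurable d (T : measurableType d) I (D : set I)
    (F : I -> set T) : countable D -> (forall i, D i -> measurable (F i)) ->
  measurable (\bigcup_(i in D) F i).
Proof.
move=> /countable_injP[f injf] mF.
rewrite (_ : \bigcup_(i in D) F i =
  \bigcup_n \bigcup_(i in D `&` f @^-1` [set n]) F i); last first.
  apply/seteqP; split => [t [i Di Fit]|t [n _ [i [Di _] Fit]]].
    by exists (f i) => //; exists i => //; split.
  by exists i.
apply: bigcup_measurable => n _.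
have [->|/set0P[i [Di fi]]] := eqVneq (D `&` f @^-1` [set n]) set0.
  by rewrite bigcup_set0.
rewrite (_ : D `&` _ = [set i]) ?bigcup_set1; first exact: mF.
apply/seteqP; split => [j [Dj fj]|_ ->//].
by apply: injf; rewrite ?inE//; rewrite fi.
Qed.

Lemma open_prod_bigcup (X Y : topologicalType) (B1 : set (set X))
    (B2 : set (set Y)) (O : set (X * Y)) : basis B1 -> basis B2 -> open O ->
  O = \bigcup_(b in (B1 `*` B2) `&` [set b | b.1 `*` b.2 `<=` O]) (b.1 `*` b.2).
Proof.
move=> [oB1 bB1] [oB2 bB2] oO; apply/seteqP; split; last first.
  by move=> z [b [_ bO]]; exact: bO.
move=> [x y] Oxy.
have [[V1 V2] /= [nV1 nV2] VV] : nbhs (x, y) O by exact: open_nbhs_nbhs.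
have [b1 [hb1 b1x] b1V] := bB1 x _ nV1.
have [b2 [hb2 b2y] b2V] := bB2 y _ nV2.
exists (b1, b2) => //; split => // -[a b] /= [ha hb].
by apply: VV; split => /=; [exact: b1V|exact: b2V].
Qed.

Context (dS dU : measure_display) (R : realType)
  (S : borelMetricType dS R) (U : borelMetricType dU R).
Hypotheses (compactS : compact [set: S]) (compactU : compact [set: U]).

(** By second countability an open set is a countable union of open rectangles, hence lies in the
    product sigma-algebra. *)
Lemma borel_prod_open (A : set (S * U)) : open A -> measurable A.
Proof.
have [B1 cB1 bB1] := compact_second_countable compactS.
have [B2 cB2 bB2] := compact_second_countable compactU.
move=> /(open_prod_bigcup bB1 bB2) ->.
apply: countable_bigcup_measurable.
  exact: sub_countable (subset_card_le (@subIsetl _ _ _)) (countableX cB1 cB2).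
move=> [b1 b2] [[/= h1 h2] _]; apply: measurableX; apply: borel_open.
  exact: bB1.1.
exact: bB2.1.
Qed.

Lemma borel_prod3_open (A : set (S * U * S)) : open A -> measurable A.
Proof.
have [B1 cB1 bB1] := second_countable_prod
  (compact_second_countable compactS) (compact_second_countable compactU).
have [B2 cB2 bB2] := compact_second_countable compactS.
move=> /(open_prod_bigcup bB1 bB2) ->.
apply: countable_bigcup_measurable.
  exact: sub_countable (subset_card_le (@subIsetl _ _ _)) (countableX cB1 cB2).
move=> [b1 b2] [[/= h1 h2] _]; apply: measurableX.
  by apply: borel_prod_open; exact: bB1.1.
by apply: borel_open; exact: bB2.1.
Qed.

Lemma borel_prod3_continuous (f : S * U * S -> R) : continuous f ->
  measurable_fun [set: S * U * S] f.
Proof.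
move=> cf; apply: (measurability _ (RGenOpens.measurableE R)).
move=> _ [_ [a [b ->]] <-]; rewrite setTI; apply: borel_prod3_open.
by apply: open_comp => [x _|]; [exact: cf|exact: interval_open].
Qed.

End second_countable_product.

Section compact_uniform.
Context (X : topologicalType) (R : realType).
Local Open Scope ring_scope.
Hypothesis cX : compact [set: X].

(** The index filter is arbitrary, as this serves both for sequences and for limits along the filter
    of [exists_limit_filter]. *)
Lemma equicontinuous_cvg_uniform I (F : set_system I) (g : I -> X -> R) :
  Filter F ->
  (forall x e, 0 < e -> \forall y \near x, forall i, `|g i y - g i x| <= e) ->
  (forall x e, 0 < e -> \forall i \near F, `|g i x| <= e) ->
  forall e, 0 < e -> \forall i \near F, forall x, `|g i x| <= e.
Proof.
move=> FF eg cg e e0.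
have e2 : 0 < e / 2 by rewrite divr_gt0.
have := (compact_near_coveringP [set: X]).1 cX I F
  (fun i x => `|g i x| <= e) FF.
have H x : [set: X] x -> \forall x' \near x & i \near F, `|g i x'| <= e.
  move=> _; exists ([set x' | forall i, `|g i x' - g i x| <= e / 2],
    [set i | `|g i x| <= e / 2]); first by split; [exact: eg|exact: cg].
  move=> [x' i] [/= h1 h2].
  rewrite -(subrK (g i x) (g i x')) (le_trans (ler_normD _ _))//.
  by rewrite [leRHS]splitr lerD.
by move=> /(_ H); apply: filterS => i h x; exact: h.
Qed.

End compact_uniform.

Section closed_projection.
Context (X Y : topologicalType).

(** Tube lemma: if a whole fibre avoids [A], then by compactness of [Y] so do all nearby fibres. *)
Lemma closed_fst_image (A : set (X * Y)) : compact [set: Y] -> closed A ->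
  closed (fst @` A).
Proof.
move=> cY clA; rewrite -[X in closed X]setCK; apply: open_closedC.
rewrite openE => x nAx; rewrite /interior.
have := (compact_near_coveringP [set: Y]).1 cY X (nbhs x)
  (fun x' y => ~ A (x', y)) _.
have H y : [set: Y] y -> \forall y' \near y & x' \near x, ~ A (x', y').
  move=> _.
  have : nbhs (x, y) (~` A).
    apply: open_nbhs_nbhs; split; first exact: closed_openC.
    by move=> Axy; apply: nAx; exists (x, y).
  case=> -[V1 V2] /= [nV1 nV2] VV; exists (V2, V1) => //=.
  by move=> [y' x'] /= [h1 h2]; exact: (VV (x', y')).
move=> /(_ _ H); apply: filterS => x' h [[a b] /= Aab ax'].
by apply: (h b) => //; rewrite -ax'.
Qed.

End closed_projection.

Lemma compact_nested (U : topologicalType) (F : nat -> set U) :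
  compact [set: U] -> (forall n, closed (F n)) -> (forall n, F n !=set0) ->
  (forall n, F n.+1 `<=` F n) -> \bigcap_n F n !=set0.
Proof.
move=> cU clF F0 dF.
have dF' m n : (m <= n)%N -> F n `<=` F m.
  move=> /subnKC <-; elim: (n - m)%N => [|k ih]; first by rewrite addn0.
  by rewrite addnS; exact: subset_trans (dF _) ih.
pose G := filter_from [set: nat] F.
have FG : ProperFilter G.
  apply: filter_from_proper => [|n _]; last exact: F0.
  apply: filter_from_filter; first by exists 0%N.
  move=> m n _ _; exists (maxn m n) => //.
  by move=> u Fu; split; apply: dF' Fu; rewrite ?leq_maxl ?leq_maxr.
have [u [_ clu]] := cU G FG (@filterT _ _ _).
exists u => n _; apply: clF => V nV; apply: clu => //; first by exists n.
Qed.

(** * Measurable selection from a closed set with compact sections *)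

Section measurable_selection.
Context (dS dU : measure_display) (R : realType)
  (S : borelMetricType dS R) (U : borelMetricType dU R).
Hypothesis compactU : compact [set: U].
Variable M : set (S * U).
Hypotheses (closedM : closed M) (exM : forall x, exists u, M (x, u)).
Local Open Scope ring_scope.

(** Closures of the members of a countable base, numbered by an injection [f]. The intersection has
    at most one term; for [n] outside the range of [f] it is empty and [C n] is the whole space. *)
Let separating : exists C : nat -> set U, (forall n, closed (C n)) /\
  forall u v, (forall n, C n u -> C n v) -> u = v.
Proof.
have [B /countable_injP[f injf] [oB bB]] := compact_second_countable compactU.
exists (fun n => \bigcap_(b in B `&` f @^-1` [set n]) closure b); split.
  by move=> n; apply: closed_bigI => b _; exact: closed_closure.
move=> u v uv; apply: contrapT => neq.
have := @metric_hausdorff _ U; rewrite open_hausdorff.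
move=> /(_ u v (introN eqP neq)) [[V W] [/= Vu Wv] [oV oW /eqP VW]].
have [b [Bb bu] bV] : filter_from [set b | B b /\ b u] id V.
  by apply: bB; apply: open_nbhs_nbhs; split => //; rewrite inE in Vu.
have : closure b v.
  apply: (uv (f b)); last by split.
  move=> b' [Bb' fb']; suff -> : b' = b by exact: subset_closure.
  by apply: injf; rewrite ?inE.
move=> /(_ W) [|t [bt Wt]].
  by apply: open_nbhs_nbhs; split => //; rewrite inE in Wv.
have : (V `&` W) t by split => //; exact: bV.
by rewrite VW.
Qed.

Let C := projT1 (cid separating).
Let closedC n : closed (C n). Proof. exact: (projT2 (cid separating)).1. Qed.
Let sepC u v : (forall n, C n u -> C n v) -> u = v.
Proof. exact: (projT2 (cid separating)).2. Qed.

(** The section of [M] at [x] is cut by [C m] whenever something remains. The closed sets obtained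
    decrease and stay nonempty, and what is left in the limit is a single point, the selected
    one. *)
Fixpoint selection_step (n : nat) (x : S) : set U :=
  if n is m.+1 then
    if `[< (selection_step m x `&` C m) !=set0 >]
    then selection_step m x `&` C m else selection_step m x
  else [set u | M (x, u)].

Let closed_step n x : closed (selection_step n x).
Proof.
elim: n => [|n ih] /=; last by case: asboolP => // _; exact: closedI.
rewrite (_ : [set u | _] = (fun u => (x, u)) @^-1` M)//.
apply: preimage_closed => // u _.
by apply: cvg_pair; [exact: cvg_cst|exact: cvg_id].
Qed.

Let step_nonempty n x : selection_step n x !=set0.
Proof. by elim: n => [|n ih] /=; [exact: exM|case: asboolP]. Qed.

Let step_sub n x : selection_step n.+1 x `<=` selection_step n x.
Proof. by move=> u /=; case: asboolP => // _ []. Qed.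

Let selection_ex x : exists u, forall n, selection_step n x u.
Proof.
have [u hu] := compact_nested compactU (closed_step^~ x) (step_nonempty^~ x)
  (step_sub^~ x).
by exists u => n; exact: hu.
Qed.

Let sel x := projT1 (cid (selection_ex x)).
Let selP x n : selection_step n x (sel x).
Proof. exact: (projT2 (cid (selection_ex x))). Qed.

(** If [u] survives every step and lies in [C n], the cut by [C n] was nonempty and was made, so
    [sel x] lies in [C n] as well; then [C] cannot separate the two points. *)
Let sel_unique x u : (forall n, selection_step n x u) -> u = sel x.
Proof.
move=> hu; apply: sepC => n Cu.
have := selP x n.+1; rewrite /=; case: asboolP => [_ []//|ne _].
by exfalso; apply: ne; exists u.
Qed.

(** At step 0 the set is a projection of a closed set. Then step n+1 meets [D] iff step n meets
    [C n] inside [D], or step n misses [C n] and meets [D]; hence the induction over all closed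
    [D]. *)
Let measurable_step n D : closed D ->
  measurable [set x | (selection_step n x `&` D) !=set0].
Proof.
elim: n D => [|n ih] D clD /=.
  rewrite (_ : [set x | _] = fst @` (M `&` snd @^-1` D)).
    rewrite -[X in measurable X]setCK; apply: measurableC; apply: borel_open.
    apply: closed_openC; apply: closed_fst_image => //; apply: closedI => //.
    apply: preimage_closed => // -[a b] _ V nV.
    by exists (setT, V) => [|[a' b'] []//]; split => //; exact: filterT.
  by apply/seteqP; split => [x [u [Mu Du]]|_ [[x u] [Mu Du] <-]];
    [exists (x, u)|exists u].
pose P D := [set x | (selection_step n x `&` D) !=set0].
rewrite (_ : [set x | _] = P (C n `&` D) `|` (~` P (C n) `&` P D)).
  apply: measurableU; first by apply: ih; exact: closedI.
  by apply: measurableI; [apply: measurableC; exact: ih|exact: ih].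
apply/seteqP; split => x /=.
  case: asboolP => [h [u [[a b] c]]|h h']; first by left; exists u.
  by right.
move=> [[u [a [b c]]]|[h h']].
  by case: asboolP => [_|[]]; exists u.
by case: asboolP.
Qed.

(** If every step meets [D], the nested traces on [D] have a common point by compactness, and that
    point is [sel x] by uniqueness. *)
Let sel_closed D : closed D ->
  sel @^-1` D = \bigcap_n [set x | (selection_step n x `&` D) !=set0].
Proof.
move=> clD; apply/seteqP; split => [x Dx n _ /=|x h /=]; first by exists (sel x).
have [u hu] := compact_nested compactU
  (fun n => closedI (@closed_step n x) clD) (fun n => h n I)
  (fun n => @setSI _ _ _ _ (@step_sub n x)).
rewrite -(@sel_unique x u) => [|n]; first exact: (hu 0%N I).2.
exact: (hu n I).1.
Qed.

Lemma measurable_selection :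
  exists2 u : S -> U, measurable_fun [set: S] u & forall x, M (x, u x).
Proof.
exists sel; last by move=> x; exact: (selP x 0%N).
apply: (measurability _ (@borel_measurableE _ _ U)).
move=> _ [D oD <-]; rewrite setTI -[X in measurable X]setCK; apply: measurableC.
rewrite preimage_setC sel_closed; last exact: open_closedC.
by apply: bigcapT_measurable => n; apply: measurable_step; exact: open_closedC.
Qed.

End measurable_selection.

(** * Kernel integrals, limits inferior and logarithms *)

Section kernel_probability.
Context d d' (X : measurableType d) (Y : measurableType d') (R : realType).
Variables (k : R.-pker X ~> Y) (x : X).

Definition kprob : set Y -> \bar R := k x.

HB.instance Definition _ := Measure.on kprob.

Let kprob_setT : kprob [set: Y] = 1. Proof. exact: prob_kernel. Qed.

HB.instance Definition _ := Measure_isProbability.Build _ _ _ kprob kprob_setT.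

End kernel_probability.

Lemma bm_measurable_kernel d d' (X : measurableType d) (Y : measurableType d')
    (R : realType) (k : R.-pker X ~> Y) (f : X * Y -> R) :
  bounded_measurable f ->
  bounded_measurable (fun x => \int[kprob k x]_y f (x, y))%R.
Proof.
move=> [mf [M fM]].
have b1 x : bounded_measurable (fun y => f (x, y)).
  split; last by exists M => y; exact: fM.
  by apply: measurableT_comp => //; exact: pair1_measurable.
split; last by exists M => x; apply: bm_Rintegral_bound.
(* Shifting by the bound [M] reduces to a nonnegative integrand. *)
rewrite (_ : (fun _ => _) =
  (fun x => fine (\int[k x]_y (f (x, y) + M)%:E) - M)%R); last first.
  apply/funext => x.
  rewrite (_ : fine _ = (\int[kprob k x]_y (f (x, y) + M))%R)//.
  by rewrite bm_RintegralD ?Rintegral_cst1 ?addrK//; exact: bm_cst.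
apply: measurable_funB; last exact: measurable_cst.
apply: measurableT_comp => //.
apply: (measurable_fun_integral_finite_kernel (fun z => (f z + M)%:E) k).
  by move=> z; rewrite lee_fin -lerBlDr sub0r; have := fM z; rewrite ler_norml => /andP[].
by apply/measurable_EFinP; apply: measurable_funD => //; exact: measurable_cst.
Qed.

Lemma le_limn_einf (R : realType) (a b : nat -> \bar R) :
  (forall n, a n <= b n) -> limn_einf a <= limn_einf b.
Proof.
move=> ab; rewrite !limn_einf_lim; apply: lee_lim; try exact: is_cvg_einfs.
apply: nearW => n; apply: le_ereal_inf_tmp => _ [m mn <-].
by apply: le_trans (ab m); apply: ereal_inf_lbound; exists m.
Qed.

(** With [a = ln s] and [b] the logarithm of a constant, this says that constant factors do not
    affect exponential growth rates. *)
Lemma limn_einf_affine (R : realType) (a b : R) :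
  limn_einf (fun N => (N%:R^-1)%:E * (N%:R * a + b)%:E) = a%:E.
Proof.
suff H : (N%:R^-1)%:E * (N%:R * a + b)%:E @[N --> \oo] --> a%:E.
  exact: (cvg_limn_einf_sup H).1.
under eq_fun do rewrite -EFinM.
apply: cvg_EFin; first exact: nearW.
have : (a + n%:R^-1 * b @[n --> \oo] --> a + 0 * b)%R.
  apply: cvgD; first exact: cvg_cst.
  apply: cvgM; last exact: cvg_cst.
  apply/gtr0_cvgV0; last exact: cvgr_idn.
  by near=> n; rewrite ltr0n; near: n; exact: nbhs_infty_gt.
rewrite mul0r addr0; apply: cvg_trans; apply: near_eq_cvg; near=> n.
rewrite /= mulrDr mulrA mulVf ?mul1r// pnatr_eq0 -lt0n.
by near: n; exact: nbhs_infty_gt.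
Unshelve. all: by end_near. Qed.

(** For [rho = 0] the upper bounds alone force [-oo], as [ln s] takes every real value; for
    [rho > 0] they are used at [s = rho * expR e] with [e] tending to 0. *)
Lemma eq_lne_lim (R : realType) (rho : R) (a : \bar R) : (0 <= rho)%R ->
  (forall s, (rho < s)%R -> a <= (ln s)%:E) ->
  ((0 < rho)%R -> (ln rho)%:E <= a) -> a = lne rho%:E.
Proof.
rewrite le_eqVlt => /orP[/eqP <-|rho0] le_a ge_a.
  have aN t : a <= t%:E by rewrite -(expRK t); apply: le_a; rewrite expR_gt0.
  rewrite [RHS]/= lexx; case: a aN {le_a ge_a} => // [t|].
    by move=> /(_ (t - 1)%R); rewrite lee_fin lerBrDr gerDl ler10.
  by move=> /(_ 0%R).
rewrite lne_EFin//; apply/le_anti/andP; split; last exact: ge_a.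
apply/lee_addgt0Pr => e e0.
rewrite -EFinD -[e in _ <= (_ + e)%:E](expRK e) -lnM ?posrE ?expR_gt0//.
by apply: le_a; rewrite ltr_pMr// -expR0 ltr_expR.
Qed.

(** * Relative entropy and densities *)

Section relative_entropy_theory.
Context d (T : measurableType d) (R : realType).
Implicit Types (mu nu : {measure set T -> \bar R}).

(** The integral of a nonnegative function is a supremum over the simple functions below it, hence
    monotone for arbitrary functions. It is applied to the relative entropy as a function of the
    state and control, whose measurability is not established. *)
Lemma le_integral_nonmeas mu (f g : T -> \bar R) : (forall x, f x <= g x) ->
  \int[mu]_x f x <= \int[mu]_x g x.
Proof.
move=> fg.
have H (a b : T -> \bar R) : (forall x, 0 <= a x) -> (forall x, a x <= b x) ->
    \int[mu]_x a x <= \int[mu]_x b x.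
  move=> a0 ab; have b0 x : 0 <= b x by exact: le_trans (ab x).
  rewrite !ge0_integralTE//; apply: ereal_sup_le => _ [h ha <-].
  by exists h => // x; exact: le_trans (ha x) (ab x).
rewrite [leLHS]integralE [leRHS]integralE; apply: leeB; apply: H => //.
- by move=> x; rewrite !funeposE ge_max !le_max fg lexx orbT.
- by move=> x; rewrite !funenegE ge_max !le_max leeN2 fg lexx orbT.
Qed.

Import HBNNSimple.

Section density.
Variables (mu nu : {measure set T -> \bar R}) (l : T -> R).
Hypothesis dl : is_density mu nu l.

Let ml : measurable_fun [set: T] (EFin \o l).
Proof. by case: dl => ml _ _; exact/measurable_EFinP. Qed.

Let l0 x : (0 <= l x)%R. Proof. by case: dl. Qed.

Let ge0_integral_density_nnsfun (f : {nnsfun T >-> R}) :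
  \int[mu]_x (f x)%:E = \int[nu]_x ((f x)%:E * (l x)%:E).
Proof.
under [in LHS]eq_integral do rewrite fimfunE -fsumEFin//.
rewrite ge0_integral_fsum//; last 2 first.
  - by move=> r; exact/measurable_EFinP/measurableT_comp.
  - by move=> r z _; rewrite EFinM nnfun_muleindic_ge0.
under [in RHS]eq_integral.
  move=> x _; rewrite fimfunE -fsumEFin// ge0_mule_fsuml; last first.
    by move=> r /=; rewrite EFinM nnfun_muleindic_ge0.
  over.
rewrite /= ge0_integral_fsum//; last 2 first.
  - move=> r; apply: emeasurable_funM => //.
    exact/measurable_EFinP/measurableT_comp.
  - move=> r z _; apply: mule_ge0; last by rewrite lee_fin.
    by rewrite EFinM nnfun_muleindic_ge0.
apply: eq_fsbigr => r _.
rewrite (integralZl_indic _ (fun r => f @^-1` [set r]))//; last first.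
  by move=> r0; rewrite preimage_nnfun0.
rewrite integral_indic// setIT.
have [r0|r0] := leP 0%R r; last first.
  rewrite preimage_nnfun0// measure0 mule0 integral0_eq// => x _.
  by rewrite indic0 mulr0 mul0e.
case: dl => _ _ ->//; rewrite [in LHS]integral_mkcond/= -ge0_integralZl//.
- apply: eq_integral => x _; rewrite restrict_EFin/= patchE indicE.
  by case: ifPn => _; rewrite ?mulr1 ?mulr0 -?EFinM ?mul0r ?mulr0.
- apply/measurable_restrict => //; rewrite setTI; exact: measurable_funTS.
- by move=> x _; rewrite restrict_EFin lee_fin patchE; case: ifPn.
Qed.

Lemma ge0_integral_density (g : T -> \bar R) : measurable_fun [set: T] g ->
  (forall x, 0 <= g x) -> \int[mu]_x g x = \int[nu]_x (g x * (l x)%:E).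
Proof.
move=> mg g0.
pose g_ := nnsfun_approx measurableT mg.
transitivity (limn (fun n => \int[mu]_x (g_ n x)%:E)).
  rewrite -monotone_convergence//.
  - by apply: eq_integral => x _; apply/esym/cvg_lim => //; exact: cvg_nnsfun_approx.
  - by move=> n; exact/measurable_EFinP.
  - by move=> n x _; rewrite lee_fin.
  - by move=> x _ a b ab; rewrite lee_fin; exact/lefP/nd_nnsfun_approx.
under eq_fun do rewrite ge0_integral_density_nnsfun.
rewrite -monotone_convergence//.
- apply: eq_integral => x _; apply/cvg_lim => //.
  apply: cvgeZr => //; exact: cvg_nnsfun_approx.
- by move=> n; apply: emeasurable_funM => //; exact/measurable_EFinP.
- by move=> n x _; rewrite mule_ge0 ?lee_fin.
- move=> x _ a b ab; apply: lee_wpmul2r; rewrite ?lee_fin//.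
  exact/lefP/nd_nnsfun_approx.
Qed.

Lemma integral_density (g : T -> \bar R) : measurable_fun [set: T] g ->
  \int[mu]_x g x = \int[nu]_x (g x * (l x)%:E).
Proof.
move=> mg; rewrite [LHS]integralE [RHS]integralE.
rewrite ge0_integral_density//; last exact: measurable_funepos.
rewrite ge0_integral_density//; last exact: measurable_funeneg.
congr (_ - _); apply: eq_integral => x _.
  by rewrite !funeposE maxe_pMl ?lee_fin// mul0e.
by rewrite !funenegE maxe_pMl ?lee_fin// mul0e mulNe.
Qed.

End density.

Lemma measurable_lne_EFin : measurable_fun [set: R] (fun t => lne t%:E).
Proof.
rewrite (_ : (fun _ => _) = fun t : R => if (t <= 0)%R then -oo else (ln t)%:E)//.
apply: measurable_fun_ifT.
- by apply: measurable_fun_ler => //; exact: measurable_cst.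
- exact: measurable_cst.
- by apply/measurable_EFinP; exact: measurable_ln.
Qed.

(** At [t = 0] the convention [-oo * 0 = 0] agrees with the usual value of [t ln t]. *)
Lemma lne_mul_ln (t : R) : (0 <= t)%R -> lne t%:E * t%:E = (t * ln t)%:E.
Proof.
rewrite le_eqVlt => /orP[/eqP <-|t0]; first by rewrite mule0 mul0r.
by rewrite lne_EFin// -EFinM mulrC.
Qed.

(** A consequence of [ln (1 / t) < 1 / t]. It makes the negative part of [l ln l] integrable against
    a probability. *)
Lemma mul_ln_geN1 (t : R) : (0 <= t)%R -> (- 1 <= t * ln t)%R.
Proof.
rewrite le_eqVlt => /orP[/eqP <-|t0]; first by rewrite mul0r oppr_le0.
have : (- ln t < t^-1)%R by rewrite -lnV ?posrE// ln_sublinear// invr_gt0.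
by rewrite -(ltr_pM2l t0) mulfV ?gt_eqF// mulrN ltrNl => /ltW.
Qed.

(** The inequality [ln v <= v - 1] at [v = w / t], multiplied by [t]: the pointwise form of Gibbs'
    inequality. *)
Lemma mul_ln_le (t w : R) : (0 <= t)%R -> (0 < w)%R ->
  (t * ln w <= t * ln t + (w - t))%R.
Proof.
rewrite le_eqVlt => /orP[/eqP <- w0|t0 w0].
  by rewrite !mul0r add0r subr0 ltW.
have : (ln (1 + (w / t - 1)) <= w / t - 1)%R.
  by apply: le_ln1Dx; rewrite ltrBrDr addrC subrr divr_gt0.
rewrite addrC subrK lnM ?posrE ?invr_gt0// lnV ?posrE// -(ler_pM2l t0).
by rewrite !mulrBr mulr1 mulrCA divff ?mulr1 ?gt_eqF// lerBlDl.
Qed.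

Lemma is_density_integral mu nu l : is_density mu nu l ->
  \int[nu]_x (l x)%:E = mu [set: T].
Proof. by case=> _ _ ->. Qed.

Lemma is_density_integrable mu nu l : mu [set: T] < +oo -> is_density mu nu l ->
  nu.-integrable [set: T] (EFin \o l).
Proof.
move=> fmu dl; have [ml l0 _] := dl; apply/integrableP; split.
  exact/measurable_EFinP.
rewrite (eq_integral (EFin \o l)) => [|x _]; last by rewrite /= ger0_norm.
by rewrite (is_density_integral dl).
Qed.

(** Two densities agree [nu]-almost everywhere, so the one chosen in the definition may be replaced
    by [l]. Against [nu] the integrand is bounded below by -1. *)
Lemma relative_entropyE mu nu l : mu [set: T] < +oo -> is_density mu nu l ->
  relative_entropy mu nu = \int[nu]_x (l x * ln (l x))%:E.
Proof.
move=> fmu dl; rewrite /relative_entropy.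
case: pselect => [ex|[]]; last by exists l.
have dl' := projT2 (cid ex); set l' := projT1 _ in dl' *.
have [ml l0 lE] := dl; have [ml' l'0 l'E] := dl'.
rewrite (integral_density dl'); last first.
  exact: (measurableT_comp measurable_lne_EFin ml').
under eq_integral do rewrite lne_mul_ln//.
have mlln (h : T -> R) : measurable_fun [set: T] h ->
    measurable_fun [set: T] (fun x => (h x * ln (h x))%:E).
  move=> mh; apply/measurable_EFinP; apply: measurable_funM => //.
  by apply: measurableT_comp mh; exact: measurable_ln.
apply: ae_eq_integral => //; [exact: mlln|exact: mlln|].
have [|||] := @integral_ae_eq _ _ _ nu setT measurableT (EFin \o l) (EFin \o l').
- exact: is_density_integrable dl'.
- exact/measurable_EFinP.
- by move=> A _ mA; rewrite -lE// -l'E.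
move=> N [mN N0 sN]; exists N; split => // x /= h; apply: sN => /= h'.
by apply: h => _; have [->] := h' I.
Qed.

(** Integrate [l ln w <= l ln l + (w - l)] against [nu]: the last term contributes at most 1 - 1 =
    0. *)
Lemma gibbs mu nu (w : T -> R) (a b : R) : mu [set: T] = 1 -> nu [set: T] = 1 ->
  measurable_fun [set: T] w -> (0 < a)%R -> (forall x, a <= w x <= b)%R ->
  \int[nu]_x (w x)%:E <= 1 ->
  \int[mu]_x (ln (w x))%:E <= relative_entropy mu nu.
Proof.
move=> mu1 nu1 mw a0 wab w1.
have [[l dl]|nol] := pselect (exists l, is_density mu nu l); last first.
  by rewrite /relative_entropy; case: pselect => // _; exact: leey.
have fmu : mu [set: T] < +oo by rewrite mu1 ltry.
have [ml l0 lE] := dl.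
have w0 x : (0 < w x)%R by have /andP[+ _] := wab x; exact: lt_le_trans.
rewrite (relative_entropyE fmu dl) (integral_density dl); last first.
  by apply/measurable_EFinP; apply: measurableT_comp mw; exact: measurable_ln.
pose k x := (l x * ln (l x))%:E.
have mk : measurable_fun [set: T] k.
  apply/measurable_EFinP; apply: measurable_funM => //.
  by apply: measurableT_comp ml; exact: measurable_ln.
have kneg x : k^\- x <= 1.
  rewrite funenegE ge_max lee01 andbT /k -EFinN lee_fin lerNl.
  exact: mul_ln_geN1.
have ikneg : \int[nu]_x k^\- x <= 1.
  apply: le_trans (le_integral_nonmeas nu kneg) _.
  by rewrite integral_cst// nu1 mule1.
have ikneg_fin : \int[nu]_x k^\- x \is a fin_num.
  rewrite ge0_fin_numE ?(le_lt_trans ikneg) ?ltry//.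
  by apply: integral_ge0 => x _; exact: funeneg_ge0.
(* If the positive part of [l ln l] has infinite integral, the entropy is [+oo] and nothing remains
   to prove; otherwise [l ln l] is integrable and the integrals may be split. *)
have [ikpos|ikpos] := eqVneq (\int[nu]_x k^\+ x) +oo.
  rewrite [leRHS]integralE ikpos addye ?leey//.
  by move: ikneg_fin; rewrite fin_numE eqe_oppLR => /andP[_ +]; apply: contraNneq => /= ->.
have ik : nu.-integrable [set: T] k.
  apply/integrableP; split => //.
  rewrite (_ : (fun x => `|k x|) = k^\+ \+ k^\-); last by rewrite -fune_abse.
  rewrite ge0_integralD//; [|exact: measurable_funepos|exact: measurable_funeneg].
  rewrite lte_add_pinfty ?ltey//; last by move: ikneg_fin; rewrite fin_numE => /andP[].
have il := is_density_integrable fmu dl.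
have iw : nu.-integrable [set: T] (EFin \o w).
  apply/integrableP; split; first exact/measurable_EFinP.
  rewrite (eq_integral (EFin \o w)) => [|x _]; last by rewrite /= gtr0_norm.
  by rewrite (le_lt_trans w1) ?ltry.
apply: le_trans (_ : \int[nu]_x (k x + ((w x)%:E - (l x)%:E)) <= _).
  apply: le_integral_nonmeas => x; rewrite /k -EFinB -EFinD -EFinM lee_fin mulrC.
  exact: mul_ln_le.
rewrite integralD//; last exact: integrableB.
rewrite integralB// (is_density_integral dl) mu1.
rewrite -[leRHS]adde0 leeD2l// -(subee (x := 1))// leeB//.
Qed.

End relative_entropy_theory.

(** * Kernels with densities, image laws and laws carried by a graph *)

Section kernel_density.
Context d d' (X : measurableType d) (Y : measurableType d') (R : realType).
Variables (k : R.-pker X ~> Y) (l : X * Y -> R).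
Hypotheses (ml : measurable_fun [set: X * Y] l) (l_ge0 : forall z, (0 <= l z)%R)
  (l1 : forall x, \int[k x]_y (l (x, y))%:E = 1).

Definition kdensity (_ : measurable_fun [set: X * Y] l) (_ : forall z, (0 <= l z)%R)
    (_ : forall x, \int[k x]_y (l (x, y))%:E = 1) (x : X) (A : set Y) : \bar R :=
  \int[k x]_(y in A) (l (x, y))%:E.

Local Notation kd := (kdensity ml l_ge0 l1).

Let ml1 x : measurable_fun [set: Y] (fun y => (l (x, y))%:E).
Proof.
by apply/measurable_EFinP; apply: measurableT_comp => //; exact: pair1_measurable.
Qed.

Let kdensity0 x : kd x set0 = 0.
Proof. exact: integral_set0. Qed.

Let kdensity_ge0 x A : 0 <= kd x A.
Proof. by apply: integral_ge0 => y _; rewrite lee_fin. Qed.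

Let kdensity_additive x : semi_sigma_additive (kd x).
Proof.
move=> F mF tF mUF; rewrite /kdensity ge0_integral_bigcup//.
- apply: is_cvg_nneseries => n _ _; apply: integral_ge0 => y _.
  by rewrite lee_fin.
- exact: measurable_funTS.
- by move=> y _; rewrite lee_fin.
Qed.

HB.instance Definition _ x := isMeasure.Build _ _ _
  (kd x) (kdensity0 x) (kdensity_ge0 x) (@kdensity_additive x).

Definition mkdensity : X -> {measure set Y -> \bar R} := kd.

Let measurable_mkdensity A : measurable A -> measurable_fun [set: X] (mkdensity ^~ A).
Proof.
move=> mA.
rewrite (_ : (fun _ => _) = fun x => \int[k x]_y (l (x, y) * \1_A y)%:E).
  apply: (measurable_fun_integral_finite_kernel (fun z => (l z * \1_A z.2)%:E) k).
    by move=> z; rewrite lee_fin mulr_ge0.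
  apply/measurable_EFinP; apply: measurable_funM => //.
  by apply: measurableT_comp; [exact: measurable_indic|exact: measurable_snd].
apply/funext => x; rewrite /mkdensity/= /kdensity integral_mkcond.
apply: eq_integral => y _; rewrite patchE indicE.
by case: ifPn => _; rewrite ?mulr1 ?mulr0.
Qed.

HB.instance Definition _ := isKernel.Build _ _ _ _ _ mkdensity measurable_mkdensity.

Let mkdensity_prob x : mkdensity x [set: Y] = 1.
Proof. exact: l1. Qed.

HB.instance Definition _ :=
  Kernel_isProbability.Build _ _ _ _ _ mkdensity mkdensity_prob.

Lemma mkdensityP x : is_density (mkdensity x) (k x) (fun y => l (x, y)).
Proof.
split => //; apply: measurableT_comp => //; exact: pair1_measurable.
Qed.

End kernel_density.

Lemma bm_Rintegral_disintegrate d d' (X : measurableType d) (Y : measurableType d')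
    (R : realType) (m : probability (X * Y)%type R) (mu : probability X R)
    (k : R.-pker X ~> Y) (h : X * Y -> R) :
  (forall A B, measurable A -> measurable B ->
    m (A `*` B) = \int[mu]_(x in A) k x B) ->
  bounded_measurable h ->
  (\int[m]_z h z = \int[mu]_x \int[kprob k x]_y h (x, y))%R.
Proof.
move=> mk bh; have [mh [M hM]] := bh.
have b1 (g : X * Y -> R) x : bounded_measurable g -> bounded_measurable (fun y => g (x, y)).
  move=> [mg [N gN]]; split; last by exists N => y; exact: gN.
  by apply: measurableT_comp => //; exact: pair1_measurable.
(* Both sides grow by [M] when [h] is replaced by the nonnegative function [h + M]. *)
rewrite -[LHS](addrK M%R) -[RHS](addrK M%R); congr (_ - _)%R.
have bM : bounded_measurable (fun z => h z + M)%R by apply: bm_add => //; exact: bm_cst.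
have hM0 z : (0 <= h z + M)%R.
  by rewrite -lerBlDr sub0r; have := hM z; rewrite ler_norml => /andP[].
have <- : (\int[m]_z (h z + M) = \int[m]_z h z + M)%R.
  by rewrite bm_RintegralD ?Rintegral_cst1//; exact: bm_cst.
have <- : (\int[mu]_x \int[kprob k x]_y (h (x, y) + M) =
    \int[mu]_x \int[kprob k x]_y h (x, y) + M)%R.
  rewrite -[in RHS](Rintegral_cst1 mu M) -bm_RintegralD.
  - apply: eq_Rintegral => x _; rewrite bm_RintegralD ?Rintegral_cst1//.
      exact: b1.
    exact: bm_cst.
  - exact: bm_measurable_kernel.
  - exact: bm_cst.
apply: EFin_inj; rewrite -bm_integral_EFin// -bm_integral_EFin.
  2: exact: (@bm_measurable_kernel _ _ _ _ _ k _ bM).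
rewrite (ge0_integral_disintegrate mk); last by move=> z; rewrite lee_fin.
  2: by apply/measurable_EFinP; exact: bM.1.
by apply: eq_integral => x _; rewrite -bm_integral_EFin//; exact: b1 bM.
Qed.

Lemma bm_Rintegral_ppush d d' (X : measurableType d) (Y : measurableType d')
    (R : realType) (m : probability X R) (f : X -> Y)
    (mf : measurable_fun [set: X] f) (h : Y -> R) : bounded_measurable h ->
  (\int[ppush m mf]_y h y = \int[m]_x h (f x))%R.
Proof.
move=> bh; have [mh [M hM]] := bh; congr fine.
rewrite /ppush integral_pushforward//; first exact/measurable_EFinP.
apply: (@bm_integrable _ _ _ m (h \o f)).
by split; [exact: measurableT_comp|exists M => x; exact: hM].
Qed.

Section image_law.
Context d d' (X : measurableType d) (Y : measurableType d') (R : realType).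
Variables (m : probability X R) (nu : probability Y R) (f : X -> Y).
Hypotheses (mf : measurable_fun [set: X] f)
  (mnu : forall A, measurable A -> m (f @^-1` A) = nu A).

Lemma ge0_integral_image (g : Y -> \bar R) : measurable_fun [set: Y] g ->
  (forall y, 0 <= g y) -> \int[m]_x g (f x) = \int[nu]_y g y.
Proof.
move=> mg g0; rewrite -(ge0_integral_ppush m mf)//.
by apply: eq_measure_integral => A mA _; exact: mnu.
Qed.

Lemma integrable_image (g : Y -> \bar R) : nu.-integrable [set: Y] g ->
  m.-integrable [set: X] (g \o f).
Proof.
move=> /integrableP[mg gi]; apply/integrableP; split; first exact: measurableT_comp.
rewrite (ge0_integral_image (g := fun y => `|g y|))//; exact: measurableT_comp.
Qed.

Lemma integral_image (g : Y -> \bar R) : nu.-integrable [set: Y] g ->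
  \int[m]_x g (f x) = \int[nu]_y g y.
Proof.
move=> gi; have /integrableP[mg _] := gi.
rewrite [LHS]integralE [RHS]integralE; congr (_ - _).
- rewrite -(ge0_integral_image (measurable_funepos mg) (funepos_ge0 g)).
  by apply: eq_integral => x _; rewrite !funeposE.
- rewrite -(ge0_integral_image (measurable_funeneg mg) (funeneg_ge0 g)).
  by apply: eq_integral => x _; rewrite !funenegE.
Qed.

End image_law.

Section disintegrate_integrable.
Context d d' (X : measurableType d) (Y : measurableType d') (R : realType).
Variables (m : probability (X * Y)%type R) (mu : probability X R)
  (k : R.-pker X ~> Y).
Hypothesis mk : forall A B, measurable A -> measurable B ->
  m (A `*` B) = \int[mu]_(x in A) k x B.

Lemma integral_disintegrate (f : X * Y -> \bar R) :
  m.-integrable [set: X * Y] f ->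
  \int[m]_z f z = \int[mu]_x \int[k x]_y f (x, y).
Proof.
move=> fi; have /integrableP[mf _] := fi.
have mp := measurable_funepos mf; have mn := measurable_funeneg mf.
have H (g : X * Y -> \bar R) : m.-integrable [set: X * Y] g ->
    (forall z, 0 <= g z) -> mu.-integrable [set: X] (fun x => \int[k x]_y g (x, y)).
  move=> /integrableP[mg gi] g0; apply/integrableP; split.
    exact: (measurable_fun_integral_finite_kernel g k g0 mg).
  under eq_integral do rewrite gee0_abs ?integral_ge0//.
  rewrite -(ge0_integral_disintegrate mk)//.
  by move: gi; under eq_integral do rewrite gee0_abs//.
rewrite [LHS]integralE !(ge0_integral_disintegrate mk)// -integralB//.
- apply: eq_integral => x _; rewrite [RHS]integralE.
  by congr (_ - _); apply: eq_integral => y _; rewrite ?funeposE ?funenegE.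
- by apply: H => [|y]; [exact: integrable_funepos|exact: funepos_ge0].
- by apply: H => [|y]; [exact: integrable_funeneg|exact: funeneg_ge0].
Qed.

End disintegrate_integrable.

(** Monotone convergence for the truncations of [g]. Truncating matters where the integrals against
    [m] are known only for bounded functions, as for a measure obtained from a mean. *)
Lemma integrable_monotone_bound d (X : measurableType d) (R : realType)
    (m : probability X R) (g : X -> R) (B : R) :
  measurable_fun [set: X] g -> (forall x, 0 <= g x)%R ->
  (forall n, \int[m]_x Num.min n%:R (g x) <= B)%R ->
  m.-integrable [set: X] (EFin \o g).
Proof.
move=> mg g0 gB; apply/integrableP; split; first exact/measurable_EFinP.
under eq_integral do rewrite /= ger0_norm//.
pose h (n : nat) (x : X) : R := Num.min n%:R (g x).
have mh n : measurable_fun [set: X] (h n).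
  by apply: measurable_minr => //; exact: measurable_cst.
have h0 n x : (0 <= h n x)%R by rewrite le_min ler0n g0.
have bh n : bounded_measurable (h n).
  by split => //; exists n%:R => x; rewrite ger0_norm// ge_min lexx.
have -> : (\int[m]_x (g x)%:E = limn (fun n => \int[m]_x (h n x)%:E))%E.
  rewrite -monotone_convergence//.
  - apply: eq_integral => x _; apply/esym/cvg_lim => //.
    apply: cvg_near_cst; near=> n; rewrite /h min_r//.
    by near: n; exact: nbhs_infty_ger.
  - by move=> n; exact/measurable_EFinP.
  - by move=> n x _; rewrite lee_fin.
  - move=> x _ a b ab; rewrite lee_fin /h le_min ge_min ler_nat ab/=.
    by rewrite ge_min lexx orbT.
apply: le_lt_trans (ltry B); apply: lime_le.
  apply: ereal_nondecreasing_is_cvgn => a b ab.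
  apply: le_integral_nonmeas => x.
  rewrite lee_fin /h le_min ge_min ler_nat ab/=.
  by rewrite ge_min lexx orbT.
by apply: nearW => n; rewrite (bm_integral_EFin _ (bh n)) lee_fin; exact: gB.
Unshelve. all: by end_near. Qed.

Section graph_law.
Context dS dU (S : measurableType dS) (U : measurableType dU) (R : realType).
Variables (mu : probability S R) (u : S -> U) (k : R.-pker (S * U) ~> S).
Hypotheses (mu_u : measurable_fun [set: S] u).

Let mgraph : measurable_fun [set: S] (fun x => (x, u x)).
Proof. by apply/measurable_fun_pairP; split => //=; exact: measurable_id. Qed.

Let mglue : measurable_fun [set: S * S] (fun z => ((z.1, u z.1), z.2)).
Proof.
apply/measurable_fun_pairP; split => /=; last exact: measurable_snd.
exact: (measurableT_comp mgraph measurable_fst).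
Qed.

(** The law of [((x, u x), y)] with [x] drawn from [mu] and [y] from [k (x, u x)]: the occupation
    measure of the stationary deterministic control [u] when [mu] is invariant. *)
Definition graph_law : probability (S * U * S)%type R :=
  mixture mu (mkmap (kprecomp k mgraph) mglue).

Lemma ge0_integral_graph_law (F : S * U * S -> \bar R) :
  measurable_fun [set: S * U * S] F -> (forall z, 0 <= F z) ->
  \int[graph_law]_z F z = \int[mu]_x \int[k (x, u x)]_y F ((x, u x), y).
Proof.
move=> mF F0; rewrite ge0_integral_mixture//.
by apply: eq_integral => x _; rewrite ge0_integral_kmap.
Qed.

Lemma graph_law_setX A B : measurable A -> measurable B ->
  graph_law (A `*` B) = \int[mu]_(x in (fun x => (x, u x)) @^-1` A) k (x, u x) B.
Proof.
move=> mA mB; rewrite integral_mkcond; apply: eq_integral => x _.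
transitivity (k (x, u x) ((fun y => ((x, u x), y)) @^-1` (A `*` B))) => //.
rewrite patchE; case: ifPn => xA.
  rewrite inE in xA; congr (k (x, u x) _).
  by apply/seteqP; split=> y /=; [case|split].
rewrite (_ : _ @^-1` _ = set0) ?measure0//.
by apply/seteqP; split=> y //= [] /mem_set Ax _; move: xA; rewrite notin_setE => /(_ (set_mem Ax)).
Qed.

Lemma graph_law_marginal12 A : measurable A ->
  graph_law (fst @^-1` A) = mu ((fun x => (x, u x)) @^-1` A).
Proof.
move=> mA; rewrite (_ : fst @^-1` A = A `*` setT); last first.
  by apply/seteqP; split => z //= -[].
rewrite graph_law_setX// (eq_integral (cst 1)) => [|x _]; last exact: prob_kernel.
rewrite integral_cst ?mul1e// -[X in measurable X]setTI; exact: mgraph.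
Qed.

Lemma graph_law_marginal1 A : measurable A ->
  graph_law ((fun z => z.1.1) @^-1` A) = mu A.
Proof.
move=> mA; have mA' : measurable (fst @^-1` A : set (S * U)).
  by rewrite -[X in measurable X]setTI; exact: measurable_fst.
exact: (graph_law_marginal12 mA').
Qed.

(** Convertible with [marginal1 graph_law], but carrying the structure of a probability. *)
Let m1 := ppush graph_law
  (measurableT_comp (@measurable_fst _ _ S U) (@measurable_fst _ _ (S * U)%type S)).

Lemma graph_law_disintegration : disintegration graph_law (kdirac mu_u) k.
Proof.
split => A B mA mB.
- transitivity (\int[mu]_(x in A) kdirac mu_u x B); last first.
    transitivity (\int[m1]_(x in A) kdirac mu_u x B) => //.
    by apply: eq_measure_integral => D mD _; exact/esym/graph_law_marginal1.
  rewrite /marginal12 /pushforward graph_law_marginal12//; last exact: measurableX.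
  rewrite (_ : _ @^-1` _ = A `&` u @^-1` B)//.
  have mu_uB : measurable (u @^-1` B) by rewrite -[X in measurable X]setTI; exact: mu_u.
  rewrite setIC -integral_indic//.
- pose m12 := ppush graph_law (@measurable_fst _ _ (S * U)%type S).
  transitivity (\int[m12]_(x in A) k x B) => //.
  rewrite integral_mkcond -(ge0_integral_image (m := mu) mgraph).
  + rewrite graph_law_setX// [LHS]integral_mkcond; apply: eq_integral => x _.
    by rewrite !patchE.
  + by move=> D mD; rewrite -graph_law_marginal12.
  + apply/(measurable_restrictT _ mA); apply: measurable_funTS.
    exact: (measurable_kernel k B mB).
  + by move=> z; rewrite patchE; case: ifPn.
Qed.

Hypothesis inv : forall A, measurable A -> \int[mu]_x k (x, u x) A = mu A.

Lemma graph_law_marginal3 A : measurable A -> graph_law (snd @^-1` A) = mu A.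
Proof.
move=> mA; rewrite (_ : snd @^-1` A = setT `*` A); last first.
  by apply/seteqP; split => z //= -[].
by rewrite graph_law_setX// preimage_setT inv.
Qed.

Lemma graph_law_ergodic : ergodic_occupation graph_law.
Proof.
exists (kdirac mu_u), k; split; first exact: graph_law_disintegration.
move=> A mA; transitivity (\int[mu]_x k (x, u x) A); last first.
  by rewrite inv// -graph_law_marginal1.
transitivity (\int[m1]_x kcomp (kdirac mu_u) k x A) => //.
transitivity (\int[mu]_x kcomp (kdirac mu_u) k x A).
  by apply: eq_measure_integral => D mD _; exact: graph_law_marginal1.
apply: eq_integral => x _; rewrite /kcomp /kdirac/= integral_dirac ?diracT ?mul1e//.
by apply: measurableT_comp (measurable_kernel k A mA) _; exact: pair1_measurable.
Qed.

End graph_law.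

(** * The Bellman operator *)

Section bellman.
Context (R : realType) (dS dU : measure_display)
  (S : borelMetricType dS R) (U : borelMetricType dU R).
Hypotheses (compactS : compact [set: S]) (compactU : compact [set: U]).
Variables (p : R.-pker (S * U) ~> S) (E : S * U * S -> R).
Local Open Scope ring_scope.
Variable C : R.
Hypotheses (cE : continuous E) (E_ge0 : forall z, 0 <= E z)
  (C_gt0 : 0 < C) (E_le : forall z, E z <= C).
Hypothesis A1 : equicontinuous
  [set f : S -> R | continuous f /\ (forall y, `|f y| <= 1)%R]
  (fun (f : S -> R) (xu : S * U) => (\int[p xu]_y f y)%R).

Lemma continuous_bm (f : S -> R) : continuous f -> bounded_measurable f.
Proof.
move=> cf; split; first exact: borel_continuous.
have [x _ fx] : exists2 c, c \in [set: S] & forall t, t \in [set: S] -> `|f t| <= `|f c|.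
  apply: compact_EVT_max => //; first by exists point.
  apply: continuous_subspaceT => x; apply: cvg_norm; exact: cf.
by exists `|f x| => y; apply: fx; rewrite inE.
Qed.

Lemma measurable_E : measurable_fun [set: S * U * S] E.
Proof. exact: borel_prod3_continuous. Qed.

Lemma bm_E : bounded_measurable E.
Proof.
by split; [exact: measurable_E|exists C => z; rewrite ger0_norm ?E_le].
Qed.

Lemma bm_E1 xu : bounded_measurable (fun y => E (xu, y)).
Proof.
split; last by exists C => z; rewrite ger0_norm ?E_le.
by apply: measurableT_comp; [exact: measurable_E|exact: pair1_measurable].
Qed.

Definition Gop (h : S -> R) (xu : S * U) : R :=
  \int[kprob p xu]_y (E (xu, y) * h y).

Lemma Gop_bm h : bounded_measurable h -> bounded_measurable (Gop h).
Proof.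
move=> [mh [M hM]].
apply: (@bm_measurable_kernel _ _ _ _ _ p (fun z => E z * h z.2)).
apply: bm_mul; first exact: bm_E.
by split; [exact: measurableT_comp|exists M => z; exact: hM].
Qed.

Lemma Gop_add h k xu : bounded_measurable h -> bounded_measurable k ->
  Gop (fun y => h y + k y) xu = Gop h xu + Gop k xu.
Proof.
move=> bh bk; rewrite /Gop -bm_RintegralD; [|exact/bm_mul/bh/bm_E1|exact/bm_mul/bk/bm_E1].
by apply: eq_Rintegral => y _; rewrite mulrDr.
Qed.

Lemma Gop_scale c h xu : bounded_measurable h ->
  Gop (fun y => c * h y) xu = c * Gop h xu.
Proof.
move=> bh; rewrite /Gop -bm_RintegralZ; last exact/bm_mul/bh/bm_E1.
by apply: eq_Rintegral => y _; rewrite mulrCA.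
Qed.

Lemma Gop_ge0 h xu : (forall y, 0 <= h y) -> 0 <= Gop h xu.
Proof. by move=> h0; apply: Rintegral_ge0 => y _; rewrite mulr_ge0. Qed.

Lemma Gop_le h k xu : bounded_measurable h -> bounded_measurable k ->
  (forall y, h y <= k y) -> Gop h xu <= Gop k xu.
Proof.
move=> bh bk hk; apply: bm_le_Rintegral.
- exact/bm_mul/bh/bm_E1.
- exact/bm_mul/bk/bm_E1.
- by move=> y; rewrite ler_wpM2l.
Qed.

Lemma Gop_norm h M xu : bounded_measurable h -> (forall y, `|h y| <= M) ->
  `|Gop h xu| <= C * M.
Proof.
move=> bh hM; apply: bm_Rintegral_bound; first exact/bm_mul/bh/bm_E1.
by move=> y; rewrite normrM ler_pM// ger0_norm ?E_le.
Qed.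

Lemma Gop_cvg (h_ : nat -> S -> R) h (M : R) xu :
  (forall n, measurable_fun [set: S] (h_ n)) ->
  (forall n x, `|h_ n x| <= M) ->
  (forall x, h_ n x @[n --> \oo] --> h x) ->
  Gop (h_ n) xu @[n --> \oo] --> Gop h xu.
Proof.
move=> mh hM hh; apply: (@bm_Rintegral_cvg _ _ _ _ _ _ (C * M)).
- move=> n; apply: measurable_funM => //; exact: (bm_E1 xu).1.
- by move=> n y; rewrite normrM ler_pM// ger0_norm ?E_le.
- by move=> y; apply: cvgM; [exact: cvg_cst|exact: hh].
Qed.

(** The increment splits into the variation of [E], uniform in [y] by compactness of [S], and that
    of [p] tested on [E (xu, y) * h y / C], which is bounded by 1 and covered by [close_bounded]. *)
Lemma Gop_equi (xu : S * U) (e : R) : 0 < e -> \forall xu' \near xu, forall h : S -> R,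
  measurable_fun [set: S] h -> (forall y, `|h y| <= 1) ->
  `|Gop h xu' - Gop h xu| <= e.
Proof.
move=> e0; have C0 := C_gt0.
have e2 : 0 < e / 2 by rewrite divr_gt0.
(* The bound from (A1) is doubled by [close_bounded] and multiplied by [C] on undoing the
   normalisation, which leaves [e / 2]. *)
have e4 : 0 < e / (4 * C) by rewrite divr_gt0// mulr_gt0.
have nE : \forall xu' \near xu, forall y, `|E (xu', y) - E (xu, y)| <= e / 2.
  have := (compact_near_coveringP [set: S]).1 compactS _ (nbhs xu)
    (fun xu' y => `|E (xu', y) - E (xu, y)| <= e / 2) _.
  have H y : [set: S] y -> \forall y' \near y & xu' \near xu,
      `|E (xu', y') - E (xu, y')| <= e / 2.
    move=> _; have e5 : 0 < e / 2 / 2 by rewrite divr_gt0.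
    have /cvgrPdist_le/(_ _ e5) [[V W] /= [nV nW] VW] := @cE (xu, y).
    exists (W, V) => // -[y' xu'] [/= Wy Vxu].
    have h1 := VW (xu', y') (conj Vxu Wy).
    have h2 := VW (xu, y') (conj (nbhs_singleton nV) Wy).
    rewrite -(subrK (E (xu, y)) (E (xu', y'))) -addrA.
    rewrite (le_trans (ler_normD _ _))// [leRHS]splitr lerD//.
    by rewrite distrC.
  by move=> /(_ _ H); apply: filterS => xu' h y; exact: h.
have nA : \forall xu' \near xu, forall f : S -> R, continuous f ->
    (forall y, `|f y| <= 1) ->
    `|\int[kprob p xu']_y f y - \int[kprob p xu]_y f y| <= e / (4 * C).
  have entE : entourage [set ab : R * R | ball ab.1 (e / (4 * C)) ab.2].
    exact: (entourage_ball R (PosNum e4)).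
  have := A1 xu entE; apply: filterS => xu' h f cf f1.
  by rewrite distrC; apply: ltW; exact: (h f (conj cf f1)).
move: nE nA; apply: filterS2 => xu' h1 h2 h mh hle.
have bh : bounded_measurable h by split => //; exists 1.
rewrite /Gop.
set a := \int[kprob p xu']_y _; set b := \int[kprob p xu]_y _.
pose c := \int[kprob p xu']_y (E (xu, y) * h y).
rewrite -(subrK c a) -addrA (le_trans (ler_normD _ _))// [leRHS]splitr lerD//.
  rewrite /a /c -bm_RintegralB; [|exact/bm_mul/bh/bm_E1..].
  apply: bm_Rintegral_bound; first by apply: bm_sub; exact/bm_mul/bh/bm_E1.
  move=> y; rewrite -mulrBl normrM -[leRHS]mulr1.
  by rewrite ler_pM.
pose g y := C^-1 * (E (xu, y) * h y).
have bg : bounded_measurable g by apply/bm_scale/bm_mul => //; exact: bm_E1.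
have g1 y : `|g y| <= 1.
  rewrite /g !normrM gtr0_norm ?invr_gt0// ler_pdivrMl// mulr1.
  by rewrite -[leRHS]mulr1 ler_pM// ger0_norm ?E_le.
have Eg (q : probability S R) : \int[q]_y (E (xu, y) * h y) = C * \int[q]_y g y.
  rewrite -bm_RintegralZ//; apply: eq_Rintegral => y _.
  by rewrite /g mulrA divff ?mul1r// gt_eqF.
rewrite /c /b !Eg -mulrBr normrM gtr0_norm//.
have le2 := close_bounded h2 bg.1 g1.
rewrite -(ler_pM2l C0) in le2; apply: (le_trans le2).
by rewrite le_eqVlt; apply/orP; left; apply/eqP; field; rewrite gt_eqF.
Qed.

(** Near [(x, u)] both [(x', u')] and [(x, u')] are close to [(x, u)]; compactness of [U] then makes
    the neighbourhood of [x] independent of the control, as the supremum in [Top] requires. *)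
Lemma Gop_equi1 x (e : R) : 0 < e -> \forall x' \near x, forall u (h : S -> R),
  measurable_fun [set: S] h -> (forall y, `|h y| <= 1) ->
  `|Gop h (x', u) - Gop h (x, u)| <= e.
Proof.
move=> e0; have e2 : 0 < e / 2 by rewrite divr_gt0.
have := (compact_near_coveringP [set: U]).1 compactU _ (nbhs x)
  (fun x' u => forall h : S -> R, measurable_fun [set: S] h -> (forall y, `|h y| <= 1) ->
  `|Gop h (x', u) - Gop h (x, u)| <= e) _.
have H u : [set: U] u -> \forall u' \near u & x' \near x,
    forall h : S -> R, measurable_fun [set: S] h -> (forall y, `|h y| <= 1) ->
    `|Gop h (x', u') - Gop h (x, u')| <= e.
  move=> _; have [[V W] /= [nV nW] VW] := Gop_equi (x, u) e2.
  exists (W, V) => // -[u' x'] [/= Wu Vx] h mh h1.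
  have a := VW (x', u') (conj Vx Wu) h mh h1.
  have b := VW (x, u') (conj (nbhs_singleton nV) Wu) h mh h1.
  rewrite -(subrK (Gop h (x, u)) (Gop h (x', u'))) -addrA.
  rewrite (le_trans (ler_normD _ _))// [leRHS]splitr lerD//.
  by rewrite distrC.
by move=> /(_ _ H); apply: filterS => x' h u; exact: h.
Qed.

(** Strong Feller property: rescaling brings [h] under the unit bound of [Gop_equi], and the [+ 1]
    keeps the scaling factor positive. *)
Lemma Gop_continuous h : bounded_measurable h -> continuous (Gop h).
Proof.
move=> [mh [M hM]] xu.
have M1 : 0 < `|M| + 1 by rewrite ltr_wpDl.
pose g y := (`|M| + 1)^-1 * h y.
have bh : bounded_measurable h by split => //; exists M.
have bg : bounded_measurable g by exact: bm_scale.
have g1 y : `|g y| <= 1.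
  rewrite /g normrM gtr0_norm ?invr_gt0// ler_pdivrMl// mulr1.
  by rewrite (le_trans (hM y))// (le_trans (ler_norm _))// lerDl.
have -> : Gop h = fun xu => (`|M| + 1) * Gop g xu.
  apply/funext => z; rewrite -Gop_scale//; congr (Gop _ z).
  by apply/funext => y; rewrite /g mulrA divff ?mul1r// gt_eqF.
apply: cvgM; first exact: cvg_cst.
apply/cvgrPdist_le => e e0.
by have := Gop_equi xu e0; apply: filterS => xu' /(_ g bg.1 g1); rewrite distrC.
Qed.

Definition Top (h : S -> R) (x : S) : R := sup [set Gop h (x, u) | u in [set: U]].

Lemma TopP h x : bounded_measurable h ->
  (forall u, Gop h (x, u) <= Top h x) /\ exists u, Top h x = Gop h (x, u).
Proof.
move=> bh.
have [u _ hu] : exists2 c, c \in [set: U] &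
    forall t, t \in [set: U] -> Gop h (x, t) <= Gop h (x, c).
  apply: compact_EVT_max => //; first by exists point.
  apply: continuous_subspaceT => u;
  apply: (@continuous_comp _ _ _ (fun u => (x, u)) (Gop h)).
    by apply: cvg_pair; [exact: cvg_cst|exact: cvg_id].
  exact: Gop_continuous.
have ubA : ubound [set Gop h (x, u) | u in [set: U]] (Gop h (x, u)).
  by move=> _ [u' _ <-]; apply: hu; rewrite inE.
have hle u' : Gop h (x, u') <= Top h x.
  by apply: ub_le_sup; [exists (Gop h (x, u))|exists u'].
split=> //; exists u; apply/le_anti/andP; split; last exact: hle.
by apply: ge_sup => //; exists (Gop h (x, u)); exists u.
Qed.

Lemma Top_ub h x u : bounded_measurable h -> Gop h (x, u) <= Top h x.
Proof. by move=> /(TopP x) []. Qed.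

(** Evaluate both sides at a control attaining the supremum for [h]. The affine form covers
    monotonicity, homogeneity and the Lipschitz bound. *)
Lemma Top_le h k x c d : bounded_measurable h -> bounded_measurable k ->
  (forall u, Gop h (x, u) <= c * Gop k (x, u) + d) -> 0 <= c ->
  Top h x <= c * Top k x + d.
Proof.
move=> bh bk hk c0; have [_ [u ->]] := TopP x bh.
by rewrite (le_trans (hk u))// lerD2r ler_wpM2l// Top_ub.
Qed.

Lemma Top_mono h k x : bounded_measurable h -> bounded_measurable k ->
  (forall y, h y <= k y) -> Top h x <= Top k x.
Proof.
move=> bh bk hk; rewrite -[leRHS]mul1r -[leRHS]addr0; apply: Top_le => // u.
by rewrite mul1r addr0; exact: Gop_le.
Qed.

Lemma Top_scale c h x : bounded_measurable h -> 0 <= c ->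
  Top (fun y => c * h y) x = c * Top h x.
Proof.
move=> bh c0; apply/le_anti/andP; split.
  rewrite -[leRHS]addr0; apply: Top_le => //; first exact: bm_scale.
  by move=> u; rewrite addr0 Gop_scale.
have [_ [u ->]] := TopP x bh; rewrite -Gop_scale//; apply: Top_ub.
exact: bm_scale.
Qed.

Lemma Top_subadd h k x : bounded_measurable h -> bounded_measurable k ->
  Top (fun y => h y + k y) x <= Top h x + Top k x.
Proof.
move=> bh bk; have bhk := bm_add bh bk.
have [_ [u ->]] := TopP x bhk; rewrite Gop_add//.
by apply: lerD; exact: Top_ub.
Qed.

Lemma Top_lip h k x M : bounded_measurable h -> bounded_measurable k ->
  (forall y, `|h y - k y| <= M) -> `|Top h x - Top k x| <= C * M.
Proof.
move=> bh bk hk.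
have H f g : bounded_measurable f -> bounded_measurable g ->
    (forall y, `|f y - g y| <= M) -> Top f x <= Top g x + C * M.
  move=> bf bg fg; rewrite -[X in X + _]mul1r; apply: Top_le => // u; rewrite mul1r.
  have -> : f = fun y => g y + (f y - g y) by apply/funext => y; rewrite addrC subrK.
  have bfg := bm_sub bf bg.
  by rewrite Gop_add// lerD2l (le_trans (ler_norm _))// Gop_norm.
rewrite ler_norml lerBlDl lerBrDl; apply/andP; split; last exact: H.
by rewrite lerBlDr; apply: H => // y; rewrite distrC.
Qed.

(** A control optimal at one of the two points competes at the other, so [Gop_equi1] passes to the
    supremum. With Arzela-Ascoli this is the compactness of [Top]. *)
Lemma Top_equi x (e : R) : 0 < e -> \forall x' \near x, forall h : S -> R,
  measurable_fun [set: S] h -> (forall y, `|h y| <= 1) ->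
  `|Top h x' - Top h x| <= e.
Proof.
move=> e0; have := Gop_equi1 x e0; apply: filterS => x' H h mh h1.
have bh : bounded_measurable h by split => //; exists 1.
have [_ [u Eu]] := TopP x bh; have [_ [u' Eu']] := TopP x' bh.
have := H u h mh h1; have := H u' h mh h1; rewrite !ler_norml.
have := Top_ub x' u bh; have := Top_ub x u' bh.
by rewrite -Eu -Eu' => ? ? /andP[? ?] /andP[? ?]; apply/andP; split; lra.
Qed.

Lemma Top_continuous h : bounded_measurable h -> continuous (Top h).
Proof.
move=> [mh [M hM]] x.
have M1 : 0 < `|M| + 1 by rewrite ltr_wpDl.
pose g y := (`|M| + 1)^-1 * h y.
have bh : bounded_measurable h by split => //; exists M.
have bg : bounded_measurable g by exact: bm_scale.
have g1 y : `|g y| <= 1.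
  rewrite /g normrM gtr0_norm ?invr_gt0// ler_pdivrMl// mulr1.
  by rewrite (le_trans (hM y))// (le_trans (ler_norm _))// lerDl.
have -> : Top h = fun x => (`|M| + 1) * Top g x.
  apply/funext => z; rewrite -Top_scale ?(ltW M1)//; congr (Top _ z).
  by apply/funext => y; rewrite /g mulrA divff ?mul1r// gt_eqF.
apply: cvgM; first exact: cvg_cst.
apply/cvgrPdist_le => e e0.
by have := Top_equi x e0; apply: filterS => x' /(_ g bg.1 g1); rewrite distrC.
Qed.

(** * Supersolutions, the growth bound and its eigenfunction *)

Definition supersolution (s : R) (f : S -> R) := [/\ 0 < s, continuous f,
  (forall x, 1 <= f x) & forall x u, Gop f (x, u) <= s * f x].

(** On a compact space [1 <= f] is positivity of [f] up to scaling; it makes [ln f] bounded and lets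
    [f] dominate the constant 1. *)
Definition growth_bound : R := inf [set s | exists f, supersolution s f].
Local Notation rho := growth_bound.

Let superlevels0 : [set s | exists f, supersolution s f] !=set0.
Proof.
exists C, (cst 1); split => //; first by move=> x; exact: cvg_cst.
move=> x u; rewrite mulr1 (le_trans (ler_norm _))// -[leRHS]mulr1.
by apply: Gop_norm => [|y]; [exact: bm_cst|rewrite normr1].
Qed.

Let superlevels_inf : has_inf [set s | exists f, supersolution s f].
Proof. by split => //; exists 0 => s [f [/ltW]]. Qed.

Lemma growth_bound_ge0 : 0 <= rho.
Proof. by apply: lb_le_inf => // s [f [/ltW]]. Qed.

Lemma growth_bound_le s f : supersolution s f -> rho <= s.
Proof. by move=> sf; apply: ge_inf; [exact: superlevels_inf.2|exists f]. Qed.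

Lemma growth_bound_lt s : rho < s -> exists2 s', s' < s & exists f, supersolution s' f.
Proof.
move=> rs; have [|s' hs' ss'] := @inf_adherent _ _ (s - rho) _ superlevels_inf.
  by rewrite subr_gt0.
by exists s' => //; move: ss'; rewrite addrC subrK.
Qed.

Lemma Top_ge0 h x : bounded_measurable h -> (forall y, 0 <= h y) -> 0 <= Top h x.
Proof. by move=> bh h0; have [_ [u ->]] := TopP x bh; exact: Gop_ge0. Qed.

Lemma Top0 x : Top (cst 0) x = 0.
Proof.
have bc : bounded_measurable (cst 0 : S -> R) by exact: bm_cst.
have [_ [u ->]] := TopP x bc; rewrite /Gop.
by under eq_Rintegral do rewrite mulr0; rewrite Rintegral_cst1.
Qed.

Section iterates.
Variables (s' s : R) (g : S -> R).
Hypotheses (s's : s' < s) (gs' : supersolution s' g).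

(** Since [Top] is not linear, the partial sums of the Neumann series are encoded as iterates from 0
    of the map sending [f] to [1 + Top f / s]. *)
Definition neumann (n : nat) : S -> R :=
  iter n (fun f x => 1 + Top f x / s) (cst 0).

Let s'_gt0 : 0 < s'. Proof. by case: gs'. Qed.
Let s_gt0 : 0 < s. Proof. exact: lt_trans s's. Qed.
Let bg : bounded_measurable g. Proof. by case: gs' => _ /continuous_bm. Qed.

Lemma neumann_continuous n : continuous (neumann n).
Proof.
elim: n => [x|n ih x] /=; first exact: cvg_cst.
apply: cvgD; first exact: cvg_cst.
apply: cvgM; last exact: cvg_cst.
exact/Top_continuous/continuous_bm.
Qed.

Let bn n : bounded_measurable (neumann n).
Proof. exact/continuous_bm/neumann_continuous. Qed.

Lemma neumann_nd n x : neumann n x <= neumann n.+1 x.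
Proof.
elim: n x => [|n ih] x; first by rewrite /= Top0 mul0r addr0.
rewrite [leLHS]/= [leRHS]/= lerD2l ler_wpM2r ?invr_ge0 ?(ltW s_gt0)//.
exact: (Top_mono x (bn n) (bn n.+1) ih).
Qed.

(** The bound [1 <= g] starts the induction. Subadditivity of [Top] propagates the increment, and
    [Top g <= s' * g] costs a factor [s' / s] at each step. *)
Lemma neumann_increment n x : neumann n.+1 x <= neumann n x + (s' / s) ^+ n * g x.
Proof.
case: gs' => _ _ g1 gg.
elim: n x => [|n ih] x; first by rewrite /= Top0 mul0r addr0 add0r mul1r.
rewrite [leLHS]/= [X in _ <= X + _]/= -addrA lerD2l exprSr -!mulrA.
have q0 : 0 <= (s' / s) ^+ n by rewrite exprn_ge0// divr_ge0 ?ltW.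
have h1 : Top (neumann n.+1) x <= Top (neumann n) x + (s' / s) ^+ n * Top g x.
  rewrite -Top_scale//; apply: le_trans (Top_subadd _ _ _) => //; last exact: bm_scale.
  by apply: Top_mono => //; apply: bm_add => //; exact: bm_scale.
have h2 : Top g x <= s' * g x by have [_ [u ->]] := TopP x bg.
rewrite ler_pdivrMr// mulrDl divfK ?gt_eqF// (le_trans h1)// lerD2l.
set q := _ ^+ n; rewrite -(_ : q * (s' * g x) = q * (s' * (s^-1 * g x)) * s).
  exact: ler_wpM2l.
by field; rewrite gt_eqF.
Qed.

End iterates.

(* The Neumann series of [Top / s] blows up as [s] decreases to [rho]; its
   normalised partial sums are almost eigenfunctions. *)
Lemma approx_eigenfunction e : 0 < rho -> 0 < e -> exists h : S -> R,
  [/\ continuous h, (forall x, 0 <= h x <= 1), (exists x, h x = 1) &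
      forall x, `|Top h x - rho * h x| <= e].
Proof.
move=> rho0 e0.
(* [K] is a height that the maximum of the partial sum will exceed. The defect [Top f - rho f] lies
   between [-2 rho] and [(s - rho) f], so dividing by a maximum above [2 rho / e] brings it below
   [e]. The value of [a] gives [a f <= 1/2] as long as [f <= K]. *)
pose K := 1 + 2 * rho / e.
have K1 : 1 <= K by rewrite lerDl divr_ge0 ?ltW// mulr_gt0.
have K0 : 0 < K by exact: lt_le_trans K1.
pose a := (2 * K)^-1.
have a0 : 0 < a by rewrite invr_gt0 mulr_gt0.
have a1 : a <= 2^-1 by rewrite /a invfM ler_piMr ?invr_ge0// invf_le1.
have [|s' s'a [g gs']] := @growth_bound_lt (rho * (1 + a)).
  by rewrite ltr_pMr// ltrDl.
pose s := (s' + rho * (1 + a)) / 2.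
have s's : s' < s by rewrite /s; lra.
have sa : s < rho * (1 + a) by rewrite /s; lra.
have rs' := growth_bound_le gs'.
have s0 : 0 < s by apply: lt_trans s's; case: gs'.
have s'0 : 0 < s' by case: gs'.
have rs : rho <= s by rewrite (le_trans rs')// ltW.
have [_ cg g1 _] := gs'.
have [_ [M gM]] := continuous_bm cg.
have M0 : 0 < M by rewrite (lt_le_trans ltr01)// (le_trans (g1 point))// (le_trans (ler_norm _)).
have q0 : 0 <= s' / s by rewrite divr_ge0 ?(ltW s'0) ?(ltW s0).
(* [0 < n] gives [1 <= f], and the second condition bounds the last increment by 1/2, so that
   [Top f] lies between [s (f - 1)] and [s (f - 1/2)]. *)
have [n n0 qn] : exists2 n, (0 < n)%N & (s' / s) ^+ n * M <= 2^-1.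
  have : (s' / s) ^+ n @[n --> \oo] --> (0 : R).
    by apply: cvg_expr; rewrite ger0_norm// ltr_pdivrMr// mul1r.
  have M2 : 0 < 2^-1 / M by rewrite divr_gt0 ?invr_gt0.
  move=> /cvgr_le /(_ _ M2) H; near \oo => n; exists n.
    by near: n; exact: nbhs_infty_gt.
  by rewrite -ler_pdivlMr//; near: n; exact: H.
pose f := neumann s n.
have cf : continuous f by exact: neumann_continuous.
have bf := continuous_bm cf.
have Tf x : Top f x = s * (neumann s n.+1 x - 1).
  by rewrite /= addrC addKr mulrC divfK// gt_eqF.
have f1 x : 1 <= f x.
  rewrite /f -(prednK n0) /= lerDl divr_ge0 ?(ltW s0)//.
  apply: Top_ge0; first exact/continuous_bm/neumann_continuous.
  case: (n.-1) => [//|m y] /=.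
  rewrite addr_ge0// divr_ge0 ?(ltW s0)//; apply: Top_ge0.
    exact/continuous_bm/neumann_continuous.
  elim: m => [//|m ih] z /=; rewrite addr_ge0// divr_ge0 ?(ltW s0)//.
  by apply: Top_ge0 => //; exact/continuous_bm/neumann_continuous.
have Tge x : s * (f x - 1) <= Top f x.
  by rewrite Tf ler_pM2l// lerD2r; exact: (neumann_nd s's gs').
have Tle x : Top f x <= s * (f x - 2^-1).
  rewrite Tf ler_pM2l// lerBlDr (le_trans (neumann_increment s's gs' n x))// -/f.
  have : (s' / s) ^+ n * g x <= 2^-1.
    rewrite (le_trans _ qn)// ler_wpM2l ?exprn_ge0//.
    by rewrite (le_trans (ler_norm _)).
  by lra.
have [x0 _ fx0] : exists2 c, c \in [set: S] & forall t, t \in [set: S] -> f t <= f c.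
  apply: compact_EVT_max => //; first by exists point.
  exact: continuous_subspaceT.
pose m := f x0.
have m0 : 0 < m by rewrite (lt_le_trans ltr01) ?f1.
have fm x : f x <= m by apply: fx0; rewrite inE.
(* If [f <= K] everywhere, then [a f <= 1/2] and [f] would be a supersolution at level
   [s (1 - a) < rho (1 + a) (1 - a) < rho], contradicting the definition of [rho]. *)
have Km : K < m.
  rewrite ltNge; apply/negP => mK.
  have : supersolution (s * (1 - a)) f.
    split => //; first by rewrite mulr_gt0// subr_gt0 (le_lt_trans a1)// invf_lt1// ltr1n.
    move=> x u; rewrite (le_trans (Top_ub x u bf))// (le_trans (Tle x))//.
    rewrite -mulrA ler_pM2l// mulrBl mul1r lerD2l lerN2.
    by rewrite /a invfM -mulrA ler_piMr ?invr_ge0// ler_pdivrMl// mulr1 (le_trans (fm x)).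
  move/growth_bound_le; apply/negP; rewrite -ltNge.
  have a2 : 0 < 1 - a by lra.
  rewrite (lt_trans (y := rho * (1 + a) * (1 - a)))// ?ltr_pM2r//.
  by rewrite -mulrA gtr_pMr//; nra.
exists (fun x => m^-1 * f x); split.
- by move=> x; apply: cvgM; [exact: cvg_cst|exact: cf].
- move=> x; rewrite mulr_ge0 ?invr_ge0 ?(ltW m0) ?(le_trans ler01)//=.
  by rewrite ler_pdivrMl// mulr1.
- by exists x0; rewrite mulVf// gt_eqF.
move=> x; rewrite Top_scale ?invr_ge0 ?(ltW m0)//.
have -> : m^-1 * Top f x - rho * (m^-1 * f x) = m^-1 * (Top f x - rho * f x) by ring.
rewrite normrM gtr0_norm ?invr_gt0// ler_pdivrMl//.
have me : 2 * rho <= m * e.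
  rewrite -ler_pdivrMr// (le_trans _ (ltW Km))// /K lerDr//.
have aK : a * K = 2^-1 by rewrite /a invfM -mulrA mulVf ?mulr1// gt_eqF.
have am : a * m <= 2^-1 * m / K.
  by rewrite ler_pdivlMr// mulrAC aK.
have := Tge x; have := Tle x; have := f1 x; have := fm x => fxm fx1 h1 h2.
have ea : rho * a * m <= e * m / 2.
  rewrite -mulrA.
  have : rho * (a * m) <= rho * (2^-1 * m / K) by rewrite ler_pM2l.
  move/le_trans; apply.
  have : 2 * rho / K <= e.
    by rewrite ler_pdivrMr// /K mulrDr mulr1 (mulrC e) divfK ?gt_eqF// lerDr ltW.
  rewrite (_ : rho * (2^-1 * m / K) = 2 * rho / K * (m / 4)); last by field; rewrite gt_eqF.
  move=> h; rewrite (le_trans (y := e * (m / 4)))//; first by rewrite ler_pM2r// divr_gt0.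
  by nra.
have sr : (s - rho) * f x <= rho * a * m.
  apply: (le_trans (y := rho * a * f x)); last by rewrite ler_wpM2l// ltW// mulr_gt0.
  by rewrite ler_wpM2r ?(le_trans ler01 fx1)//; lra.
have sr0 : 0 <= (s - rho) * f x by rewrite mulr_ge0 ?subr_ge0// (le_trans ler01).
have s2 : s <= 2 * rho.
  by rewrite ltW// (lt_le_trans sa)//; nra.
by rewrite ler_norml; apply/andP; split; nra.
Unshelve. all: by end_near. Qed.

(** The [h n] need not be equicontinuous but the [Top (h n)] are, so these converge uniformly along
    [F]; as [rho h n] differs from them by at most 1/(n+1), so do the [h n]. Uniformity keeps the
    limit nonzero, each [h n] reaching 1, and the Lipschitz bound passes the equation to the
    limit. *)
Lemma eigenfunction : 0 < growth_bound -> exists f : S -> R,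
  [/\ continuous f, (forall x, 0 <= f x), (exists x, 0 < f x) &
      forall x, Top f x = growth_bound * f x].
Proof.
set rho := growth_bound => rho0.
have [F [PF sF cF]] := exists_limit_filter R.
have npos n : 0 < n.+1%:R^-1 :> R by rewrite invr_gt0.
pose hP n := cid (approx_eigenfunction rho0 (npos n)).
pose h n : S -> R := projT1 (hP n).
have ch n : continuous (h n) by have [] := projT2 (hP n).
have h01 n x : 0 <= h n x <= 1 by have [_ + _ _] := projT2 (hP n); exact.
have h1 n : exists x, h n x = 1 by have [] := projT2 (hP n).
have hT n x : `|Top (h n) x - rho * h n x| <= n.+1%:R^-1.
  by have [_ _ _] := projT2 (hP n); exact.
have hle n x : `|h n x| <= 1 by have /andP[? ?] := h01 n x; rewrite ger0_norm.
have bh n := continuous_bm (ch n).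
have smallF (e : R) : 0 < e -> \forall n \near F, n.+1%:R^-1 <= e.
  move=> e0; apply: sF; near=> n; apply: ltW.
  by near: n; exact: (near_infty_natSinv_lt (PosNum e0)).
pose l x := projT1 (cid (cF (h ^~ x) 1 (fun n => hle n x))).
have hl x : h n x @[n --> F] --> l x.
  exact: (projT2 (cid (cF (h ^~ x) 1 (fun n => hle n x)))).
have l01 x : 0 <= l x <= 1.
  rewrite -(cvg_lim _ (hl x))//; apply/andP; split.
    by apply: limr_ge; [exact: cvgP (hl x)|apply: nearW => n; case/andP: (h01 n x)].
  by apply: limr_le; [exact: cvgP (hl x)|apply: nearW => n; case/andP: (h01 n x)].
have Tl x : Top (h n) x @[n --> F] --> rho * l x.
  have -> : (fun n => Top (h n) x) =
      fun n => (Top (h n) x - rho * h n x) + rho * h n x.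
    by apply/funext => n; rewrite subrK.
  rewrite -[X in _ --> X]add0r; apply: cvgD; last first.
    by apply: cvgM; [exact: cvg_cst|exact: hl].
  apply/cvgrPdist_le => e e0; move: (smallF e e0); apply: filterS => n.
  by rewrite sub0r normrN; exact: le_trans.
have el x (e : R) : 0 < e -> \forall x' \near x, `|rho * l x' - rho * l x| <= e.
  move=> e0; have := Top_equi x e0; apply: filterS => x' H.
  have cv : `|Top (h n) x' - Top (h n) x| @[n --> F] --> `|rho * l x' - rho * l x|.
    by apply: cvg_norm; apply: cvgB; exact: Tl.
  rewrite -(cvg_lim _ cv)//; apply: limr_le; first exact: cvgP cv.
  by apply: nearW => n; apply: H => //; exact: (bh n).1.
have cl : continuous l.
  have -> : l = fun x => rho^-1 * (rho * l x).
    by apply/funext => x; rewrite mulKf// gt_eqF.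
  move=> x; apply: cvgM; first exact: cvg_cst.
  apply/cvgrPdist_le => e e0.
  by have := el x e e0; apply: filterS => x'; rewrite distrC.
have bl := continuous_bm cl.
have uT e : 0 < e -> \forall n \near F, forall x, `|Top (h n) x - rho * l x| <= e.
  apply: (equicontinuous_cvg_uniform compactS) => [x e' e0|x e' e0].
    have e2 : 0 < e' / 2 by rewrite divr_gt0.
    have := el x _ e2; have := Top_equi x e2; apply: filterS2 => x' H1 H2 n.
    have -> : Top (h n) x' - rho * l x' - (Top (h n) x - rho * l x) =
      (Top (h n) x' - Top (h n) x) - (rho * l x' - rho * l x) by ring.
    rewrite (le_trans (ler_normB _ _))// [leRHS]splitr lerD//.
    by apply: H1 => //; exact: (bh n).1.
  have /cvgrPdist_le/(_ _ e0) := Tl x; apply: filterS => n.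
  by rewrite distrC.
have uh e : 0 < e -> \forall n \near F, forall x, `|h n x - l x| <= e.
  move=> e0; have e2 : 0 < rho * (e / 2) by rewrite mulr_gt0// divr_gt0.
  move: (uT _ e2) (smallF _ e2); apply: filterS2 => n H1 H2 x.
  rewrite -(ler_pM2l rho0) -[X in X * `|_|](gtr0_norm rho0) -normrM.
  have -> : rho * (h n x - l x) =
    (Top (h n) x - rho * l x) - (Top (h n) x - rho * h n x) by ring.
  rewrite (le_trans (ler_normB _ _))// [e in leRHS]splitr mulrDr lerD//.
  exact: le_trans (hT n x) H2.
exists l; split => //.
- by move=> x; case/andP: (l01 x).
- have half : (0 : R) < 2^-1 by rewrite invr_gt0.
  have [n Hn] := @filter_ex _ F PF _ (uh _ half).
  have [x hx] := h1 n; exists x.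
  by have := Hn x; rewrite hx ler_norml => /andP[_]; lra.
move=> x; apply/eqP; rewrite -subr_eq0 -normr_le0; apply/ler_addgt0Pr => e e0.
rewrite add0r.
have e2 : 0 < e / 2 by rewrite divr_gt0.
have e3 : 0 < e / 2 / C by rewrite divr_gt0.
have [n [H1 H2]] := @filter_ex _ F PF _ (filterI (uh _ e3) (uT _ e2)).
have -> : Top l x - rho * l x =
  - (Top (h n) x - Top l x) + (Top (h n) x - rho * l x) by ring.
rewrite (le_trans (ler_normD _ _))// normrN [leRHS]splitr lerD//.
rewrite (le_trans (Top_lip x (bh n) bl H1))//.
by rewrite mulrC divfK// gt_eqF.
Unshelve. all: by end_near. Qed.

(** The pairs attaining the supremum form a closed set because both [Gop f] and [Top f] are
    continuous. *)
Lemma optimal_selector (f : S -> R) : continuous f ->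
  exists2 u : S -> U, measurable_fun [set: S] u & forall x, Gop f (x, u x) = Top f x.
Proof.
move=> cf; have bf := continuous_bm cf.
apply: (@measurable_selection _ _ _ _ _ compactU
  [set xu | Gop f xu = Top f xu.1]); last first.
  by move=> x; have [_ [u Eu]] := TopP x bf; exists u; rewrite /= Eu.
rewrite (_ : [set _ | _] = (fun xu => Gop f xu - Top f xu.1) @^-1` [set 0]).
  apply: preimage_closed; last exact: closed_eq.
  move=> [x u] _; apply: cvgB; first exact: Gop_continuous.
  apply: (@continuous_comp _ _ _ fst (Top f)); first exact: cvg_fst.
  exact: Top_continuous.
by apply/seteqP; split => xu /= => [->|/subr0_eq//]; rewrite subrr.
Qed.

(** * The eigenmeasure and the stationary law *)

Section eigenmeasure.
Variables (f : S -> R) (u : S -> U) (x0 : S).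
Hypotheses (cf : continuous f) (f_ge0 : forall x, 0 <= f x) (fx0 : 0 < f x0)
  (mu : measurable_fun [set: S] u)
  (fu : forall x, Gop f (x, u x) = growth_bound * f x)
  (rho_gt0 : 0 < growth_bound).
Local Notation rho := growth_bound.
Let P := [set x | 0 < f x].
Implicit Types (h k g : S -> R).

Let bf : bounded_measurable f. Proof. exact: continuous_bm. Qed.

Let mP : measurable P.
Proof.
rewrite (_ : P = f @^-1` `]0, +oo[); last first.
  by apply/seteqP; split => x /=; rewrite in_itv/= andbT.
by rewrite -[X in measurable X]setTI; apply: bf.1 => //; exact: measurable_itv.
Qed.

Let mgraph : measurable_fun [set: S] (fun x => (x, u x)).
Proof. by apply/measurable_fun_pairP; split => //=; exact: measurable_id. Qed.

(** Fixing the control makes the operator linear. The factor [\1_P] makes it kill functions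
    supported where [f] vanishes, which forces an eigenmeasure to live on [P]. *)
Definition Lop (h : S -> R) (x : S) : R := Gop (fun y => h y * \1_P y) (x, u x).
Local Notation L := Lop.

Let bhP h : bounded_measurable h -> bounded_measurable (fun y => h y * \1_P y).
Proof. by move=> bh; apply: bm_mul => //; exact: bm_indic. Qed.

Lemma Lop_bm h : bounded_measurable h -> bounded_measurable (L h).
Proof.
move=> /bhP/Gop_bm [mh [M hM]]; split; first exact: measurableT_comp.
by exists M => x; exact: hM.
Qed.

Lemma Lop_linear c h k x : bounded_measurable h -> bounded_measurable k ->
  L (fun y => c * h y + k y) x = c * L h x + L k x.
Proof.
move=> bh bk; rewrite /Lop -Gop_scale; last exact: bhP.
rewrite -Gop_add; [|exact/bm_scale/bhP|exact: bhP].
by congr (Gop _ _); apply/funext => y; rewrite mulrDl mulrA.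
Qed.

Lemma Lop_le h k x : bounded_measurable h -> bounded_measurable k ->
  (forall y, h y <= k y) -> L h x <= L k x.
Proof.
move=> bh bk hk; apply: Gop_le => [||y]; [exact: bhP|exact: bhP|].
by rewrite ler_wpM2r// indicE.
Qed.

Lemma Lop_scale c h x : bounded_measurable h -> L (fun y => c * h y) x = c * L h x.
Proof.
move=> bh; rewrite /Lop -Gop_scale; last exact: bhP.
by congr (Gop _ _); apply/funext => y; rewrite mulrA.
Qed.

Lemma mulf_indic g y : g y * f y * \1_P y = g y * f y.
Proof.
rewrite indicE; have [yP|yP] := boolP (y \in P); first by rewrite mulr1.
suff -> : f y = 0 by rewrite !mulr0.
apply/le_anti; rewrite f_ge0 andbT leNgt; apply/negP => fy.
by move/negP : yP; apply; rewrite inE.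
Qed.

Lemma Lop_f g x : L (fun y => g y * f y) x = Gop (fun y => g y * f y) (x, u x).
Proof. by congr (Gop _ _); apply/funext => y; exact: mulf_indic. Qed.

Lemma Lop_eigen x : L f x = rho * f x.
Proof.
rewrite -fu; congr (Gop _ _); apply/funext => y.
by have := mulf_indic (cst 1) y; rewrite !mul1r.
Qed.

Let bL n h : bounded_measurable h -> bounded_measurable (iter n L h).
Proof. by move=> bh; elim: n => //= n ih; exact: Lop_bm. Qed.

Let iterL_le n h k x : bounded_measurable h -> bounded_measurable k ->
  (forall y, h y <= k y) -> iter n L h x <= iter n L k x.
Proof.
move=> bh bk hk; elim: n x => //= n ih x.
by apply: Lop_le => //; exact: bL.
Qed.

Let iterL_linear n c h k x : bounded_measurable h -> bounded_measurable k ->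
  iter n L (fun y => c * h y + k y) x = c * iter n L h x + iter n L k x.
Proof.
move=> bh bk; elim: n x => //= n ih x.
rewrite -Lop_linear; [|exact: bL..].
by congr (L _ x); apply/funext => y; exact: ih.
Qed.

(** For a supersolution [g], [L g <= Gop g <= s' g] and [|h| <= M g], so the iterates grow at most
    like [s' ^+ n]; this controls the remainder of the resolvent sum. *)
Let iterL_norm n h (M s' : R) g x : bounded_measurable h -> supersolution s' g ->
  0 <= M -> (forall y, `|h y| <= M) -> `|iter n L h x| <= M * (s' ^+ n * g x).
Proof.
move=> bh [s'0 cg g1 gg] M0 hM; have bg := continuous_bm cg.
have Mg y : M <= M * g y by rewrite ler_peMr.
have bMg c : bounded_measurable (fun y => c * g y) by exact: bm_scale.
have HU z : iter n L (fun y => M * g y) z <= M * (s' ^+ n * g z).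
  elim: n z => [|n ih] z /=; first by rewrite mul1r.
  apply: le_trans (_ : L (fun y => (M * s' ^+ n) * g y) z <= _).
    by apply: Lop_le => // [|y]; [exact: bL|rewrite -mulrA].
  rewrite Lop_scale// -mulrA ler_wpM2l// exprSr -mulrA ler_wpM2l ?exprn_ge0 ?(ltW s'0)//.
  apply: le_trans (gg z (u z)).
  apply: Gop_le => [||y]; [exact: bhP|exact: bg|].
  by rewrite indicE; case: (y \in P); rewrite ?mulr1// mulr0 (le_trans ler01).
have hg y : `|h y| <= M * g y by exact: le_trans (Mg y).
have bN : bounded_measurable (fun y => -1 * h y + 0 * h y) by exact/bm_add/bm_scale/bh/bm_scale.
rewrite ler_norml; apply/andP; split; last first.
  apply: le_trans (HU x); apply: iterL_le => // y.
  exact: le_trans (ler_norm _) (hg y).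
rewrite lerNl; apply: le_trans (HU x).
(* Writing [- h] as [-2 h + h] puts the negation in the form [c h + k] of [iterL_linear]. *)
have -> : - iter n L h x = iter n L (fun y => -2 * h y + h y) x.
  by rewrite iterL_linear//; ring.
apply: iterL_le => // [|y]; first exact/bm_add/bh/bm_scale.
have := hg y; rewrite ler_norml => /andP[+ _].
by rewrite (_ : -2 * h y + h y = - h y); [rewrite lerNl|ring].
Qed.

(* Resolvent means: [sum_(k < n) s^-k L^k] started at [x0], normalised; their
   mass blows up as [s] decreases to [rho] because [L f = rho f]. *)
Lemma approx_eigenmean (e : R) : 0 < e -> exists2 psi, mean psi &
  forall (h : S -> R) (M : R), measurable_fun [set: S] h -> (forall y, `|h y| <= M) ->
    `|psi (L h) - rho * psi h| <= e * M.
Proof.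
move=> e0; have [_ [F fF]] := bf.
have F0 : 0 < F by rewrite (lt_le_trans fx0)// (le_trans (ler_norm _)).
(* The boundary terms of the telescoping sum cost [4 F / f x0] times [s - rho] after normalisation,
   and replacing [s] by [rho] costs one more [s - rho]. *)
pose d := e / (4 * F / f x0 + 1).
have den0 : 0 < 4 * F / f x0 + 1 by rewrite ltr_wpDl// divr_ge0// ?mulr_ge0// ltW.
have d0 : 0 < d by rewrite divr_gt0.
have rd : rho < rho + d by rewrite ltrDl.
have [s' s'd [g gs']] := growth_bound_lt rd.
pose s := (s' + (rho + d)) / 2.
have s's : s' < s by rewrite /s; lra.
have sd : s < rho + d by rewrite /s; lra.
have rs' := growth_bound_le gs'.
have s'0 : 0 < s' by case: gs'.
have rs : rho < s by exact: le_lt_trans s's.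
have s0 : 0 < s by exact: lt_trans s's.
have sV0 : 0 < s^-1 by rewrite invr_gt0.
have [_ cg g1 _] := gs'.
have q'0 : 0 <= s' / s by rewrite divr_ge0 ?(ltW s'0) ?(ltW s0).
have q0 : 0 <= rho / s by rewrite divr_ge0 ?(ltW rho_gt0) ?(ltW s0).
have q1 : rho / s < 1 by rewrite ltr_pdivrMr// mul1r.
(* The first condition bounds the final boundary term; the second makes the truncated geometric
   series of ratio [rho / s] at least half of the full one. *)
have [n qn qn'] : exists2 n, (s' / s) ^+ n * g x0 <= 1 & (rho / s) ^+ n <= 2^-1.
  have c1 : (s' / s) ^+ n @[n --> \oo] --> (0 : R).
    by apply: cvg_expr; rewrite ger0_norm// ltr_pdivrMr// mul1r.
  have c2 : (rho / s) ^+ n @[n --> \oo] --> (0 : R).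
    by apply: cvg_expr; rewrite ger0_norm.
  have gx0 : 0 < g x0 by rewrite (lt_le_trans ltr01).
  have e1 : 0 < (g x0)^-1 by rewrite invr_gt0.
  have e2 : 0 < 2^-1 :> R by rewrite invr_gt0.
  move/cvgr_le : c1 => /(_ _ e1) H1; move/cvgr_le : c2 => /(_ _ e2) H2.
  near \oo => n; exists n; last by near: n; exact: H2.
  by rewrite -ler_pdivlMr// mul1r; near: n; exact: H1.
pose A h := \sum_(k < n) s^-1 ^+ k * iter k L h x0.
have bone : bounded_measurable (cst 1 : S -> R) by exact: bm_cst.
have Alin c h k : bounded_measurable h -> bounded_measurable k ->
    A (fun y => c * h y + k y) = c * A h + A k.
  move=> bh bk; rewrite /A mulr_sumr -big_split/=; apply: eq_bigr => i _.
  by rewrite iterL_linear//; ring.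
have Amono h k : bounded_measurable h -> bounded_measurable k ->
    (forall y, h y <= k y) -> A h <= A k.
  move=> bh bk hk; apply: ler_sum => i _.
  by rewrite ler_wpM2l ?exprn_ge0 ?(ltW sV0)//; exact: iterL_le.
have iterf i x : iter i L f x = rho ^+ i * f x.
  elim: i x => [|i ih] x; first by rewrite mul1r.
  rewrite iterS (_ : iter i L f = fun y => rho ^+ i * f y); last exact/funext.
  by rewrite Lop_scale// Lop_eigen exprSr mulrA.
(* From [f <= F] one gets [A f <= F * A 1], while [A f] is [f x0] times a geometric sum, since [f]
   is an eigenfunction of [L]. *)
have A1ge : f x0 / F * (s / (2 * (s - rho))) <= A (cst 1).
  have -> : A (cst 1) = F^-1 * (F * A (cst 1) + 0) by rewrite addr0 mulKf// gt_eqF.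
  rewrite mulrAC mulrC ler_pM2l ?invr_gt0// addr0.
  have fle : A f <= F * A (cst 1).
    have : A f <= A (fun y => F * cst 1 y + 0 * f y).
      apply: Amono => //; first exact/bm_add/bm_scale/bf/bm_scale.
      by move=> y; rewrite /= mulr1 mul0r addr0 (le_trans (ler_norm _)).
    rewrite (_ : (fun y => F * cst 1 y + 0 * f y) = fun y => F * cst 1 y + cst 0 y); last first.
      by apply/funext => y; rewrite mul0r.
    rewrite Alin//; last exact: bm_cst.
    rewrite (_ : A (cst 0) = 0) ?addr0//.
    have b0 : bounded_measurable (cst 0 : S -> R) by exact: bm_cst.
    have := Alin 1 _ _ b0 b0; rewrite (_ : (fun y => _) = cst 0 :> (S -> R)).
      by rewrite mul1r => /eqP; rewrite -subr_eq0 opprD addrA subrr sub0r oppr_eq0 => /eqP.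
    by apply/funext => y; rewrite /= mulr0 addr0.
  apply: le_trans fle.
  have -> : A f = f x0 * \sum_(k < n) (rho / s) ^+ k.
    rewrite /A mulr_sumr; apply: eq_bigr => i _.
    by rewrite iterf expr_div_n exprVn; field; rewrite expf_neq0// gt_eqF.
  rewrite ler_pM2l//.
  have q1' : 0 < 1 - rho / s by rewrite subr_gt0.
  have geo : (1 - rho / s) * \sum_(k < n) (rho / s) ^+ k = 1 - (rho / s) ^+ n.
    by rewrite -[1 - rho / s]opprB mulNr -subrX1 opprB.
  rewrite -(ler_pM2l q1') geo.
  have -> : (1 - rho / s) * (s / (2 * (s - rho))) = 2^-1.
    by field; rewrite ?(gt_eqF s0)// gt_eqF// subr_gt0.
  by lra.
have sr0 : 0 < s - rho by rewrite subr_gt0.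
have A1gt0 : 0 < A (cst 1).
  apply: lt_le_trans A1ge; apply: mulr_gt0; first exact: divr_gt0.
  by apply: divr_gt0 => //; exact: mulr_gt0.
exists (fun h => A h / A (cst 1)).
  split => [c h k bh bk|h bh h0|].
  - by rewrite Alin// mulrDl mulrA.
  - rewrite divr_ge0 ?(ltW A1gt0)//; apply: sumr_ge0 => i _.
    rewrite mulr_ge0 ?exprn_ge0 ?(ltW sV0)//.
    have b0 : bounded_measurable (cst 0 : S -> R) by exact: bm_cst.
    apply: le_trans (_ : iter i L (cst 0) x0 <= _); last exact: iterL_le.
    have := iterL_linear i 1 x0 b0 b0; rewrite (_ : (fun y => _) = cst 0 :> (S -> R)).
      by rewrite mul1r => /eqP; rewrite -subr_eq0 opprD addrA subrr sub0r oppr_eq0 => /eqP ->.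
    by apply/funext => y; rewrite /= mulr0 addr0.
  - by rewrite divff// gt_eqF.
move=> h M mh hM.
have bh : bounded_measurable h by split => //; exists M.
have M0 : 0 <= M by rewrite (le_trans _ (hM point)).
have Ale : `|A h| <= M * A (cst 1).
  rewrite /A mulr_sumr (le_trans (ler_norm_sum _ _ _))//; apply: ler_sum => i _.
  rewrite normrM (ger0_norm (exprn_ge0 _ (ltW sV0))) mulrCA ler_wpM2l ?exprn_ge0 ?(ltW sV0)//.
  have H c : iter i L (fun y => c * cst 1 y + 0 * h y) x0 = c * iter i L (cst 1) x0.
    rewrite (_ : (fun y => _) = fun y => (c - 1) * cst 1 y + cst 1 y).
      by rewrite iterL_linear//; ring.
    by apply/funext => y /=; ring.
  have bc c : bounded_measurable (fun y => c * cst 1 y + 0 * h y : R).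
    by apply: bm_add; exact: bm_scale.
  rewrite ler_norml; apply/andP; split.
    rewrite -mulNr -H; apply: iterL_le => // y.
    by rewrite /= mulr1 mul0r addr0; have := hM y; rewrite ler_norml => /andP[].
  rewrite -H; apply: iterL_le => // y.
  by rewrite /= mulr1 mul0r addr0; have := hM y; rewrite ler_norml => /andP[].
have tele : A (L h) - s * A h = s * (s^-1 ^+ n * iter n L h x0 - h x0).
  rewrite /A; elim: (n) => [|m ih]; first by rewrite !big_ord0 mulr0 subr0 mul1r subrr mulr0.
  rewrite !big_ord_recr/= mulrDr opprD addrACA ih -iterSr iterS exprSr.
  by field; rewrite gt_eqF.
have teleB : `|A (L h) - s * A h| <= s * (2 * M).
  rewrite tele normrM gtr0_norm// ler_pM2l// (le_trans (ler_normB _ _))//.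
  rewrite (_ : 2 * M = M + M); last by ring.
  rewrite lerD// normrM (ger0_norm (exprn_ge0 _ (ltW sV0))).
  apply: le_trans (_ : s^-1 ^+ n * (M * (s' ^+ n * g x0)) <= _).
    by rewrite ler_wpM2l ?exprn_ge0 ?(ltW sV0)//; exact: iterL_norm.
  rewrite mulrCA -[leRHS]mulr1 ler_wpM2l// mulrA.
  by rewrite -exprMn_comm; [rewrite (mulrC s^-1)|exact: mulrC].
have -> : A (L h) / A (cst 1) - rho * (A h / A (cst 1)) =
    ((A (L h) - s * A h) + (s - rho) * A h) / A (cst 1) by ring.
rewrite normrM [X in _ * X]gtr0_norm ?invr_gt0// ler_pdivrMr//.
rewrite (le_trans (ler_normD _ _))//.
apply: le_trans (lerD teleB (_ : _ <= (s - rho) * (M * A (cst 1)))) _.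
  by rewrite normrM gtr0_norm// ler_pM2l.
have k1 : s <= A (cst 1) * (2 * F / f x0 * (s - rho)).
  rewrite -ler_pdivrMr//; last by rewrite mulr_gt0// divr_gt0// mulr_gt0.
  apply: le_trans A1ge; rewrite le_eqVlt; apply/orP; left; apply/eqP.
  by field; rewrite !gt_eqF.
have k2 : s - rho <= d by rewrite lerBlDl ltW.
have k3 : d * (4 * F / f x0 + 1) = e by rewrite /d divfK// gt_eqF.
apply: le_trans (_ : A (cst 1) * M * ((s - rho) * (4 * F / f x0 + 1)) <= _).
  have k4 : s * (2 * M) <= A (cst 1) * (2 * F / f x0 * (s - rho)) * (2 * M).
    by rewrite ler_wpM2r// mulr_ge0.
  apply: le_trans (lerD k4 (lexx _)) _.
  by rewrite le_eqVlt; apply/orP; left; apply/eqP; field; rewrite gt_eqF.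
have k5 : (s - rho) * (4 * F / f x0 + 1) <= e by rewrite -k3 ler_wpM2r// ltW.
rewrite (_ : e * M * A (cst 1) = A (cst 1) * M * e); last by ring.
by rewrite ler_wpM2l// mulr_ge0// ltW.
Unshelve. all: by end_near. Qed.

(** The limit mean is a priori only finitely additive. If the [A n] decrease to the empty set, the
    functions [Gop] of [\1_(A n) * \1_P] tend to 0 pointwise and are equicontinuous, hence tend to 0
    uniformly on [S * U]; then [psi (\1_(A n))], which is [psi (L (\1_(A n))) / rho], tends to 0.
    Uniformity over all controls is used because [u] is only measurable. *)
Lemma exists_eigenmeasure : exists nu : probability S R, forall h,
  bounded_measurable h -> \int[nu]_x L h x = rho * \int[nu]_x h x.
Proof.
have [F [PF sF cF]] := exists_limit_filter R.
have npos n : 0 < n.+1%:R^-1 :> R by rewrite invr_gt0.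
pose aP n := cid2 (approx_eigenmean (npos n)).
pose a n := projT1 (aP n).
have ma n : mean (a n) by have := aP n; rewrite /a; case: (aP n).
have aL n h (M : R) : measurable_fun [set: S] h -> (forall y, `|h y| <= M) ->
    `|a n (L h) - rho * a n h| <= n.+1%:R^-1 * M.
  by rewrite /a; case: (aP n) => /= psi _ H; exact: H.
pose psi h : R := lim (a n h @[n --> F]).
have cpsi h : bounded_measurable h -> a n h @[n --> F] --> psi h.
  move=> bh; have [M hM] := bh.2.
  have [l hl] := cF (fun n => a n h) M (fun n => mean_norm_le (ma n) bh hM).
  by rewrite /psi (cvg_lim _ hl).
have mpsi : mean psi.
  split => [c h k bh bk|h bh h0|].
  - apply: cvg_lim => //; have -> : (fun n => a n (fun x => c * h x + k x)) =
        fun n => c * a n h + a n k.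
      by apply/funext => n; have [-> // _ _] := ma n.
    apply: cvgD; last exact: cpsi.
    by apply: cvgM; [exact: cvg_cst|exact: cpsi].
  - apply: limr_ge; first exact: cvgP (cpsi _ bh).
    by apply: nearW => n; exact: (mean_ge0 (ma n) bh h0).
  - apply: cvg_lim => //; under eq_fun do rewrite (mean_cst (ma _)).
    exact: cvg_cst.
have psiL h : bounded_measurable h -> psi (L h) = rho * psi h.
  move=> bh; have [mh [M hM]] := bh; apply: cvg_lim => //.
  have -> : (fun n => a n (L h)) = fun n => (a n (L h) - rho * a n h) + rho * a n h.
    by apply/funext => n; rewrite subrK.
  rewrite -[X in _ --> X]add0r; apply: cvgD; last first.
    by apply: cvgM; [exact: cvg_cst|exact: cpsi].
  apply/cvgrPdist_le => e e0; apply: sF.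
  have M1 : 0 < `|M| + 1 by rewrite ltr_wpDl.
  have e1 : 0 < e / (`|M| + 1) by rewrite divr_gt0.
  near=> n; rewrite sub0r normrN (le_trans (aL n h M mh hM))//.
  apply: le_trans (_ : n.+1%:R^-1 * (`|M| + 1) <= _).
    by rewrite ler_wpM2l// (le_trans (ler_norm _))// lerDl.
  rewrite -ler_pdivlMr//; apply: ltW.
  by near: n; exact: (near_infty_natSinv_lt (PosNum e1)).
have [|nu nuE] := mean_integral mpsi; last first.
  by exists nu => h bh; rewrite -!nuE//; [exact: psiL|exact: Lop_bm].
move=> A mA ndA A0; apply/cvgrPdist_le => e e0.
have re0 : 0 < rho * e by rewrite mulr_gt0.
pose g n : S -> R := fun y => \1_(A n) y * \1_P y.
have bg n : bounded_measurable (g n) by apply: bhP; exact: bm_indic.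
have g1 n y : `|g n y| <= 1.
  by rewrite /g !indicE; do 2!case: (_ \in _);
    rewrite ?mulr0 ?mul0r ?mulr1 ?normr0 ?normr1.
have g0 y : g n y @[n --> \oo] --> (0 : R).
  have [m nAm] : exists m, ~ A m y.
    by apply: contrapT => h; have : (\bigcap_n A n) y;
      [move=> n _; apply: contrapT => nA; apply: h; exists n|rewrite A0].
  apply: cvg_near_cst; near=> n; rewrite /g indicE memNset ?mul0r// => An.
  apply: nAm; have mn : (m <= n)%N by near: n; exact: nbhs_infty_ge.
  by have /subsetPset := ndA m n mn; exact.
have cSU : compact [set: S * U] by rewrite -setXTT; exact: compact_setX.
have := @equicontinuous_cvg_uniform _ _ cSU nat \oo (fun n => Gop (g n)) _ _ _ _ re0.
have H1 (xu : S * U) (e' : R) : 0 < e' ->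
    \forall xu' \near xu, forall n, `|Gop (g n) xu' - Gop (g n) xu| <= e'.
  move=> e'0; have := Gop_equi xu e'0; apply: filterS => xu' H n.
  by apply: H => //; exact: (bg n).1.
have H2 (xu : S * U) (e' : R) : 0 < e' -> \forall n \near \oo, `|Gop (g n) xu| <= e'.
  move=> e'0; have : Gop (g n) xu @[n --> \oo] --> Gop (cst 0) xu.
    by apply: Gop_cvg => [n|n y|y]; [exact: (bg n).1|exact: g1|exact: g0].
  rewrite (_ : Gop (cst 0) xu = 0); last first.
    by rewrite /Gop; under eq_Rintegral do rewrite mulr0; rewrite Rintegral_cst1.
  by move=> /cvgrPdist_le /(_ _ e'0); apply: filterS => n; rewrite sub0r normrN.
move=> /(_ _ H1 H2); apply: filterS => n Hn.
have bA : bounded_measurable (\1_(A n) : S -> R) by exact: bm_indic.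
rewrite sub0r normrN -(ler_pM2l rho_gt0) -[X in X * `|_|](gtr0_norm rho_gt0).
rewrite -normrM -psiL//; apply: (mean_norm_le mpsi); first exact: Lop_bm.
by move=> x; exact: Hn.
Unshelve. all: by end_near. Qed.

(** Doob transform of [L] by [f]: the mean of [h] under the kernel with density [E f / Gop f] and
    control [u], where [Gop f] is [rho f]. It is set to 0 where [f] vanishes. *)
Definition tilt (h : S -> R) (x : S) : R :=
  \1_P x * (Gop (fun y => h y * f y) (x, u x) / (rho * f x)).

(** The law is [f nu] normalised. Its invariance is the identity [tilt h * f = L (h f) / rho]
    integrated against the eigenmeasure [nu]. *)
Lemma exists_stationary : exists eta : probability S R,
  [/\ forall h, bounded_measurable h -> \int[eta]_x tilt h x = \int[eta]_x h x,
      \int[eta]_x \1_P x = 1 &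
      exists B : R, forall n, \int[eta]_x Num.min n%:R `|ln (f x)| <= B].
Proof.
have [nu nuL] := exists_eigenmeasure.
pose Z := \int[nu]_x f x.
have bP : bounded_measurable (\1_P : S -> R) by exact: bm_indic.
(* [L] sends the indicator of the complement of [P] to 0, so the eigenvalue equation with [rho > 0]
   gives that complement mass 0. *)
have nuP : \int[nu]_x \1_P x = 1.
  have bPC : bounded_measurable (\1_(~` P) : S -> R).
    by apply: bm_indic; exact: measurableC.
  have P1 x : \1_P x = 1 - \1_(~` P) x :> R.
    by rewrite !indicE in_setC; case: (_ \in _); rewrite ?subr0 ?subrr.
  under eq_Rintegral do rewrite P1.
  rewrite bm_RintegralB//; last exact: bm_cst.
  rewrite Rintegral_cst1 -[X in 1 - X](mulKf (lt0r_neq0 rho_gt0)) -nuL//.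
  rewrite (_ : \int[nu]_x L _ x = 0) ?mulr0 ?subr0//.
  rewrite -[RHS](Rintegral_cst1 nu); apply: eq_Rintegral => x _.
  rewrite /Lop -[RHS](Rintegral_cst1 (kprob p (x, u x))).
  apply: eq_Rintegral => y _; rewrite !indicE in_setC.
  by case: (_ \in _); rewrite ?mul0r ?mulr0.
(* If [f] had integral 0, so would [min 1 (n f)]; but these functions converge to [\1_P], whose
   integral is 1. *)
have Z0 : 0 < Z.
  rewrite lt_neqAle Rintegral_ge0// andbT eq_sym; apply/negP => /eqP ZE.
  pose g (n : nat) (x : S) : R := Num.min 1 (n%:R * f x).
  have g1 n x : `|g n x| <= 1.
    by rewrite ger0_norm ?ge_min ?lexx// le_min ler01 mulr_ge0.
  have mg n : measurable_fun [set: S] (g n).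
    apply: measurable_minr; first exact: measurable_cst.
    by apply: measurable_funM; [exact: measurable_cst|exact: bf.1].
  have gP x : g n x @[n --> \oo] --> (\1_P x : R).
    rewrite indicE; have [xP|xP] := boolP (x \in P).
      rewrite inE in xP; apply: cvg_near_cst; near=> n.
      rewrite /g min_l// -ler_pdivrMr// mul1r.
      by near: n; exact: nbhs_infty_ger.
    apply: cvg_near_cst; apply: nearW => n; rewrite /g.
    suff -> : f x = 0 by rewrite mulr0 min_r.
    apply/le_anti; rewrite f_ge0 andbT leNgt; apply/negP => fy.
    by move/negP : xP; apply; rewrite inE.
  have := @bm_Rintegral_cvg _ _ _ nu _ _ _ mg g1 gP; rewrite nuP.
  have -> : (fun n => \int[nu]_x g n x) = fun=> 0.
    apply/funext => n; apply/le_anti/andP; split; last first.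
      by apply: Rintegral_ge0 => x _; rewrite le_min ler01 mulr_ge0.
    rewrite -(mulr0 n%:R) -ZE -bm_RintegralZ//; apply: bm_le_Rintegral.
    - by split => //; exists 1.
    - exact: bm_scale.
    - by move=> x; rewrite /g ge_min lexx orbT.
  move=> /cvg_unique /(_ (cvg_cst _)) => /(_ (@Rhausdorff R)) /eqP.
  by rewrite oner_eq0.
have bhf h : bounded_measurable h -> bounded_measurable (fun x => h x * f x).
  by move=> bh; exact: bm_mul.
pose psi h : R := (\int[nu]_x (h x * f x)) / Z.
have mpsi : mean psi.
  split => [c h k bh bk|h bh h0|].
  - have H : \int[nu]_x ((c * h x + k x) * f x) =
        c * \int[nu]_x (h x * f x) + \int[nu]_x (k x * f x).
      rewrite -bm_RintegralZ; last exact: bhf.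
      rewrite -bm_RintegralD; [|exact/bm_scale/bhf|exact: bhf].
      by apply: eq_Rintegral => x _; ring.
    by rewrite /psi H mulrDl mulrA.
  - by rewrite divr_ge0 ?(ltW Z0)//; apply: Rintegral_ge0 => x _; rewrite mulr_ge0.
  - by rewrite /psi; under eq_Rintegral do rewrite mul1r; rewrite divff// gt_eqF.
have [Mf fM] := bf.2.
have [|eta etaE] := mean_integral mpsi.
- move=> A mA ndA A0; rewrite -(mul0r Z^-1); apply: cvgM; last exact: cvg_cst.
  rewrite -[X in _ --> X](Rintegral_cst1 nu); apply: (@bm_Rintegral_cvg _ _ _ _ _ _ Mf).
  + move=> n; apply: measurable_funM; last exact: bf.1.
    exact: measurable_indic.
  + move=> n x; rewrite normrM -[leRHS]mul1r ler_pM//.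
    by rewrite indicE; case: (_ \in _); rewrite ?normr1 ?normr0.
  + move=> y; have [m nAm] : exists m, ~ A m y.
      by apply: contrapT => h; have : (\bigcap_n A n) y;
        [move=> n _; apply: contrapT => nA; apply: h; exists n|rewrite A0].
    apply: cvg_near_cst; near=> n; rewrite indicE memNset ?mul0r// => An.
    apply: nAm; have mn : (m <= n)%N by near: n; exact: nbhs_infty_ge.
    by have /subsetPset := ndA m n mn; exact.
have tiltE h x : bounded_measurable h ->
    tilt h x * f x = rho^-1 * L (fun y => h y * f y) x.
  move=> bh; rewrite Lop_f /tilt indicE.
  have [xP|xP] := boolP (x \in P).
    by rewrite inE in xP; rewrite mul1r; field; rewrite !gt_eqF.
  have fx : f x = 0.
    apply/le_anti; rewrite f_ge0 andbT leNgt; apply/negP => fy.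
    by move/negP : xP; apply; rewrite inE.
  rewrite mul0r fx mulr0; apply/esym/eqP; rewrite mulf_eq0; apply/orP; right.
  have [M hM] := bh.2; have [mh _] := bh.
  rewrite -normr_le0 -(mulr0 M) -(mulr0 rho) -fx -fu -Gop_scale//.
  rewrite ler_norml -mulN1r -Gop_scale; last exact: bm_scale.
  apply/andP; split; apply: Gop_le => [||y]; do ?[exact: bhf|exact/bm_scale/bm_scale|exact: bm_scale];
    have := hM y; rewrite ler_norml => /andP[h1 h2].
    by rewrite mulN1r -mulNr ler_wpM2r.
  by rewrite ler_wpM2r.
have btilt h : bounded_measurable h -> bounded_measurable (tilt h).
  move=> bh; have [mh [M hM]] := bh.
  have M0 : 0 <= M by rewrite (le_trans _ (hM point)).
  split; last first.
    exists M => x; rewrite /tilt indicE.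
    have [xP|xP] := boolP (x \in P); last by rewrite mul0r normr0.
    rewrite inE in xP; have rf : 0 < rho * f x by rewrite mulr_gt0.
    rewrite mul1r normrM [X in _ * X]gtr0_norm ?invr_gt0// ler_pdivrMr// -fu -Gop_scale//.
    rewrite ler_norml -mulN1r -Gop_scale; last exact: bm_scale.
    apply/andP; split; apply: Gop_le => [||y]; do ?[exact: bhf|exact/bm_scale/bm_scale|exact: bm_scale];
      have := hM y; rewrite ler_norml => /andP[h1 h2].
      by rewrite mulN1r -mulNr ler_wpM2r.
    by rewrite ler_wpM2r.
  apply: measurable_funM; first exact: measurable_indic.
  apply: measurable_funM.
    by apply: measurableT_comp (mgraph); exact: (Gop_bm (bhf _ bh)).1.
  rewrite (_ : (fun x => _) = (fun t => t `^ (-1)) \o (fun x => rho * f x)); last first.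
    by apply/funext => x /=; rewrite powR_inv1// mulr_ge0// ltW.
  apply: measurableT_comp; first exact: measurable_powR.
  by apply: measurable_funM; [exact: measurable_cst|exact: bf.1].
exists eta; split.
- move=> h bh; rewrite -!etaE//; last exact: btilt.
  rewrite /psi; under eq_Rintegral do rewrite tiltE//.
  rewrite bm_RintegralZ; last exact/Lop_bm/bhf.
  by rewrite nuL ?mulKf ?gt_eqF//; exact: bhf.
- have fP x : f x * \1_P x = f x by have := mulf_indic (cst 1) x; rewrite !mul1r.
  rewrite -etaE// /psi; under eq_Rintegral do rewrite mulrC fP.
  by rewrite divff// gt_eqF.
(* [t |ln t|] is at most 1 for [t < 1], and at most [Mf * Mf] for [t] between 1 and [Mf], by
   [ln t < t]. The weight [f] in the law thus makes [ln f] integrable. *)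
pose B := 1 + Mf * Mf.
have Mf0 : 0 < Mf by rewrite (lt_le_trans fx0)// (le_trans (ler_norm _)).
have B0 : 0 <= B by rewrite addr_ge0// mulr_ge0// ltW.
have tlnt t : 0 <= t <= Mf -> `|ln t| * t <= B.
  rewrite le_eqVlt => /andP[/orP[/eqP <-|t0] tM]; first by rewrite mulr0.
  have [t1|t1] := ltP t 1.
    have : - ln t < t^-1 by rewrite -lnV ?posrE// ln_sublinear// invr_gt0.
    rewrite ler0_norm; last by rewrite ln_le0// ltW.
    move/ltW; rewrite -(ler_pM2r t0) mulVf ?gt_eqF// => /le_trans; apply.
    by rewrite lerDl mulr_ge0// ltW.
  rewrite ger0_norm ?ln_ge0//; apply: le_trans (_ : Mf * Mf <= _); last by rewrite lerDr.
  by rewrite ler_pM ?ln_ge0// ?(ltW t0)// (le_trans (ltW (ln_sublinear t0))).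
exists (B / Z) => n.
have bn : bounded_measurable (fun x => Num.min n%:R `|ln (f x)|).
  split; last first.
    by exists n%:R => x; rewrite ger0_norm ?ge_min ?lexx// le_min normr_ge0 ler0n.
  apply: measurable_minr; first exact: measurable_cst.
  apply: measurableT_comp => //; apply: measurableT_comp; last exact: bf.1.
  exact: measurable_ln.
rewrite -etaE// /psi ler_pM2r ?invr_gt0// -[leRHS](Rintegral_cst1 nu).
apply: bm_le_Rintegral; [exact: bhf|exact: bm_cst|].
move=> x; apply: le_trans (tlnt (f x) _).
  by rewrite ler_wpM2r// ge_min lexx orbT.
by rewrite f_ge0 (le_trans (ler_norm _)).
Unshelve. all: by end_near. Qed.

End eigenmeasure.

(** * The growth rate of a control *)

Section control.
Variables (r : S * U * S -> \bar R).
Local Notation hist := (@history _ _ S U).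
Hypothesis rE : forall z, expeR (r z) = (E z)%:E.

Definition Eprod n (h : hist n) : R :=
  \prod_(m < n) E (hist_state h m, hist_control h m, hist_state h m.+1).

Lemma expeR_total_reward n (h : hist n) :
  expeR (total_reward r h) = (Eprod h)%:E.
Proof.
rewrite /total_reward /Eprod -prodEFin.
apply: (big_ind2 (fun a b => expeR a = b)) => [|a _ b _ <- <-|m _].
- exact: expeR0.
- by rewrite expeRD.
- exact: rE.
Qed.

Lemma Eprod_rcons n (h : hist n) u y :
  Eprod (hist_rcons h u y) = Eprod h * E (h.2, u, y).
Proof.
(* At [m = n] the old history returns its current state by default, while the extended one reads the
   same state from the pair just appended. *)
have st (m : nat) : (m <= n)%N -> hist_state (hist_rcons h u y) m = hist_state h m.
  rewrite /hist_state /hist_rcons/= /unzip1 map_rcons nth_rcons size_map size_tuple.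
  rewrite leq_eqVlt => /orP[/eqP ->|mn].
    by rewrite ltnn eqxx nth_default// size_map size_tuple.
  by rewrite mn; apply: set_nth_default; rewrite size_map size_tuple.
have stn : hist_state (hist_rcons h u y) n.+1 = y.
  by rewrite /hist_state/= nth_default// size_map size_rcons size_tuple.
have hn : hist_state h n = h.2.
  by rewrite /hist_state nth_default// size_map size_tuple.
rewrite /Eprod big_ord_recr/= stn st// hn; congr (_ * E (_, _, _)).
  apply: eq_bigr => i _; rewrite !st//; last exact: ltnW.
  congr (E (_, _, _)); rewrite /hist_control/=.
  rewrite (tnth_nth (h.2, u)) (tnth_nth (h.2, u)) /= nth_rcons size_tuple.
  by rewrite ltn_ord.
rewrite /hist_control (tnth_nth (h.2, u)) /= nth_rcons size_tuple ltnn eqxx//.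
Qed.

Lemma Eprod_ge0 n (h : hist n) : 0 <= Eprod h.
Proof. exact: prodr_ge0. Qed.

Lemma measurable_Eprod n : measurable_fun [set: hist n] (@Eprod n).
Proof.
apply: measurable_prod => m _.
have mtn : measurable_fun [set: hist n] (fun h : hist n => tnth h.1 m).
  exact: (measurableT_comp (@measurable_tnth _ (S * U)%type n m) measurable_fst).
have mst (k : nat) : measurable_fun [set: hist n] (fun h : hist n => hist_state h k).
  have [kn|nk] := ltnP k n.
    rewrite (_ : (fun _ => _) = fst \o (fun h : hist n => tnth h.1 (Ordinal kn))).
      apply: measurableT_comp; first exact: measurable_fst.
      exact: (measurableT_comp (@measurable_tnth _ (S * U)%type n _) measurable_fst).
    apply/funext => h /=; rewrite /hist_state (nth_map (h.2, point)) ?size_tuple//.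
    by rewrite (tnth_nth (h.2, point)).
  rewrite (_ : (fun _ => _) = snd); first exact: measurable_snd.
  by apply/funext => h; rewrite /hist_state nth_default// size_map size_tuple.
apply: measurableT_comp; first exact: measurable_E.
apply/measurable_fun_pairP; split => /=; last exact: mst.
apply/measurable_fun_pairP; split => /=; first exact: mst.
exact: (measurableT_comp measurable_snd mtn).
Qed.

(** The step law is an iterated mixture: draw a history from [m], then a control from [phi], then a
    state from [p]. *)
Lemma ge0_integral_step_law n (phi : R.-pker (hist n) ~> U)
    (m : probability (hist n) R) (F : hist n.+1 -> \bar R) :
  measurable_fun [set: hist n.+1] F -> (forall h, (0 <= F h)%E) ->
  (\int[step_law p phi m]_h F h =
   \int[m]_h \int[phi h]_u \int[p (h.2, u)]_y F (hist_rcons h u y))%E.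
Proof.
move=> mF F0.
have mg : measurable_fun [set: hist n * U] (fun hu => (hu.1.2, hu.2)).
  apply/measurable_fun_pairP; split => /=.
    exact: (measurableT_comp measurable_snd measurable_fst).
  exact: measurable_snd.
pose k1 : R.-pker (hist n) ~> (hist n * U)%type :=
  mkmap phi (@measurable_id _ (hist n * U)%type setT).
pose k2 : R.-pker (hist n * U)%type ~> (hist n.+1) :=
  mkmap (kprecomp p mg) (@measurable_hist_rcons _ _ S U n).
have mk2 : measurable_fun [set: hist n * U] (fun hu => \int[k2 hu]_z F z)%E.
  exact: (measurable_fun_integral_kernel (measurable_kernel k2)).
transitivity (\int[mixture (mixture m k1) k2]_h F h)%E.
  apply: eq_measure_integral => A mA _.
  rewrite /= /mixture ge0_integral_mixture//; last exact: measurable_kernel.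
  apply: eq_integral => h _.
  rewrite ge0_integral_kmap//; last exact: measurable_kernel.
rewrite ge0_integral_mixture// ge0_integral_mixture//; last first.
  by move=> hu; exact: integral_ge0.
apply: eq_integral => h _; rewrite ge0_integral_kmap//; last first.
  by move=> hu; exact: integral_ge0.
by apply: eq_integral => u _; rewrite ge0_integral_kmap.
Qed.

(** Conditionally on the history and the control, the new factor [E] times [f] of the new state
    integrates to [Gop f]; the control enters only through an average of [Gop f]. *)
Lemma hist_law_step (phi : control_policy) x n (f : S -> R) :
  bounded_measurable f -> (forall y, 0 <= f y) ->
  (\int[hist_law p phi x n.+1]_h (Eprod h * f h.2)%:E =
   \int[hist_law p phi x n]_h ((Eprod h)%:E *
     \int[phi n h]_u (Gop f (h.2, u))%:E))%E.
Proof.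
move=> bf f0; rewrite ge0_integral_step_law.
- apply: eq_integral => h _; rewrite -ge0_integralZl//.
  + apply: eq_integral => u _; rewrite /Gop -bm_integral_EFin; last exact/bm_mul/bf/bm_E1.
    rewrite -ge0_integralZl//.
    * by apply: eq_integral => y _; rewrite Eprod_rcons/= -EFinM mulrA.
    * by apply/measurable_EFinP; apply: measurable_funM; [exact: (bm_E1 _).1|exact: bf.1].
    * by move=> y _; rewrite lee_fin mulr_ge0.
    * by rewrite lee_fin Eprod_ge0.
  + apply/measurable_EFinP; apply: measurableT_comp; first exact: (Gop_bm bf).1.
    exact: pair1_measurable.
  + by move=> u _; rewrite lee_fin Gop_ge0.
  + by rewrite lee_fin Eprod_ge0.
- apply/measurable_EFinP; apply: measurable_funM; first exact: measurable_Eprod.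
  by apply: measurableT_comp; [exact: bf.1|exact: measurable_snd].
- by move=> h; rewrite lee_fin mulr_ge0// Eprod_ge0.
Qed.

Lemma hist_law0 (phi : control_policy) x (f : S -> R) :
  bounded_measurable f ->
  (\int[hist_law p phi x 0]_h (Eprod h * f h.2)%:E = (f x)%:E)%E.
Proof.
move=> bf; rewrite /= integral_dirac//=.
  by rewrite diracT mul1e /Eprod big_ord0 mul1r.
apply/measurable_EFinP; apply: measurable_funM; first exact: measurable_Eprod.
by apply: measurableT_comp; [exact: bf.1|exact: measurable_snd].
Qed.

Let mEf n (f : S -> R) : bounded_measurable f ->
  measurable_fun [set: hist n] (fun h : hist n => (Eprod h * f h.2)%:E).
Proof.
move=> bf; apply/measurable_EFinP; apply: measurable_funM; first exact: measurable_Eprod.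
by apply: measurableT_comp; [exact: bf.1|exact: measurable_snd].
Qed.

Lemma hist_law_upper s f (phi : control_policy) x n : supersolution s f ->
  (\int[hist_law p phi x n]_h (Eprod h * f h.2)%:E <= (s ^+ n * f x)%:E)%E.
Proof.
move=> [s0 cf f1 fs]; have bf := continuous_bm cf.
have f0 y : 0 <= f y by rewrite (le_trans ler01).
elim: n => [|n ih]; first by rewrite hist_law0// mul1r.
rewrite hist_law_step// exprS -mulrA EFinM.
apply: le_trans (_ : s%:E * \int[hist_law p phi x n]_h (Eprod h * f h.2)%:E <= _)%E; last first.
  by apply: lee_wpmul2l ih; rewrite lee_fin ltW.
rewrite -ge0_integralZl//; last 3 first.
- exact: mEf.
- by move=> h _; rewrite lee_fin mulr_ge0// Eprod_ge0.
- by rewrite lee_fin ltW.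
apply: ge0_le_integral => //.
- move=> h _; rewrite mule_ge0 ?lee_fin ?Eprod_ge0//.
  by apply: integral_ge0 => u _; rewrite lee_fin Gop_ge0.
- apply: emeasurable_funM; first by apply/measurable_EFinP; exact: measurable_Eprod.
  apply: (measurable_fun_integral_finite_kernel
    (fun hu : hist n * U => (Gop f (hu.1.2, hu.2))%:E) (phi n)).
    by move=> hu; rewrite lee_fin Gop_ge0.
  apply/measurable_EFinP; apply: measurableT_comp; first exact: (Gop_bm bf).1.
  apply/measurable_fun_pairP; split => /=.
    exact: (measurableT_comp measurable_snd measurable_fst).
  exact: measurable_snd.
- apply: emeasurable_funM; first exact: measurable_cst.
  exact: mEf.
move=> h _; rewrite EFinM muleCA; apply: lee_pmul; rewrite ?lee_fin ?Eprod_ge0//.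
  by apply: integral_ge0 => u _; rewrite lee_fin Gop_ge0.
apply: le_trans (_ : \int[kprob (phi n) h]_u (s * f h.2)%:E <= _)%E.
  apply: ge0_le_integral => //.
  - by move=> u _; rewrite lee_fin Gop_ge0.
  - apply/measurable_EFinP; apply: measurableT_comp; first exact: (Gop_bm bf).1.
    exact: pair1_measurable.
  - by move=> u _; rewrite lee_fin; exact: fs.
by rewrite bm_integral_EFin; [rewrite Rintegral_cst1 EFinM|exact: bm_cst].
Qed.

Lemma hist_law_lower (f : S -> R) (u : S -> U) (mu : measurable_fun [set: S] u)
    (c : R) (x : S) (n : nat) :
  continuous f -> (forall y, 0 <= f y) -> (forall y, Gop f (y, u y) = c * f y) ->
  0 <= c ->
  let mhu m := measurableT_comp mu (@measurable_snd _ _ (m.-tuple (S * U)) S) in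
  (\int[hist_law p (fun m => kdirac (mhu m)) x n]_h (Eprod h * f h.2)%:E
   = (c ^+ n * f x)%:E)%E.
Proof.
move=> cf f0 fc c0 mhu; have bf := continuous_bm cf.
elim: n => [|n ih]; first by rewrite hist_law0// mul1r.
rewrite hist_law_step// exprS -mulrA EFinM -ih -ge0_integralZl//; last 2 first.
- exact: mEf.
- by move=> h _; rewrite lee_fin mulr_ge0// Eprod_ge0.
- apply: eq_integral => h _; rewrite /kdirac integral_dirac//=; last first.
    apply/measurable_EFinP; apply: measurableT_comp; first exact: (Gop_bm bf).1.
    exact: pair1_measurable.
  by rewrite diracT mul1e fc -!EFinM mulrCA.
Qed.

Let measurable_Eprod_EFin n :
  measurable_fun [set: hist n] (fun h : hist n => (Eprod h)%:E).
Proof. by apply/measurable_EFinP; exact: measurable_Eprod. Qed.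

Let integral_total_reward (phi : control_policy) x n :
  (\int[hist_law p phi x n]_h expeR (total_reward r h) =
   \int[hist_law p phi x n]_h (Eprod h)%:E)%E.
Proof. by apply: eq_integral => h _; exact: expeR_total_reward. Qed.

Lemma optimal_growth_rate_le s f : supersolution s f ->
  (optimal_growth_rate p r <= (ln s)%:E)%E.
Proof.
move=> sf; have [s0 cf f1 _] := sf; have bf := continuous_bm cf.
apply: ge_ereal_sup => _ [x _ <-]; apply: ge_ereal_sup => _ [phi _ <-].
rewrite /growth_rate -(limn_einf_affine (ln s) (ln (f x))).
apply: le_limn_einf => n; apply: lee_wpmul2l; first by rewrite lee_fin invr_ge0.
have fx0 : 0 < f x by rewrite (lt_le_trans ltr01).
have sn0 : 0 < s ^+ n * f x by rewrite mulr_gt0// exprn_gt0.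
have -> : n%:R * ln s + ln (f x) = ln (s ^+ n * f x).
  by rewrite [RHS]lnM ?posrE ?exprn_gt0// lnXn// mulr_natl.
rewrite -lne_EFin// lee_lne ?in_itv/= ?leey ?andbT; last 2 first.
- by apply: integral_ge0 => h _; exact: expeR_ge0.
- by rewrite lee_fin ltW.
rewrite integral_total_reward; apply: le_trans (hist_law_upper phi x n sf).
apply: ge0_le_integral => //.
- by move=> h _; rewrite lee_fin Eprod_ge0.
- exact: measurable_Eprod_EFin.
- exact: mEf.
- by move=> h _; rewrite lee_fin ler_peMr// Eprod_ge0.
Qed.

(** As [f <= M], the expected product of rewards under the stationary policy [u] is at least
    [c ^+ n * (f x / M)], and the positive constant [f x / M] does not affect the rate. *)
Lemma optimal_growth_rate_ge (f : S -> R) (u : S -> U) (c : R) (x : S) :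
  measurable_fun [set: S] u -> continuous f -> (forall y, 0 <= f y) -> 0 < f x ->
  (forall y, Gop f (y, u y) = c * f y) -> 0 < c ->
  ((ln c)%:E <= optimal_growth_rate p r)%E.
Proof.
move=> mu cf f0 fx0 fc c0; have bf := continuous_bm cf.
pose mhu m := measurableT_comp mu (@measurable_snd _ _ (m.-tuple (S * U)) S).
pose phi : @control_policy _ _ S U R := fun m => kdirac (mhu m).
apply: le_trans (_ : growth_rate p r phi x <= _)%E; last first.
  apply: le_trans (_ : ereal_sup [set growth_rate p r phi x | phi in setT] <= _)%E.
    by apply: ereal_sup_ubound; exists phi.
  by apply: ereal_sup_ubound; exists x.
have [_ [M fM]] := bf.
have M0 : 0 < M by rewrite (lt_le_trans fx0)// (le_trans (ler_norm _)).
rewrite /growth_rate -(limn_einf_affine (ln c) (ln (f x / M))).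
apply: le_limn_einf => n; apply: lee_wpmul2l; first by rewrite lee_fin invr_ge0.
have fM0 : 0 < f x / M by rewrite divr_gt0.
have cn0 : 0 < c ^+ n * (f x / M) by rewrite mulr_gt0// exprn_gt0.
have -> : n%:R * ln c + ln (f x / M) = ln (c ^+ n * (f x / M)).
  by rewrite [RHS]lnM ?posrE ?exprn_gt0// lnXn// mulr_natl.
rewrite -lne_EFin// lee_lne ?in_itv/= ?leey ?andbT; last 2 first.
- by rewrite lee_fin ltW.
- by apply: integral_ge0 => h _; exact: expeR_ge0.
rewrite integral_total_reward.
have := hist_law_lower mu x n cf f0 fc (ltW c0) => /= H.
rewrite (mulrC (f x)) mulrCA EFinM -H -ge0_integralZl//; last 3 first.
- exact: mEf.
- by move=> h _; rewrite lee_fin mulr_ge0// Eprod_ge0.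
- by rewrite lee_fin invr_ge0 ltW.
apply: ge0_le_integral => //.
- by move=> h _; rewrite -EFinM lee_fin mulr_ge0 ?invr_ge0 ?(ltW M0)// mulr_ge0// Eprod_ge0.
- by apply: emeasurable_funM; [exact: measurable_cst|exact: mEf].
- exact: measurable_Eprod_EFin.
move=> h _; rewrite -EFinM lee_fin ler_pdivrMl// mulrC ler_wpM2r ?Eprod_ge0//.
by rewrite (le_trans (ler_norm _)).
Qed.

End control.

(** * The variational value *)

Section entropy_upper.
Variables (r : S * U * S -> \bar R).
Hypothesis rE : forall z, expeR (r z) = (E z)%:E.

Let m11 : measurable_fun [set: S * U * S] (fun z => z.1.1).
Proof. exact: (measurableT_comp measurable_fst measurable_fst). Qed.

(** Composing the two disintegrations, invariance says that the first and third marginals coincide;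
    this is what cancels the terms in [ln f]. *)
Lemma occupation_marginal (eta : probability (S * U * S)%type R)
    (h : S -> R) : ergodic_occupation eta -> bounded_measurable h ->
  \int[eta]_z h z.2 = \int[eta]_z h z.1.1.
Proof.
move=> [eta1 [eta2 [[dis1 dis2] inv]]] bh.
pose m1 := ppush eta m11.
pose m12 := ppush eta (@measurable_fst _ _ (S * U)%type S).
rewrite -(bm_Rintegral_ppush eta (@measurable_snd _ _ (S * U)%type S) bh).
rewrite -(bm_Rintegral_ppush eta m11 bh).
congr fine; apply: eq_measure_integral => A mA _.
transitivity (eta (setT `*` A)).
  by congr (eta _); apply/seteqP; split => z //= -[].
rewrite dis2//; transitivity (\int[m12]_xu eta2 xu A)%E => //.
rewrite (@ge0_integral_disintegrate _ _ S U R m12 m1 eta1 dis1)//; last first.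
  exact: (measurable_kernel eta2 A mA).
exact: inv.
Qed.

Lemma entropy_reward_le (s' s : R) f (eta : probability (S * U * S)%type R)
    (eta1 : R.-pker S ~> U) (eta2 : R.-pker (S * U) ~> S) :
  supersolution s' f -> s' < s -> ergodic_occupation eta ->
  disintegration eta eta1 eta2 -> (entropy_reward p r eta eta2 <= (ln s)%:E)%E.
Proof.
move=> [s'0 cf f1 fs'] s's erg [_ dis2].
have bf := continuous_bm cf; have [mf [F fF]] := bf.
have s0 : 0 < s by exact: lt_trans s's.
have F1 : 1 <= F by rewrite (le_trans (f1 point))// (le_trans (ler_norm _)).
have F0 : 0 < F by exact: lt_le_trans F1.
have f0 x : 0 < f x by exact: lt_le_trans (f1 x).
have fleF x : f x <= F by exact: le_trans (ler_norm _) (fF x).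
(* [E] may vanish, so [d] is added to keep the weight [w] bounded away from 0. As [f <= F], it adds
   at most [s - s' <= (s - s') f] to [Gop f <= s' f], so that [w] still has [p]-integral at most
   1. *)
pose d := (s - s') / F.
have d0 : 0 < d by rewrite divr_gt0// subr_gt0.
pose w (z : S * U * S) := (E z + d) * f z.2 / (s * f z.1.1).
have Ed0 z : 0 < E z + d by rewrite ltr_wpDl.
have mf1 : measurable_fun [set: S * U * S] (fun z => f z.1.1) by exact: measurableT_comp m11.
have mf2 : measurable_fun [set: S * U * S] (fun z => f z.2) by exact: measurableT_comp.
have mEd : measurable_fun [set: S * U * S] (fun z => E z + d).
  by apply: measurable_funD; [exact: measurable_E|exact: measurable_cst].
have mw : measurable_fun [set: S * U * S] w.
  apply: measurable_funM; first exact: measurable_funM.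
  rewrite (_ : (fun x => _) = (fun t => t `^ (-1)) \o (fun z => s * f z.1.1)); last first.
    by apply/funext => z /=; rewrite powR_inv1// mulr_ge0// ltW.
  apply: measurableT_comp; first exact: measurable_powR.
  by apply: measurable_funM; [exact: measurable_cst|exact: mf1].
pose a := d / (s * F); pose b := (C + d) * F / s.
have a0 : 0 < a by rewrite divr_gt0// mulr_gt0.
have sf0 x : 0 < s * f x by rewrite mulr_gt0.
have wab z : a <= w z <= b.
  apply/andP; split.
    rewrite /a /w ler_pM ?invr_ge0 ?(ltW d0)// ?mulr_ge0 ?(ltW s0) ?(ltW F0)//.
      have dE : d <= E z + d by rewrite lerDr.
      by rewrite (le_trans dE)// ler_peMr// ltW.
    by rewrite lef_pV2 ?posrE ?mulr_gt0// ler_pM2l.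
  rewrite /b /w ler_pM ?invr_ge0 ?(ltW (sf0 _))//.
  - by apply: mulr_ge0; exact: ltW.
  - by apply: ler_pM; rewrite ?lerD2r// ltW.
  - by rewrite lef_pV2 ?posrE// ler_peMr// ltW.
have w0 z : 0 < w z by have /andP[h _] := wab z; exact: lt_le_trans h.
pose g z := ln (w z).
have bg : bounded_measurable g.
  split; first by apply: measurableT_comp mw; exact: measurable_ln.
  exists (`|ln a| + `|ln b|) => z; have /andP[h1 h2] := wab z.
  have l1 : ln a <= g z by rewrite ler_ln ?posrE.
  have l2 : g z <= ln b by rewrite ler_ln ?posrE// (lt_le_trans (w0 z)).
  rewrite ler_norml; apply/andP; split.
    by rewrite (le_trans _ l1)// lerNl (le_trans (ler_norm _))// normrN lerDl.
  by rewrite (le_trans l2)// (le_trans (ler_norm _))// lerDr.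
have w1 xu : (\int[p xu]_y (w (xu, y))%:E <= 1)%E.
  have bE := bm_E1 xu.
  have bEf : bounded_measurable (fun y => E (xu, y) * f y) by exact: bm_mul.
  have bw : bounded_measurable (fun y => w (xu, y)).
    split; first by apply: measurableT_comp mw _; exact: pair1_measurable.
    by exists b => y; rewrite gtr0_norm//; case/andP: (wab (xu, y)).
  rewrite (_ : integral _ _ _ = (\int[kprob p xu]_y w (xu, y))%:E); last first.
    exact: (bm_integral_EFin (kprob p xu) bw).
  rewrite lee_fin.
  have -> : \int[kprob p xu]_y w (xu, y) =
      (s * f xu.1)^-1 * (Gop f xu + d * \int[kprob p xu]_y f y).
    rewrite /Gop -bm_RintegralZ// -bm_RintegralD//; last exact: bm_scale.
    rewrite -bm_RintegralZ; last by apply: bm_add => //; exact: bm_scale.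
    by apply: eq_Rintegral => y _; rewrite /w/=; ring.
  rewrite ler_pdivrMl// mulr1.
  have h1 : Gop f xu <= s' * f xu.1 by case: (xu) => x u; exact: fs'.
  have h2 : \int[kprob p xu]_y f y <= F.
    by rewrite (le_trans (ler_norm _))// bm_Rintegral_bound.
  have h3 : d * \int[kprob p xu]_y f y <= s - s'.
    rewrite (le_trans (y := d * F))//; first by rewrite ler_wpM2l// ltW.
    by rewrite /d divfK// gt_eqF.
  have h4 : s - s' <= (s - s') * f xu.1 by rewrite ler_peMr// subr_ge0 ltW.
  rewrite (le_trans (lerD h1 h3))// (le_trans (lerD (lexx _) h4))//.
  by rewrite -mulrDl addrC subrK.
pose m12 := ppush eta (@measurable_fst _ _ (S * U)%type S).
have gdis : \int[eta]_z g z = \int[m12]_xu \int[kprob eta2 xu]_y g (xu, y).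
  exact: bm_Rintegral_disintegrate.
have bG : bounded_measurable (fun xu => \int[kprob eta2 xu]_y g (xu, y)).
  exact: bm_measurable_kernel.
have gD : ((\int[eta]_z g z)%:E <=
    \int[marginal12 eta]_xu relative_entropy (eta2 xu) (p xu))%E.
  rewrite gdis -bm_integral_EFin//.
  apply: (@le_integral_nonmeas _ _ _ m12) => xu.
  rewrite -bm_integral_EFin; last first.
    have [mg [M gM]] := bg; split; last by exists M => y; exact: gM.
    by apply: measurableT_comp mg _; exact: pair1_measurable.
  apply: (@gibbs _ _ _ (eta2 xu) (p xu) (fun y => w (xu, y)) a b) => //.
  - exact: prob_kernel.
  - exact: prob_kernel.
  - by apply: measurableT_comp mw _; exact: pair1_measurable.
have bln1 : bounded_measurable (fun x => ln (f x)).
  split; first by apply: measurableT_comp mf; exact: measurable_ln.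
  exists (ln F) => x; rewrite ger0_norm ?ln_ge0// ler_ln ?posrE//.
have bln11 : bounded_measurable (fun z : S * U * S => ln (f z.1.1)).
  have [ml [M lM]] := bln1; split; last by exists M => z; exact: lM.
  exact: (measurableT_comp ml m11).
have bln2 : bounded_measurable (fun z : S * U * S => ln (f z.2)).
  have [ml [M lM]] := bln1; split; last by exists M => z; exact: lM.
  exact: (measurableT_comp ml).
(* [r <= ln (E + d)] holds even where [r = -oo], and [ln (E + d)] is [g + ln s] plus the difference
   of [ln f] between the first and third coordinates, of integral 0. *)
have rle : (\int[eta]_z r z <= (\int[eta]_z g z + ln s)%:E)%E.
  have -> : \int[eta]_z g z + ln s =
      \int[eta]_z (g z + (ln s + (ln (f z.1.1) - ln (f z.2)))).
    rewrite bm_RintegralD//; last first.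
      by apply: bm_add; [exact: bm_cst|exact: bm_sub].
    rewrite bm_RintegralD//; [|exact: bm_cst|exact: bm_sub].
    rewrite Rintegral_cst1 bm_RintegralB//.
    by rewrite (occupation_marginal erg bln1) subrr addr0.
  rewrite -bm_integral_EFin; last first.
    by apply: bm_add => //; apply: bm_add; [exact: bm_cst|exact: bm_sub].
  apply: le_integral_nonmeas => z.
  rewrite -lee_expeR rE /= lee_fin.
  have -> : g z + (ln s + (ln (f z.1.1) - ln (f z.2))) = ln (E z + d).
    rewrite /g /w ln_div ?posrE// ?mulr_gt0// !lnM ?posrE//.
    by ring.
  by rewrite lnK ?posrE// lerDl ltW.
rewrite /entropy_reward; apply: le_trans (leeB rle gD) _.
by rewrite -EFinB lee_fin addrC addKr.
Qed.

Lemma variational_value_le (s' s : R) f : supersolution s' f -> s' < s ->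
  (variational_value p r <= (ln s)%:E)%E.
Proof.
move=> sf s's; apply: ge_ereal_sup => _ [eta erg [eta1 [eta2 [dis ->]]]].
exact: entropy_reward_le sf s's erg dis.
Qed.

End entropy_upper.

Section entropy_lower.
Variables (r : S * U * S -> \bar R).
Hypothesis rE : forall z, expeR (r z) = (E z)%:E.
Variables (f : S -> R) (u : S -> U) (x0 : S).
Hypotheses (cf : continuous f) (f_ge0 : forall x, 0 <= f x) (fx0 : 0 < f x0)
  (mu : measurable_fun [set: S] u)
  (fu : forall x, Gop f (x, u x) = growth_bound * f x)
  (rho_gt0 : 0 < growth_bound).
Local Notation rho := growth_bound.

Let bf : bounded_measurable f. Proof. exact: continuous_bm. Qed.
Let bG : bounded_measurable (Gop f). Proof. exact: Gop_bm. Qed.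

Let mgraph : measurable_fun [set: S] (fun x => (x, u x)).
Proof. by apply/measurable_fun_pairP; split => //=; exact: measurable_id. Qed.

(** The density of the Doob transform of [p] by [f]. The value 1 where [Gop f] vanishes keeps it a
    probability density there. *)
Definition twist (z : S * U * S) : R :=
  if 0 < Gop f z.1 then E z * f z.2 / Gop f z.1 else 1.

Let Gf_ge0 xu : 0 <= Gop f xu. Proof. exact: Gop_ge0. Qed.

Let measurable_twist : measurable_fun [set: S * U * S] twist.
Proof.
have mG : measurable_fun [set: S * U * S] (fun z => Gop f z.1).
  exact: (measurableT_comp bG.1 measurable_fst).
apply: measurable_fun_ifT; last exact: measurable_cst.
  by apply: measurable_fun_ltr => //; exact: measurable_cst.
apply: measurable_funM.
  apply: measurable_funM; first exact: measurable_E.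
  exact: (measurableT_comp bf.1 measurable_snd).
rewrite (_ : (fun x => _) = (fun t => t `^ (-1)) \o (fun z => Gop f z.1)); last first.
  by apply/funext => z /=; rewrite powR_inv1.
by apply: measurableT_comp mG; exact: measurable_powR.
Qed.

Let twist_ge0 z : 0 <= twist z.
Proof. by rewrite /twist; case: ifPn => // _; rewrite divr_ge0// mulr_ge0. Qed.

Let twist1 xu : (\int[p xu]_y (twist (xu, y))%:E = 1)%E.
Proof.
rewrite /twist /=; case: ltP => G0; last by rewrite integral_cst// mul1e prob_kernel.
have bEf : bounded_measurable (fun y => E (xu, y) * f y).
  by apply: bm_mul => //; exact: bm_E1.
transitivity (\int[kprob p xu]_y ((Gop f xu)^-1 * (E (xu, y) * f y))%:E)%E.
  by apply: eq_integral => y _; rewrite mulrC.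
by rewrite bm_integral_EFin ?bm_RintegralZ ?mulVf ?gt_eqF//; exact: bm_scale.
Qed.

Definition twisted : R.-pker (S * U) ~> S :=
  mkdensity measurable_twist twist_ge0 twist1.

Let twistedP xu : is_density (twisted xu) (p xu) (fun y => twist (xu, y)).
Proof. exact: mkdensityP. Qed.

Let measurable_twist1 xu : measurable_fun [set: S] (fun y => twist (xu, y)).
Proof. by have [] := twistedP xu. Qed.

Lemma twisted_entropy xu : relative_entropy (twisted xu) (p xu) =
  (\int[twisted xu]_y (ln (twist (xu, y)))%:E)%E.
Proof.
have fin : (twisted xu [set: S] < +oo)%E by rewrite prob_kernel ltry.
rewrite (relative_entropyE fin (twistedP xu)) (integral_density (twistedP xu)).
  by apply: eq_integral => y _; rewrite -EFinM mulrC.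
apply/measurable_EFinP; apply: measurableT_comp (measurable_twist1 xu).
exact: measurable_ln.
Qed.

Lemma twisted_tilt A x : measurable A -> 0 < f x ->
  twisted (x, u x) A = (tilt f u \1_A x)%:E.
Proof.
move=> mA fx; have G0 : 0 < Gop f (x, u x) by rewrite fu mulr_gt0.
have [_ _ ->//] := twistedP (x, u x).
have bA : bounded_measurable (\1_A : S -> R) by exact: bm_indic.
rewrite /tilt indicE mem_set// mul1r mulrC -fu /Gop.
rewrite -bm_RintegralZ; last by apply: bm_mul; [exact: bm_E1|exact: bm_mul].
rewrite -bm_integral_EFin; last first.
  by apply: bm_scale; apply: bm_mul; [exact: bm_E1|exact: bm_mul].
rewrite integral_mkcond; apply: eq_integral => y _.
rewrite patchE indicE /twist/= G0; case: ifPn => _; last by rewrite !(mul0r, mulr0).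
by congr EFin; rewrite mul1r mulrC.
Qed.

Let measurable_lnf : measurable_fun [set: S] (fun x => ln (f x)).
Proof. by apply: measurableT_comp bf.1; exact: measurable_ln. Qed.

Section stationary.
Variable eta0 : probability S R.
Hypotheses
  (tilt_inv : forall h, bounded_measurable h ->
    \int[eta0]_x tilt f u h x = \int[eta0]_x h x)
  (eta0_pos : \int[eta0]_x \1_[set x | 0 < f x] x = 1)
  (eta0_lnf : eta0.-integrable [set: S] (EFin \o (fun x => ln (f x)))).

Let mpos : measurable [set x | 0 < f x].
Proof.
rewrite (_ : mkset _ = f @^-1` `]0, +oo[); last first.
  by apply/seteqP; split => x /=; rewrite in_itv/= andbT.
by rewrite -[X in measurable X]setTI; apply: bf.1 => //; exact: measurable_itv.
Qed.

Let eta0_null : eta0 [set x | f x <= 0] = 0%E.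
Proof.
rewrite (_ : mkset _ = ~` [set x | 0 < f x]); last first.
  by apply/seteqP; split => x /=; rewrite leNgt => /negP.
rewrite probability_setC//; apply/eqP; rewrite sube_eq ?fin_num_measure//= ?add0e.
rewrite -[X in (_ == X)%E]fineK ?fin_num_measure//.
by move: eta0_pos; rewrite /Rintegral integral_indic// setIT => ->.
Qed.

Let ae_pos : {ae eta0, forall x, 0 < f x}.
Proof.
exists [set x | f x <= 0]; split => //; last by move=> x /=; rewrite leNgt => /negP.
rewrite (_ : mkset _ = ~` [set x | 0 < f x]); first exact: measurableC.
by apply/seteqP; split => x /=; rewrite leNgt => /negP.
Qed.

(** On {f > 0} the twisted kernel under [u] is the [tilt] of an indicator, and [eta0] gives the
    complement mass 0. *)
Lemma twisted_invariant A : measurable A ->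
  (\int[eta0]_x twisted (x, u x) A = eta0 A)%E.
Proof.
move=> mA.
have meas : measurable_fun [set: S] (fun x => twisted (x, u x) A).
  exact: (measurableT_comp (measurable_kernel twisted A mA) mgraph).
have tiltE : (\int[eta0]_x twisted (x, u x) A = \int[eta0]_x (tilt f u \1_A x)%:E)%E.
  rewrite -[RHS](_ : (\int[eta0]_x ((\1_[set x | 0 < f x] x)%:E * twisted (x, u x) A) = _)%E).
    apply: ae_eq_integral => //.
      apply: emeasurable_funM => //.
      by apply/measurable_EFinP; exact: measurable_indic.
    by apply: filterS ae_pos => x fx _; rewrite indicE mem_set// mul1e.
  apply: eq_integral => x _; rewrite indicE; have [xP|xP] := boolP (x \in _).
    by rewrite inE in xP; rewrite mul1e twisted_tilt.
  by rewrite mul0e /tilt indicE (negbTE xP) mul0r.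
rewrite tiltE; have fin : (\int[eta0]_x (tilt f u \1_A x)%:E)%E \is a fin_num.
  rewrite -tiltE.
  exact: (fin_num_measure (mixture eta0 (kprecomp twisted mgraph))).
rewrite -(fineK fin) -[fine _]/(\int[eta0]_x tilt f u \1_A x) tilt_inv; last exact: bm_indic.
by rewrite /Rintegral integral_indic// setIT fineK// fin_num_measure.
Qed.

Let eta := graph_law eta0 twisted mu.

Let dis := graph_law_disintegration eta0 twisted mu.

Let marg12 := graph_law_marginal12 eta0 twisted mu.

Let marg3 := graph_law_marginal3 mu twisted_invariant.

Let nu := ppush eta0 mgraph.

Let measurable_lnG : measurable_fun [set: S * U] (fun xu => ln (Gop f xu)).
Proof. by apply: measurableT_comp bG.1; exact: measurable_ln. Qed.

Let lnGE : (\int[eta0]_x (ln (Gop f (x, u x)))%:E =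
  \int[eta0]_x ((ln rho)%:E + (ln (f x))%:E))%E.
Proof.
apply: ae_eq_integral => //.
- by apply/measurable_EFinP; exact: (measurableT_comp measurable_lnG mgraph).
- apply/measurable_EFinP; apply: measurable_funD => //; exact: measurable_cst.
- by apply: filterS ae_pos => x fx _; rewrite fu lnM ?posrE.
Qed.

Let norm_lnG_le x : `|ln (Gop f (x, u x))| <= `|ln rho| + `|ln (f x)|.
Proof.
(* Where [f] vanishes so does [Gop f], and [ln 0] is 0 for the real logarithm. *)
rewrite fu; have := f_ge0 x; rewrite le_eqVlt => /orP[/eqP <-|fx].
  by rewrite mulr0 ln0// normr0 addr_ge0.
by rewrite lnM ?posrE// ler_normD.
Qed.

Let integrable_lnG : nu.-integrable [set: S * U] (fun xu => (ln (Gop f xu))%:E).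
Proof.
apply/integrableP; split; first exact/measurable_EFinP.
rewrite ge0_integral_ppush//; last first.
  by apply: measurableT_comp => //; exact/measurable_EFinP.
apply: (@le_lt_trans _ _ (\int[eta0]_x (`|ln rho|%:E + `|(ln (f x))%:E|))%E).
  by apply: le_integral_nonmeas => x /=; rewrite lee_fin.
have i1 := integrable_abse eta0_lnf.
have i2 : eta0.-integrable [set: S] (cst `|ln rho|%:E).
  by apply: (bm_integrable eta0 (h := cst `|ln rho|)); exact: bm_cst.
by have := integrable_lty measurableT (integrableD measurableT i2 i1).
Qed.

(** The log-density, whose [eta]-integral is the entropy term. It has to be shown integrable before
    terms can be cancelled: its negative part by the general bound on [t ln t], its positive part
    through the integrability of [ln f]. *)
Let k z := ln (twist z).
Let kneg z := Num.max (- k z) 0.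

Let measurable_k : measurable_fun [set: S * U * S] k.
Proof. by apply: measurableT_comp measurable_twist; exact: measurable_ln. Qed.

Let measurable_kneg : measurable_fun [set: S * U * S] kneg.
Proof.
by apply: measurable_maxr; [exact: measurableT_comp|exact: measurable_cst].
Qed.

Let kneg_ge0 z : 0 <= kneg z. Proof. by rewrite le_max lexx orbT. Qed.

(** Against [p] the negative part becomes that of [t ln t] at [t = twist], which is at most 1. *)
Let integrable_kneg : eta.-integrable [set: S * U * S] (EFin \o kneg).
Proof.
apply/integrableP; split; first exact/measurable_EFinP.
under eq_integral do rewrite /= ger0_norm//.
rewrite ge0_integral_graph_law//; last exact/measurable_EFinP.
apply: (@le_lt_trans _ _ (\int[eta0]_x 1)%E); last first.
  by rewrite integral_cst// mul1e ltey_eq fin_num_measure.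
apply: le_integral_nonmeas => x.
rewrite (integral_density (twistedP _)); last first.
  apply/measurable_EFinP; apply: measurableT_comp measurable_kneg _.
  exact: pair1_measurable.
apply: (@le_trans _ _ (\int[p (x, u x)]_y 1)%E); last first.
  by rewrite integral_cst// mul1e prob_kernel.
apply: le_integral_nonmeas => y; rewrite -EFinM lee_fin /kneg.
rewrite maxr_pMl// mul0r ge_max ler01 andbT mulNr lerNl mulrC.
exact: mul_ln_geN1.
Qed.

(** Apply the logarithm to [E f / Gop f] with [E <= C]. In the degenerate cases the left side is 0,
    since [ln 1 = 0] and [ln 0 = 0]. *)
Let k_le z : k z <= `|ln C| + `|ln (f z.2)| + `|ln (Gop f z.1)|.
Proof.
have pos : 0 <= `|ln C| + `|ln (f z.2)| + `|ln (Gop f z.1)| by rewrite !addr_ge0.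
rewrite /k /twist; case: ltP => G0; last by rewrite ln1.
have := E_ge0 z; rewrite le_eqVlt => /orP[/eqP <-|Ez]; first by rewrite !mul0r ln0.
have := f_ge0 z.2; rewrite le_eqVlt => /orP[/eqP <-|fz]; first by rewrite mulr0 mul0r ln0.
rewrite ln_div ?posrE ?mulr_gt0// lnM ?posrE// lerD ?lerD ?ler_norm//.
  by rewrite (le_trans _ (ler_norm _))// ler_ln ?posrE.
by rewrite (le_trans (ler_norm _))// normrN.
Qed.

Let eta_lnf2 : eta.-integrable [set: S * U * S] (fun z => (ln (f z.2))%:E).
Proof. exact: (integrable_image measurable_snd marg3 eta0_lnf). Qed.

Let marg12nu A : measurable A -> eta (fst @^-1` A) = nu A.
Proof. exact: marg12. Qed.

Let eta_lnG : eta.-integrable [set: S * U * S] (fun z => (ln (Gop f z.1))%:E).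
Proof. exact: (integrable_image measurable_fst marg12nu integrable_lnG). Qed.

Let integrable_k : eta.-integrable [set: S * U * S] (EFin \o k).
Proof.
pose H z := kneg z + (`|ln C| + `|ln (f z.2)| + `|ln (Gop f z.1)|).
apply: (@le_integrable _ _ _ _ _ measurableT _ (EFin \o H)).
- exact/measurable_EFinP.
- move=> z _; rewrite /= lee_fin /H [leRHS]ger0_norm ?addr_ge0//.
  rewrite ler_norml; apply/andP; split.
    by rewrite lerNl (@le_trans _ _ (kneg z))// ?lerDl ?addr_ge0// le_max lexx.
  by rewrite (le_trans (k_le z))// lerDr.
- rewrite (_ : EFin \o H = (fun z => (kneg z)%:E + ((`|ln C|)%:E +
      `|(ln (f z.2))%:E| + `|(ln (Gop f z.1))%:E|))%E)//.
  apply: integrableD => //; apply: integrableD => //.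
    apply: integrableD => //; last exact: integrable_abse.
    by apply: (bm_integrable eta (h := cst `|ln C|)); exact: bm_cst.
  exact: integrable_abse.
Qed.

(** A law with density [twist] gives no mass to the zeros of [twist], and along the control [u] the
    function [Gop f] is [rho f], which is positive [eta0]-almost everywhere. *)
Let eta_null : eta.-negligible [set z | twist z <= 0 \/ Gop f z.1 <= 0].
Proof.
have mG0 : measurable [set xu | Gop f xu <= 0].
  rewrite (_ : mkset _ = Gop f @^-1` `]-oo, 0]); last first.
    by apply/seteqP; split => xu /=; rewrite in_itv.
  by rewrite -[X in measurable X]setTI; apply: bG.1 => //; exact: measurable_itv.
have mtw0 : measurable [set z | twist z <= 0].
  rewrite (_ : mkset _ = twist @^-1` `]-oo, 0]); last first.
    by apply/seteqP; split => xu /=; rewrite in_itv.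
  by rewrite -[X in measurable X]setTI; apply: measurable_twist => //; exact: measurable_itv.
apply: (@negligibleU _ _ _ _ [set z | twist z <= 0] (fst @^-1` [set xu | Gop f xu <= 0])).
- apply/negligibleP => //; rewrite -[LHS](_ : \int[eta]_z (\1_[set z | twist z <= 0] z)%:E = _)%E; last first.
    by rewrite integral_indic// setIT.
  rewrite ge0_integral_graph_law//.
    2: by apply/measurable_EFinP; exact: measurable_indic.
  rewrite integral0_eq// => x _.
  rewrite (integral_density (twistedP _)); last first.
    apply/measurable_EFinP.
    have mi : measurable_fun [set: S * U * S] (\1_[set z | twist z <= 0] : _ -> R).
      exact: measurable_indic.
    exact: (measurableT_comp mi (pair1_measurable _)).
  rewrite integral0_eq// => y _; rewrite -EFinM indicE.
  case: (boolP (_ \in _)); last by rewrite mul0r.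
  rewrite inE /= => tw0; have -> : twist (x, u x, y) = 0.
    by apply/le_anti; rewrite tw0 twist_ge0.
  by rewrite mulr0.
- apply/negligibleP; first by rewrite -[X in measurable X]setTI; exact: measurable_fst.
  transitivity (nu [set xu | Gop f xu <= 0]); first exact: marg12nu.
  transitivity (eta0 [set x | f x <= 0]); last exact: eta0_null.
  congr (eta0 _); apply/seteqP; split => x /=; rewrite fu.
    by rewrite pmulr_rle0.
  by rewrite pmulr_rle0.
Qed.

Let rlne z : r z = lne (E z)%:E.
Proof. by rewrite -rE expeRK. Qed.

Let ae_r : {ae eta, forall z, r z = (k z + (ln (Gop f z.1) - ln (f z.2)))%:E}.
Proof.
apply: negligibleS eta_null => z /= nr; apply: contrapT => /not_orP[].
move=> /negP; rewrite -ltNge => tw0 /negP; rewrite -ltNge => G0; apply: nr.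
move: tw0; rewrite /k /twist G0 pmulr_lgt0 ?invr_gt0// => Ef0.
have E0 : 0 < E z.
  rewrite lt_neqAle E_ge0 andbT; apply: contraTN Ef0 => /eqP <-.
  by rewrite mul0r ltxx.
have f0 : 0 < f z.2 by move: Ef0; rewrite pmulr_rgt0.
rewrite rlne lne_EFin//; congr EFin.
by rewrite ln_div ?posrE ?mulr_gt0// lnM ?posrE//; ring.
Qed.

(** Almost everywhere [r] is [k + ln (Gop f) - ln f], the last term taken at the new state. The
    entropy cancels [k]; along [u] the second term is [ln rho + ln f] at the old state, and
    stationarity cancels the two integrals of [ln f], which are finite. *)
Lemma twisted_reward : entropy_reward p r eta twisted = (ln rho)%:E.
Proof.
have mr : measurable_fun [set: S * U * S] r.
  rewrite (_ : r = (fun t => lne t%:E) \o E); last by apply/funext => z /=.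
  by apply: measurableT_comp measurable_E; exact: measurable_lne_EFin.
pose m12 := ppush eta (@measurable_fst _ _ (S * U)%type S).
have entE : (\int[marginal12 eta]_xu relative_entropy (twisted xu) (p xu) =
    \int[eta]_z (k z)%:E)%E.
  transitivity (\int[m12]_xu relative_entropy (twisted xu) (p xu))%E => //.
  transitivity (\int[m12]_xu \int[twisted xu]_y (k (xu, y))%:E)%E.
    by apply: eq_integral => xu _; rewrite twisted_entropy.
  exact/esym/(@integral_disintegrate _ _ _ _ _ eta m12 twisted dis.2 _ integrable_k).
have lnfE : (\int[eta]_z (ln (f z.2))%:E = \int[eta0]_x (ln (f x))%:E)%E.
  exact: (integral_image measurable_snd marg3 eta0_lnf).
have lnGE2 : (\int[eta]_z (ln (Gop f z.1))%:E =
    (ln rho)%:E + \int[eta0]_x (ln (f x))%:E)%E.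
  rewrite (integral_image measurable_fst marg12nu integrable_lnG).
  rewrite -(integral_image (m := eta0) mgraph (nu := nu) _ integrable_lnG)// lnGE integralD//.
    rewrite integral_cst// [X in (_ * X)%E](_ : _ = 1%E) ?mule1//.
    exact: probability_setT.
  by apply: (bm_integrable eta0 (h := cst (ln rho))); exact: bm_cst.
have iGf : eta.-integrable [set: S * U * S]
    (fun z => (ln (Gop f z.1) - ln (f z.2))%:E).
  exact: integrableB eta_lnG eta_lnf2.
rewrite /entropy_reward entE.
rewrite (ae_eq_integral (fun z => (k z)%:E + (ln (Gop f z.1) - ln (f z.2))%:E)%E)//; last first.
- by apply: filterS ae_r => z ->.
- have /integrableP[+ _] := iGf; move=> miGf; apply: emeasurable_funD => //.
  exact/measurable_EFinP.
rewrite integralD// (integralB _ eta_lnG eta_lnf2)// lnGE2 lnfE.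
have /fineK <- : (\int[eta]_z (k z)%:E)%E \is a fin_num.
  exact: integrable_fin_num integrable_k.
have /fineK <- : (\int[eta0]_x (ln (f x))%:E)%E \is a fin_num.
  exact: integrable_fin_num eta0_lnf.
by rewrite -!EFinD; congr EFin => /=; ring.
Qed.

End stationary.
Lemma variational_value_ge : ((ln rho)%:E <= variational_value p r)%E.
Proof.
have [eta0 [inv pos [B BE]]] := exists_stationary cf f_ge0 fx0 mu fu rho_gt0.
have iln : eta0.-integrable [set: S] (EFin \o (fun x => ln (f x))).
  apply: (@le_integrable _ _ _ _ _ measurableT _ (EFin \o (fun x => `|ln (f x)|))).
  - exact/measurable_EFinP.
  - by move=> x _; rewrite /= lee_fin normr_id.
  - by apply: (integrable_monotone_bound (B := B)) => //; exact: measurableT_comp.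
have einv := twisted_invariant inv pos.
apply: ereal_sup_ubound; exists (graph_law eta0 twisted mu).
  exact: graph_law_ergodic einv.
exists (kdirac mu), twisted; split; first exact: graph_law_disintegration.
by rewrite twisted_reward.
Qed.

End entropy_lower.

Lemma growth_rate_variational (r : S * U * S -> \bar R) :
  (forall z, expeR (r z) = (E z)%:E) ->
  optimal_growth_rate p r = variational_value p r.
Proof.
move=> rE; transitivity (lne growth_bound%:E); last apply/esym.
- apply: (eq_lne_lim growth_bound_ge0) => [s rs|rho0].
    have [s' s's [f sf]] := growth_bound_lt rs.
    apply: le_trans (optimal_growth_rate_le rE sf) _.
    have [s'0 _ _ _] := sf; have s0 := lt_trans s'0 s's.
    by rewrite lee_fin ler_ln ?posrE// ltW.
  have [f [cf f0 [x fx] fT]] := eigenfunction rho0.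
  have [u mu fu] := optimal_selector cf.
  apply: (optimal_growth_rate_ge rE mu cf f0 fx) => // y.
  by rewrite fu fT.
- apply: (eq_lne_lim growth_bound_ge0) => [s rs|rho0].
    have [s' s's [f sf]] := growth_bound_lt rs.
    exact: (variational_value_le rE sf s's).
  have [f [cf f0 [x fx] fT]] := eigenfunction rho0.
  have [u mu fu] := optimal_selector cf.
  apply: (variational_value_ge rE cf f0 fx mu) => // y.
  by rewrite fu fT.
Qed.

End bellman.

Unset Implicit Arguments.

Theorem theorem4 (R : realType) (dS dU : measure_display)
    (S : borelMetricType dS R) (U : borelMetricType dU R)
    (compactS : compact [set: S]) (compactU : compact [set: U])
    (p : R.-pker (S * U) ~> S) (r : S * U * S -> \bar R)
    (r_lty : forall z, r z < +oo)
    (A0 : continuous (fun z : S * U * S => fine (expeR (r z))))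
    (A1 : equicontinuous
      [set f : S -> R | continuous f /\ (forall y, `|f y| <= 1)%R]
      (fun (f : S -> R) (xu : S * U) => (\int[p xu]_y f y)%R)) :
  optimal_growth_rate p r = variational_value p r.
Proof.
pose E z := fine (expeR (r z)).
have rE z : expeR (r z) = (E z)%:E.
  rewrite /E fineK// ge0_fin_numE ?expeR_ge0//.
  by have := r_lty z; case: (r z) => [x||] //= _; rewrite ltry.
have E0 z : (0 <= E z)%R by rewrite fine_ge0// expeR_ge0.
have cSUS : compact [set: S * U * S].
  by rewrite -!setXTT; apply: compact_setX => //; exact: compact_setX.
have [z0 _ z0E] : exists2 c, c \in [set: S * U * S] &
    forall t, t \in [set: S * U * S] -> (E t <= E c)%R.
  apply: compact_EVT_max => //; first by exists point.
  exact: continuous_subspaceT.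
(* The [+ 1] makes the bound on [E] positive even if [E] vanishes identically. *)
apply: (@growth_rate_variational R dS dU S U compactS compactU p E (E z0 + 1)) => //.
- by rewrite ltr_wpDl.
- by move=> z; rewrite (le_trans (z0E z _)) ?inE// lerDl.
Qed.
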